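(* Assume (C1), (C2) and (C3), and suppose that for every $z\in\mathcal Z$ the indicator $I(Z=z)$ is an affine function of $X$. Let $\hat b_1,\dots,\hat b_k$ be $p$-vectors with $\hat b_t\to b_t$ in probability, and put $B=(b_1,\dots,b_k)$. (i) As $n\to\infty$, $\sqrt n\{\hat\theta(\hat b_1,\dots,\hat b_k)-\theta\}\to N(0,V(B))$ in distribution, where $$V(B)=V_{\rm SR}(B)-E\big[R(B)\{\Omega_{\rm SR}-\Omega(Z_i)\}R(B)\big],$$ with $V_{\rm SR}(B)=\mathrm{diag}\{\pi_t^{-1}\mathrm{var}(Y^{(t)}-b_t^\top X)\}+\mathscr B^\top\Sigma_XB+B^\top\Sigma_X\mathscr B-B^\top\Sigma_XB$, $\Omega_{\rm SR}=\mathrm{diag}(\pi_t)-\pi\pi^\top$, $\pi=(\pi_1,\dots,\pi_k)^\top$, and $R(B)=\mathrm{diag}\big(\pi_t^{-1}E\{Y_i^{(t)}-\theta_t-b_t^\top(X_i-\mu_X)\mid Z_i\}\big)$. Moreover $R(\mathscr B)=0$, hence $V(\mathscr B)=V_{\rm SR}(\mathscr B)$. (ii) $V(B)-V(\mathscr B)$ is positive semidefinite for every $p\times k$ matrix $B$.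
   Context: Setup: $k$ arms; potential responses $Y^{(1)},\dots,Y^{(k)}$; discrete covariate $Z$; $p$-dimensional covariate $X$. (C1): $(Y_i^{(1)},\dots,Y_i^{(k)},Z_i,X_i)$, $i=1,\dots,n$, i.i.d. with finite second moments, covariate distribution unaffected by treatment, $\Sigma_X=\mathrm{var}(X)$ positive definite. $\pi_t\in(0,1)$, $\sum_t\pi_t=1$. $A_i\in\{a_1,\dots,a_k\}$ ($a_t$ the standard basis vectors of $\mathbb R^k$), $Y_i=Y_i^{(t)}$ iff $A_i=a_t$. (C2): $Z$ takes values in a finite set $\mathcal Z$; (i) given $\{Z_i\}$, $\{A_i\}$ is conditionally independent of $\{(Y_i^{(1)},\dots,Y_i^{(k)},X_i)\}$; (ii) $n_t(z)/n(z)\to\pi_t$ a.s. for all $z,t$, where $n(z)=\#\{i:Z_i=z\}$, $n_t(z)=\#\{i:Z_i=z,A_i=a_t\}$. (C3): there exist $k\times k$ matrices $\Omega(z)$, $z\in\mathcal Z$, such that conditionally on $Z_1,\dots,Z_n$, $\sqrt n\big(n_1(z)/n(z)-\pi_1,\dots,n_k(z)/n(z)-\pi_k,\ z\in\mathcal Z\big)^\top\to N(0,D)$ in distribution, where $D$ is block diagonal with blocks $\Omega(z)/P(Z_i=z)$, $z\in\mathcal Z$. Notation: $\theta_t=EY^{(t)}$, $\mu_X=EX$, $\beta_t=\Sigma_X^{-1}\mathrm{cov}(X,Y^{(t)})$, $\mathscr B=(\beta_1,\dots,\beta_k)$, $\mathrm{diag}(d_t)$ the diagonal $k\times k$ matrix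 with entries $d_t$. $\hat\theta(\hat b_1,\dots,\hat b_k)=(\bar Y_1-\hat b_1^\top(\bar X_1-\bar X),\dots,\bar Y_k-\hat b_k^\top(\bar X_k-\bar X))^\top$ with $\bar Y_t,\bar X_t$ arm-$t$ sample means and $\bar X$ the overall mean of $X_i$. (Components of $b_t$ corresponding to dummy variables for $Z$ may be zero, so this covers estimators not adjusting for $Z$.) *)

(* Defs.v *)
From HB Require Import structures.
From mathcomp Require Import all_boot all_order all_algebra.
From mathcomp Require Import all_classical all_reals all_analysis.
Set Implicit Arguments. Unset Strict Implicit. Unset Printing Implicit Defensive.
Import Order.TTheory GRing.Theory Num.Theory.
Import numFieldNormedType.Exports.
Local Open Scope classical_set_scope.
Local Open Scope ring_scope.

Section Defs.
Context {R : realType} {d : measure_display} {T : measurableType d}.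
Variable P : probability T R.

Definition Ex (f : T -> R) : R := fine ('E_P[f])%E.
Definition cov (f g : T -> R) : R :=
  Ex (fun w => (f w - Ex f) * (g w - Ex g)).
Definition var (f : T -> R) : R := cov f f.
Definition prob (A : set T) : R := fine (P A).

Definition cvg_in_prob (u : nat -> T -> R) (l : R) : Prop :=
  forall eps : R, 0 < eps ->
    (fun n => prob [set w | eps < `|u n w - l|]) @ \oo --> 0.

(* Characteristic-function definition of a centred Gaussian random matrix:
   G ~ N(0, q), where q is the quadratic form ("covariance"), i.e.
   E exp(i <u, G>) = exp(- q(u) / 2) for all u. *)
Definition mx_inner (a b : nat) (u M : 'M[R]_(a, b)) : R :=
  \sum_(i < a) \sum_(j < b) u i j * M i j.

Definition is_centred_normal {d' : measure_display} {T' : measurableType d'}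
  (Q : probability T' R) (a b : nat) (G : T' -> 'M[R]_(a, b))
  (q : 'M[R]_(a, b) -> R) : Prop :=
  (forall i j, measurable_fun setT (fun w => G w i j)) /\
  (forall u : 'M[R]_(a, b),
      fine ('E_Q[fun w => cos (mx_inner u (G w))])%E = expR (- (q u / 2)) /\
      fine ('E_Q[fun w => sin (mx_inner u (G w))])%E = 0).

Definition bounded_continuous (a b : nat) (f : 'M[R]_(a, b) -> R) : Prop :=
  continuous f /\ exists M : R, forall x, `|f x| <= M.

Definition cvg_dist_normal (a b : nat) (S : nat -> T -> 'M[R]_(a, b))
  (q : 'M[R]_(a, b) -> R) : Prop :=
  exists (d' : measure_display) (T' : measurableType d') (Q : probability T' R)
         (G : T' -> 'M[R]_(a, b)),
    is_centred_normal Q G q /\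
    forall f : 'M[R]_(a, b) -> R, bounded_continuous f ->
      (fun n => Ex (fun w => f (S n w))) @ \oo
        --> fine ('E_Q[fun w => f (G w)])%E.

Section Sample.
Variables (k p : nat) (zT : finType).
Variables (Y : nat -> 'I_k -> T -> R) (Z : nat -> T -> zT)
          (X : nat -> 'I_p -> T -> R) (A : nat -> T -> 'I_k).

Definition Zev (n : nat) (w0 : T) : set T :=
  [set w | forall i, (i < n)%N -> Z i w = Z i w0].

Definition condE_Zn (n : nat) (f : T -> R) (w0 : T) : R :=
  Ex (fun w => f w * (\1_(Zev n w0) w)) / prob (Zev n w0).

Definition cond_cvg_dist_normal (a b : nat) (S : nat -> T -> 'M[R]_(a, b))
  (q : 'M[R]_(a, b) -> R) : Prop :=
  exists (d' : measure_display) (T' : measurableType d') (Q : probability T' R)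
         (G : T' -> 'M[R]_(a, b)),
    is_centred_normal Q G q /\
    forall f : 'M[R]_(a, b) -> R, bounded_continuous f ->
      {ae P, forall w0, (fun n => condE_Zn n (fun w => f (S n w)) w0) @ \oo
                          --> fine ('E_Q[fun w => f (G w)])%E}.

Definition nZ (n : nat) (z : zT) (w : T) : nat :=
  #|[set i : 'I_n | Z i w == z]|.
Definition ntZ (n : nat) (t : 'I_k) (z : zT) (w : T) : nat :=
  #|[set i : 'I_n | (Z i w == z) && (A i w == t)]|.
Definition nt (n : nat) (t : 'I_k) (w : T) : nat :=
  #|[set i : 'I_n | A i w == t]|.

Definition Ybar (n : nat) (t : 'I_k) (w : T) : R :=
  (\sum_(i < n | A i w == t) Y i t w) / (nt n t w)%:R.
Definition Xbar_arm (n : nat) (t : 'I_k) (j : 'I_p) (w : T) : R :=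
  (\sum_(i < n | A i w == t) X i j w) / (nt n t w)%:R.
Definition Xbar (n : nat) (j : 'I_p) (w : T) : R :=
  (\sum_(i < n) X i j w) / n%:R.

Definition theta_hat (n : nat) (b : 'M[R]_(p, k)) (w : T) : 'cV[R]_k :=
  \col_t (Ybar n t w - \sum_j b j t * (Xbar_arm n t j w - Xbar n j w)).

(* (C1): i.i.d. with finite second moments, var(X) positive definite.
   Independence / identical distribution stated through rectangle events
   of the joint vector (Y_i^(1..k), Z_i, X_i). *)
Definition rect_ev (i : nat) (SY : 'I_k -> set R) (SZ : {set zT})
  (SX : 'I_p -> set R) : set T :=
  [set w | (forall t, SY t (Y i t w)) /\ Z i w \in SZ /\ (forall j, SX j (X i j w))].

Definition C1 : Prop :=
  (forall i t, measurable_fun setT (Y i t)) /\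
  (forall i j, measurable_fun setT (X i j)) /\
  (forall i z, measurable [set w | Z i w = z]) /\
  (forall (n : nat) (SY : nat -> 'I_k -> set R) (SZ : nat -> {set zT})
          (SX : nat -> 'I_p -> set R),
     (forall i t, measurable (SY i t)) -> (forall i j, measurable (SX i j)) ->
     P (\bigcap_(i in [set i | (i < n)%N]) rect_ev i (SY i) (SZ i) (SX i))
     = (\prod_(i < n) P (rect_ev i (SY i) (SZ i) (SX i)))%E) /\
  (forall (i : nat) (SY : 'I_k -> set R) (SZ : {set zT}) (SX : 'I_p -> set R),
     (forall t, measurable (SY t)) -> (forall j, measurable (SX j)) ->
     P (rect_ev i SY SZ SX) = P (rect_ev 0%N SY SZ SX)) /\
  (forall i t, P.-integrable setT (fun w => (Y i t w ^+ 2)%:E)) /\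
  (forall i j, P.-integrable setT (fun w => (X i j w ^+ 2)%:E)).

Definition C2 (pi : 'I_k -> R) : Prop :=
  (forall i t, measurable [set w | A i w = t]) /\
  (forall (n : nat) (a : 'I_n -> 'I_k) (zs : 'I_n -> zT)
          (SY : 'I_n -> 'I_k -> set R) (SX : 'I_n -> 'I_p -> set R),
     (forall i t, measurable (SY i t)) -> (forall i j, measurable (SX i j)) ->
     let EA := [set w | forall i : 'I_n, A i w = a i] in
     let EYX := [set w | forall i : 'I_n,
                   (forall t, SY i t (Y i t w)) /\ (forall j, SX i j (X i j w))] in
     let EZ := [set w | forall i : 'I_n, Z i w = zs i] in
     (P (EA `&` EYX `&` EZ) * P EZ = P (EA `&` EZ) * P (EYX `&` EZ))%E) /\
  (forall z t, {ae P, forall w,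
     (fun n => (ntZ n t z w)%:R / (nZ n z w)%:R : R) @ \oo --> pi t}).

Definition Dform (Omg : zT -> 'M[R]_k) (u : 'M[R]_(k, #|zT|)) : R :=
  \sum_(z : zT)
    ((col (enum_rank z) u)^T *m Omg z *m col (enum_rank z) u) 0 0
      / prob [set w | Z 0%N w = z].

Definition C3 (pi : 'I_k -> R) (Omg : zT -> 'M[R]_k) : Prop :=
  cond_cvg_dist_normal
    (fun n w => \matrix_(t < k, c < #|zT|)
        (Num.sqrt n%:R * ((ntZ n t (enum_val c) w)%:R / (nZ n (enum_val c) w)%:R
                          - pi t)))
    (Dform Omg).

End Sample.

(* Population quantities, computed from the unit-0 variables *)
Section Population.
Variables (k p : nat) (zT : finType).
Variables (Y0 : 'I_k -> T -> R) (Z0 : T -> zT) (X0 : 'I_p -> T -> R).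
Variables (pi : 'I_k -> R) (Omg : zT -> 'M[R]_k).

Definition theta : 'cV[R]_k := \col_t Ex (Y0 t).
Definition muX : 'cV[R]_p := \col_j Ex (X0 j).
Definition SigmaX : 'M[R]_p := \matrix_(j, l) cov (X0 j) (X0 l).
Definition scriptB : 'M[R]_(p, k) :=
  invmx SigmaX *m \matrix_(j, t) cov (X0 j) (Y0 t).

Definition VSR (B : 'M[R]_(p, k)) : 'M[R]_k :=
  diag_mx (\row_t ((pi t)^-1 * var (fun w => Y0 t w - \sum_j B j t * X0 j w)))
  + scriptB^T *m SigmaX *m B + B^T *m SigmaX *m scriptB - B^T *m SigmaX *m B.

Definition OmegaSR : 'M[R]_k :=
  diag_mx (\row_t pi t) - (\col_t pi t) *m (\col_t pi t)^T.

Definition condE_Z (f : T -> R) (z : zT) : R :=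
  Ex (fun w => f w * (Z0 w == z)%:R) / prob [set w | Z0 w = z].

Definition Rmat (B : 'M[R]_(p, k)) (z : zT) : 'M[R]_k :=
  diag_mx (\row_t ((pi t)^-1 *
    condE_Z (fun w => Y0 t w - theta t 0 - \sum_j B j t * (X0 j w - muX j 0)) z)).

Definition Vmat (B : 'M[R]_(p, k)) : 'M[R]_k :=
  VSR B - \matrix_(s, t)
            Ex (fun w => (Rmat B (Z0 w) *m (OmegaSR - Omg (Z0 w)) *m Rmat B (Z0 w)) s t).

End Population.

Definition posdef (m : nat) (M : 'M[R]_m) : Prop :=
  forall u : 'cV[R]_m, u != 0 -> 0 < (u^T *m M *m u) 0 0.
Definition psd (m : nat) (M : 'M[R]_m) : Prop :=
  forall u : 'cV[R]_m, 0 <= (u^T *m M *m u) 0 0.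

End Defs.

(* Main.v *)
(* Fix a direction [u].  Up to a term negligible in probability,
   [u . sqrt n (theta_hat - theta)] is the sum of three parts: a normalized sum
   of terms that depend on a unit's arm, stratum and data and are centred given
   the stratum; a normalized sum of functions of the strata alone; and a linear
   form in the imbalances [sqrt n (n_t(z) / n(z) - pi_t)].  Given all arms and
   strata the data of the units are independent, so the characteristic function
   of the first part factorizes and may be replaced by a Gaussian one; (C3)
   given the strata then handles the imbalances, and the i.i.d. central limit
   theorem the remaining part.  The limit is [exp (- u^T V(B) u / 2)], and
   Levy's continuity theorem gives (i).

   When the stratum indicators are affine in [X], the residuals of the
   population regression are uncorrelated with them, whence [R(scriptB) = 0].
   For (ii), centring the residuals for [B] within strata gives the residuals
   for [scriptB] plus an orthogonal term. *)

Require Import Defs.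
From mathcomp Require Import all_boot all_order all_algebra.
From mathcomp Require Import all_classical all_reals all_analysis.
From mathcomp Require Import measurable_realfun complex ring lra.
Set Implicit Arguments.
Unset Strict Implicit.
Unset Printing Implicit Defensive.
Import Order.TTheory GRing.Theory Num.Theory.
Import numFieldNormedType.Exports.
Local Open Scope classical_set_scope.
Local Open Scope ring_scope.

Section Expectation.
Context {R : realType} {d : measure_display} {T : measurableType d}.
Variable P : probability T R.
Implicit Types f g : T -> R.

Lemma ExE f : Ex P f = fine (\int[P]_w (f w)%:E).
Proof. by rewrite /Ex unlock. Qed.

Lemma EFin_Ex f : P.-integrable setT (EFin \o f) ->
  (\int[P]_w (f w)%:E)%E = (Ex P f)%:E.
Proof. by move=> fi; rewrite ExE fineK//; exact: integrable_fin_num. Qed.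

Lemma bounded_integrable f (M : R) : measurable_fun setT f ->
  (forall w, `|f w| <= M) -> P.-integrable setT (EFin \o f).
Proof.
move=> mf fM; apply: measurable_bounded_integrable => //.
  by rewrite (le_lt_trans (probability_le1 P measurableT))// ltry.
exists M; split; first exact: num_real.
by move=> N MN w _; exact: le_trans (fM w) (ltW MN).
Qed.

Lemma integrable_measurable f : P.-integrable setT (EFin \o f) ->
  measurable_fun setT f.
Proof. by move=> /integrableP[/measurable_EFinP]. Qed.

Lemma le_integrable_real f g : measurable_fun setT f ->
  (forall w, `|f w| <= g w) -> P.-integrable setT (EFin \o g) ->
  P.-integrable setT (EFin \o f).
Proof.
move=> mf fg; apply: le_integrable => //; first exact/measurable_EFinP.
by move=> w _ /=; rewrite lee_fin (le_trans (fg w))// ler_norm.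
Qed.

Lemma Ex_cst (r : R) : Ex P (fun=> r) = r.
Proof. by rewrite /Ex expectation_cst. Qed.

Lemma integrable_cst (r : R) : P.-integrable setT (EFin \o (fun _ : T => r)).
Proof. by apply: (@bounded_integrable _ `|r|). Qed.

Lemma integrable_addr f g : P.-integrable setT (EFin \o f) ->
  P.-integrable setT (EFin \o g) ->
  P.-integrable setT (EFin \o (fun w => f w + g w)).
Proof.
move=> fi gi; rewrite (_ : EFin \o _ = ((EFin \o f) \+ (EFin \o g))%E)//.
exact: integrableD.
Qed.

Lemma integrable_scale (r : R) f : P.-integrable setT (EFin \o f) ->
  P.-integrable setT (EFin \o (fun w => r * f w)).
Proof.
move=> fi; rewrite (_ : EFin \o _ = fun w => r%:E * (EFin \o f) w)%E//.
exact: integrableZl.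
Qed.

Lemma integrable_subr f g : P.-integrable setT (EFin \o f) ->
  P.-integrable setT (EFin \o g) ->
  P.-integrable setT (EFin \o (fun w => f w - g w)).
Proof.
move=> fi gi; rewrite (_ : EFin \o _ = ((EFin \o f) \- (EFin \o g))%E)//.
exact: integrableB.
Qed.

Lemma integrable_sumr (I : finType) (A : pred I) (F : I -> T -> R) :
  (forall i, A i -> P.-integrable setT (EFin \o F i)) ->
  P.-integrable setT (EFin \o (fun w => \sum_(i | A i) F i w)).
Proof.
move=> Fi.
have -> : EFin \o (fun w => \sum_(i | A i) F i w) =
          fun w => (\sum_(i | A i) (F i w)%:E)%E.
  by apply/funext => w /=; rewrite -sumEFin.
by apply: (@integrable_sum _ _ _ P setT measurableT _ (index_enum I) A
             (fun i => EFin \o F i)).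
Qed.

Lemma ExD f g : P.-integrable setT (EFin \o f) ->
  P.-integrable setT (EFin \o g) ->
  Ex P (fun w => f w + g w) = Ex P f + Ex P g.
Proof.
move=> fi gi; rewrite !ExE.
rewrite (_ : (\int[P]_w (f w + g w)%:E)%E =
  (\int[P]_w (f w)%:E + \int[P]_w (g w)%:E)%E); last exact: integralD_EFin.
by rewrite fineD//; exact: integrable_fin_num.
Qed.

Lemma ExZ (r : R) f : P.-integrable setT (EFin \o f) ->
  Ex P (fun w => r * f w) = r * Ex P f.
Proof.
move=> fi; rewrite !ExE.
rewrite (_ : (\int[P]_w (r * f w)%:E)%E = (r%:E * \int[P]_w (f w)%:E)%E).
  by rewrite fineM//; exact: integrable_fin_num.
by under eq_integral do rewrite EFinM; exact: integralZl.
Qed.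

Lemma ExN f : P.-integrable setT (EFin \o f) ->
  Ex P (fun w => - f w) = - Ex P f.
Proof.
by move=> fi; under eq_fun do rewrite -mulN1r; rewrite ExZ// mulN1r.
Qed.

Lemma integrable_oppr f : P.-integrable setT (EFin \o f) ->
  P.-integrable setT (EFin \o (fun w => - f w)).
Proof.
by move=> fi; under eq_fun do rewrite -mulN1r; exact: integrable_scale.
Qed.

Lemma ExB f g : P.-integrable setT (EFin \o f) ->
  P.-integrable setT (EFin \o g) ->
  Ex P (fun w => f w - g w) = Ex P f - Ex P g.
Proof.
by move=> fi gi; rewrite ExD ?ExN//; exact: integrable_oppr.
Qed.

Lemma Ex_sum (I : finType) (A : pred I) (F : I -> T -> R) :
  (forall i, A i -> P.-integrable setT (EFin \o F i)) ->
  Ex P (fun w => \sum_(i | A i) F i w) = \sum_(i | A i) Ex P (F i).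
Proof.
move=> Fi; pose G i : T -> R := if A i then F i else fun=> 0.
have Gi i : P.-integrable setT (EFin \o G i).
  by rewrite /G; case: ifPn => [/Fi//|_]; exact: integrable_cst.
transitivity (Ex P (fun w => \sum_i G i w)).
  congr Ex; apply/funext => w; rewrite big_mkcond/=; apply: eq_bigr => i _.
  by rewrite /G; case: ifP.
rewrite ExE; under eq_integral do rewrite -sumEFin.
rewrite (@integral_sum _ _ _ P setT measurableT I (fun i => EFin \o G i))//.
under eq_bigr do rewrite /= EFin_Ex//.
rewrite sumEFin/= [RHS]big_mkcond/=; apply: eq_bigr => i _.
by rewrite /G; case: ifP => // _; rewrite Ex_cst.
Qed.

Lemma Ex_le f g : P.-integrable setT (EFin \o f) ->
  P.-integrable setT (EFin \o g) -> (forall w, f w <= g w) ->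
  Ex P f <= Ex P g.
Proof.
move=> fi gi fg; rewrite -lee_fin -!EFin_Ex//.
by apply: le_integral => // w _; rewrite lee_fin.
Qed.

Lemma Ex_ge0 f : (forall w, 0 <= f w) -> 0 <= Ex P f.
Proof. by move=> f0; rewrite /Ex fine_ge0// expectation_ge0. Qed.

Lemma integrable_normr f : P.-integrable setT (EFin \o f) ->
  P.-integrable setT (EFin \o (fun w => `|f w|)).
Proof. by move=> fi; exact: integrable_norm. Qed.

Lemma Ex_norm f : P.-integrable setT (EFin \o f) ->
  `|Ex P f| <= Ex P (fun w => `|f w|).
Proof.
move=> fi; rewrite ler_norml lerNl -ExN//; apply/andP.
split; apply: Ex_le => //; try exact: integrable_normr.
- exact: integrable_oppr.
- by move=> w; rewrite -normrN ler_norm.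
- by move=> w; exact: ler_norm.
Qed.

Lemma Ex_bound f (M : R) : measurable_fun setT f ->
  (forall w, `|f w| <= M) -> `|Ex P f| <= M.
Proof.
move=> mf fM; have fi := bounded_integrable mf fM.
rewrite (le_trans (Ex_norm fi))// -[leRHS]Ex_cst; apply: Ex_le => //.
  exact: integrable_normr.
exact: integrable_cst.
Qed.

Lemma Ex_indic (A : set T) : measurable A -> Ex P (\1_A) = prob P A.
Proof. by move=> mA; rewrite /Ex expectation_indic. Qed.

Lemma eq_Ex_ae f g : measurable_fun setT f -> measurable_fun setT g ->
  {ae P, forall w, f w = g w} -> Ex P f = Ex P g.
Proof.
move=> mf mg fg; rewrite !ExE; congr fine.
apply: ae_eq_integral => //; [exact/measurable_EFinP..|].
by apply: filterS fg => w -> _.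
Qed.

Lemma cvg_Ex_ae (F : nat -> T -> R) f g :
  (forall n, measurable_fun setT (F n)) -> measurable_fun setT f ->
  {ae P, forall w, F n w @[n --> \oo] --> f w} ->
  P.-integrable setT (EFin \o g) -> (forall n w, `|F n w| <= g w) ->
  Ex P (F n) @[n --> \oo] --> Ex P f.
Proof.
move=> mF mf Ff gi Fg.
have mF' n : measurable_fun setT (EFin \o F n) by exact/measurable_EFinP.
have mf' : measurable_fun setT (EFin \o f) by exact/measurable_EFinP.
have Ff' : {ae P, forall w, setT w ->
    (EFin \o F n) w @[n --> \oo] --> (EFin \o f) w}.
  by apply: filterS Ff => w Fw _; exact/cvg_EFin/Fw/nearW.
have Fg' : {ae P, forall w n, setT w -> (`|(EFin \o F n) w| <= (EFin \o g) w)%E}.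
  by apply: aeW => w n _ /=; rewrite lee_fin.
have [fi _] := @dominated_convergence _ _ _ P _ measurableT _ _ _ mF' mf' Ff' gi Fg'.
rewrite /= EFin_Ex// => cF.
under eq_fun do rewrite ExE.
exact: fine_cvg cF.
Qed.

Lemma cvg_Ex (F : nat -> T -> R) f g :
  (forall n, measurable_fun setT (F n)) ->
  (forall w, F n w @[n --> \oo] --> f w) ->
  P.-integrable setT (EFin \o g) -> (forall n w, `|F n w| <= g w) ->
  Ex P (F n) @[n --> \oo] --> Ex P f.
Proof.
move=> mF Ff; apply: cvg_Ex_ae => //; last exact/aeW.
exact: (@measurable_fun_cvg _ _ _ _ F).
Qed.

Lemma probE (A : set T) : measurable A -> P A = (prob P A)%:E.
Proof. by move=> mA; rewrite /prob fineK// fin_num_measure. Qed.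

Lemma prob_ge0 (A : set T) : 0 <= prob P A.
Proof. by rewrite /prob fine_ge0. Qed.

Lemma probU_le (A B : set T) : measurable A -> measurable B ->
  prob P (A `|` B) <= prob P A + prob P B.
Proof.
move=> mA mB; rewrite -lee_fin EFinD -!probE//; last exact: measurableU.
exact: measureU2.
Qed.

Lemma prob_eq1 (A : set T) : measurable A ->
  {ae P, forall w, A w} -> prob P A = 1.
Proof.
move=> mA Aw; rewrite -(Ex_cst 1) -Ex_indic//.
apply: eq_Ex_ae => //.
by apply: filterS Aw => w Aw; rewrite indicE mem_set.
Qed.
End Expectation.

Section RealMeasurability.
Context {R : realType} {d : measure_display} {T : measurableType d}.

Lemma measurable_cos_comp (f : T -> R) : measurable_fun setT f ->
  measurable_fun setT (fun w => cos (f w)).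
Proof.
move=> mf; apply: measurableT_comp mf.
by apply: continuous_measurable_fun; exact: continuous_cos.
Qed.

Lemma measurable_sin_comp (f : T -> R) : measurable_fun setT f ->
  measurable_fun setT (fun w => sin (f w)).
Proof.
move=> mf; apply: measurableT_comp mf.
by apply: continuous_measurable_fun; exact: continuous_sin.
Qed.

Lemma measurable_expR_comp (f : T -> R) : measurable_fun setT f ->
  measurable_fun setT (fun w => expR (f w)).
Proof.
move=> mf; apply: measurableT_comp mf.
by apply: continuous_measurable_fun; exact: continuous_expR.
Qed.

Lemma measurable_sumr (I : finType) (A : pred I) (F : I -> T -> R) :
  (forall i, A i -> measurable_fun setT (F i)) ->
  measurable_fun setT (fun w => \sum_(i | A i) F i w).
Proof.
move=> mF; under eq_fun do rewrite big_mkcond/=.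
apply: measurable_sum => i; case: (boolP (A i)) => [/mF//|_].
exact: measurable_cst.
Qed.

Lemma measurable_scale (r : R) (f : T -> R) : measurable_fun setT f ->
  measurable_fun setT (fun w => r * f w).
Proof. by move=> mf; apply: measurable_funM => //; exact: measurable_cst. Qed.

Lemma measurable_gt_set (f : T -> R) (c : R) : measurable_fun setT f ->
  measurable [set w | c < f w].
Proof.
move=> mf; have := mf measurableT `]c, +oo[%classic (measurable_itv _).
rewrite setTI; congr measurable; apply/seteqP; split=> w /=;
  by rewrite in_itv/= andbT.
Qed.

Lemma cvg_Rintegral (mu : {measure set T -> \bar R}) (F : nat -> T -> R) f g :
  (forall n, measurable_fun setT (F n)) ->
  (forall w, F n w @[n --> \oo] --> f w) ->
  mu.-integrable setT (EFin \o g) -> (forall n w, `|F n w| <= g w) ->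
  (\int[mu]_w F n w) @[n --> \oo] --> \int[mu]_w f w.
Proof.
move=> mF Ff gi Fg.
have mf : measurable_fun setT f by exact: (@measurable_fun_cvg _ _ _ _ F).
have mF' n : measurable_fun setT (EFin \o F n) by exact/measurable_EFinP.
have mf' : measurable_fun setT (EFin \o f) by exact/measurable_EFinP.
have Ff' : {ae mu, forall w, setT w ->
    (EFin \o F n) w @[n --> \oo] --> (EFin \o f) w}.
  by apply: aeW => w _; exact/cvg_EFin/Ff/nearW.
have Fg' : {ae mu, forall w n, setT w ->
    (`|(EFin \o F n) w| <= (EFin \o g) w)%E}.
  by apply: aeW => w n _ /=; rewrite lee_fin.
have [fi _] :=
  @dominated_convergence _ _ _ mu _ measurableT _ _ _ mF' mf' Ff' gi Fg'.
move=> cF; apply: fine_cvg.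
by rewrite fineK//; exact: integrable_fin_num.
Qed.

Lemma integrable_real_normr (mu : {measure set T -> \bar R}) (f : T -> R) :
  mu.-integrable setT (EFin \o f) ->
  mu.-integrable setT (EFin \o (fun x => `|f x|)).
Proof. by move=> fi; exact: integrable_norm. Qed.

Lemma integrable_real_sub (mu : {measure set T -> \bar R}) (f g : T -> R) :
  mu.-integrable setT (EFin \o f) -> mu.-integrable setT (EFin \o g) ->
  mu.-integrable setT (EFin \o (fun x => f x - g x)).
Proof.
move=> fi gi; rewrite (_ : EFin \o _ = ((EFin \o f) \- (EFin \o g))%E)//.
exact: integrableB.
Qed.

End RealMeasurability.

(** * Gaussian vectors *)

Section GaussianKernel.
Context {R : realType}.
Local Notation mu := (@lebesgue_measure R).

Definition gkernel (x : R) : R := expR (- (x ^+ 2 / 2)).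

Lemma normal_pdf01 (x : R) : normal_pdf 0 1 x = normal_peak 1 * gkernel x.
Proof.
rewrite normal_pdfE ?oner_neq0// /normal_fun /gkernel subr0 expr1n.
by rewrite mulNr.
Qed.

Lemma gkernel_ge0 x : 0 <= gkernel x.
Proof. exact: expR_ge0. Qed.

Lemma measurable_gkernel : measurable_fun setT gkernel.
Proof.
apply: measurable_expR_comp; apply: measurableT_comp => //.
by apply: measurable_funM => //; exact: measurable_funX.
Qed.

Lemma integrable_gkernel : mu.-integrable setT (EFin \o gkernel).
Proof.
have -> : EFin \o gkernel =
    fun x => (((normal_peak 1)^-1 : R)%:E * (normal_pdf 0 1 x)%:E)%E.
  apply/funext => x /=; rewrite normal_pdf01 -EFinM mulKf//.
  by rewrite gt_eqF// normal_peak_gt0// oner_neq0.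
by apply: integrableZl => //; exact: integrable_normal_pdf.
Qed.

Lemma le_normr_gkernel (x : R) : `|x| * gkernel x <= expR (- (x ^+ 2 / 4)).
Proof.
have -> : gkernel x = expR (- (x ^+ 2 / 4)) * expR (- (x ^+ 2 / 4)).
  by rewrite -expRD; congr expR; field.
rewrite mulrA ler_piMl ?expR_ge0// expRN ler_pdivrMr ?expR_gt0// mul1r.
apply: le_trans (expR_ge1Dx _); rewrite -real_normK ?num_real//.
have := sqr_ge0 (`|x| / 2 - 1); lra.
Qed.

Lemma integrable_normr_gkernel :
  mu.-integrable setT (EFin \o (fun x => `|x| * gkernel x)).
Proof.
have s2 : Num.sqrt 2 != 0 :> R by rewrite gt_eqF// sqrtr_gt0.
apply: (@le_integrable _ _ _ mu setT measurableT _
    (EFin \o (fun x => expR (- (x ^+ 2 / 4))))) => //.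
- apply/measurable_EFinP/measurable_funM; last exact: measurable_gkernel.
  exact: measurableT_comp (@normr_measurable R setT) _.
- move=> x _ /=; rewrite lee_fin [leRHS]ger0_norm ?expR_ge0//.
  by rewrite ger0_norm ?mulr_ge0 ?gkernel_ge0// le_normr_gkernel.
have -> : EFin \o (fun x : R => expR (- (x ^+ 2 / 4))) = fun x =>
    (((normal_peak (Num.sqrt 2))^-1 : R)%:E * (normal_pdf 0 (Num.sqrt 2) x)%:E)%E.
  apply/funext => x /=; rewrite normal_pdfE// -EFinM mulKf.
    rewrite /normal_fun subr0 sqr_sqrtr// mulNr; congr (expR (- (_ / _)))%:E.
    by ring.
  by rewrite gt_eqF// normal_peak_gt0.
by apply: integrableZl => //; exact: integrable_normal_pdf.
Qed.

Lemma is_derive_gkernel (x : R) : is_derive x 1 gkernel (- x * gkernel x).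
Proof.
have -> : gkernel = expR \o (fun y => (- 2^-1) * (y ^+ 2)).
  by apply/funext => y; rewrite /gkernel /= mulNr mulrC.
apply: is_derive_eq.
by rewrite /= /GRing.scale/= /GRing.scale/=; field.
Qed.

Lemma gkernel_cvg0 : gkernel n%:R @[n --> \oo] --> (0 : R).
Proof.
have b n : 0 <= gkernel n.+1%:R <= (n.+1%:R^-1 : R).
  rewrite gkernel_ge0/= -[leRHS]mul1r ler_pdivlMr ?ltr0n// mulrC.
  have := le_normr_gkernel (n.+1%:R : R); rewrite ger0_norm// => /le_trans; apply.
  by rewrite -[leRHS]expR0 ler_expR oppr_le0 divr_ge0// sqr_ge0.
rewrite -(cvg_shiftS (fun n => gkernel n%:R)).
apply: (@squeeze_cvgr _ _ _ _ (cst 0) (@harmonic R)) => //.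
- by apply: nearW => n; exact: b.
- exact: cvg_cst.
- exact: cvg_harmonic.
Qed.

Lemma Rintegral_derive_eq0 (F D : R -> R) :
  (forall x : R, is_derive x 1 F (D x)) -> continuous D ->
  mu.-integrable setT (EFin \o D) ->
  F n%:R @[n --> \oo] --> (0 : R) -> F (- n%:R) @[n --> \oo] --> (0 : R) ->
  \int[mu]_x D x = 0.
Proof.
move=> dF cD iD Fp Fm.
have mD : measurable_fun setT D by exact: continuous_measurable_fun.
pose Dn (n : nat) (x : R) := D x * \1_(`[- n%:R, n%:R]) x.
have c1 : (\int[mu]_x Dn n x) @[n --> \oo] --> \int[mu]_x D x.
  apply: (@cvg_Rintegral _ _ _ mu Dn D (fun x => `|D x|)).
  - by move=> n; apply: measurable_funM => //; exact: measurable_indic.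
  - move=> x; apply: cvg_near_cst; exists (Num.bound `|x|) => // n /= xn.
    rewrite /Dn indicE mem_set ?mulr1// /= in_itv/= -ler_norml.
    by rewrite (le_trans (ltW (archi_boundP (normr_ge0 x))))// ler_nat.
  - exact: (@integrable_real_normr _ _ _ mu D).
  - move=> n x; rewrite /Dn normrM ler_piMr// indicE.
    by case: (_ \in _); rewrite ?normr1 ?normr0.
have c2 : (\int[mu]_x Dn n x) @[n --> \oo] --> (0 : R).
  rewrite (_ : 0 = 0 - 0 :> R); last by rewrite subr0.
  apply: (cvg_trans _ (cvgB Fp Fm)).
  apply: near_eq_cvg; exists 1%N => // n /= n0.
  have nn : - n%:R < n%:R :> R.
    by rewrite (@lt_trans _ _ 0)// ?oppr_lt0 ltr0n.
  have cF : continuous F.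
    by move=> x; apply/differentiable_continuous/derivable1_diffP; case: (dF x).
  have e := @continuous_FTC2 R D F _ _ nn (continuous_subspaceT cD).
  rewrite /Rintegral (_ : (\int[mu]_x (Dn n x)%:E)%E =
      (\int[mu]_(x in `[(- n%:R)%R, n%:R]) (D x)%:E)%E); last first.
    rewrite [RHS]integral_mkcond; apply: eq_integral => x _.
    by rewrite /Dn patchE indicE; case: ifP; rewrite ?mulr1 ?mulr0.
  rewrite e//.
  - split; first by move=> x _; case: (dF x).
    + exact/cvg_at_right_filter/cF.
    + exact/cvg_at_left_filter/cF.
  - by move=> x _; rewrite derive1E; case: (dF x).
by apply: cvg_unique c2.
Qed.

End GaussianKernel.

Section NormalCharacteristicFunction.
Context {R : realType}.
Local Notation mu := (@lebesgue_measure R).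

Let C (a v : R) : R := \int[mu]_x (cos (v * x + a) * gkernel x).

Lemma integrable_bounded_gkernel (f : R -> R) (M : R) :
  measurable_fun setT f -> (forall x, `|f x| <= M) ->
  mu.-integrable setT (EFin \o (fun x => f x * gkernel x)).
Proof.
move=> mf fM; apply: (@le_integrable _ _ _ mu setT measurableT _
    (fun x => (M%:E * (gkernel x)%:E)%E)).
- by apply/measurable_EFinP/measurable_funM => //; exact: measurable_gkernel.
- move=> x _ /=; rewrite lee_fin !normrM ler_wpM2r//.
  by rewrite (le_trans (fM x))// ler_norm.
- by apply: integrableZl => //; exact: integrable_gkernel.
Qed.

Lemma measurable_affine (v a : R) : measurable_fun setT (fun x : R => v * x + a).
Proof.
by apply: measurable_funD => //; exact: measurable_scale.
Qed.

Let dcos (x a v : R) :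
  is_derive v 1 (fun v => cos (v * x + a) * gkernel x)
    (- (x * gkernel x * sin (v * x + a))).
Proof.
have -> : (fun v => cos (v * x + a) * gkernel x) =
  gkernel x \*: (cos \o (fun v => x * v + a)).
  by apply/funext => y /=; rewrite /GRing.scale/= [y * x]mulrC [LHS]mulrC.
apply: is_derive_eq.
by rewrite /GRing.scale/= ?mulr0 ?mulr1 ?add0r ?addr0 [x * v]mulrC; ring.
Qed.

Let intsin (v a : R) :
  mu.-integrable setT (EFin \o (fun x => x * gkernel x * sin (v * x + a))).
Proof.
apply: (@le_integrable _ _ _ mu setT measurableT _
    (EFin \o (fun x => `|x| * gkernel x))).
- apply/measurable_EFinP/measurable_funM.
    by apply: measurable_funM => //; exact: measurable_gkernel.
  by apply: measurable_sin_comp; exact: measurable_affine.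
- move=> x _ /=; rewrite lee_fin !normrM normr_id.
  by apply: ler_piMr; [rewrite mulr_ge0|exact: sin_max].
- exact: integrable_normr_gkernel.
Qed.

Let derC (a v : R) :
  is_derive v 1 (C a) (- \int[mu]_x (x * gkernel x * sin (v * x + a))).
Proof.
have E : (\int[mu]_x partial1of2 (fun v x => cos (v * x + a) * gkernel x) v x) =
   - \int[mu]_x (x * gkernel x * sin (v * x + a)).
  rewrite -mulN1r -RintegralZl//.
  apply: eq_Rintegral => x _; rewrite mulN1r partial1of2E.
  by case: (dcos x a v).
have H := @cvg_differentiation_under_integral R _ _ mu
  (fun v x => cos (v * x + a) * gkernel x) setT measurableT v (v - 1) (v + 1).
have {}H : h^-1 *: (C a (h + v) - C a v) @[h --> 0^'] -->
    - \int[mu]_x (x * gkernel x * sin (v * x + a)).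
  rewrite -E; apply: (H _ _ _ (fun x => `|x| * gkernel x)).
  - by rewrite /= in_itv/=; apply/andP; split; lra.
  - move=> x _; apply: (@integrable_bounded_gkernel _ 1).
      by apply: measurable_cos_comp; exact: measurable_affine.
    by move=> y; exact: cos_max.
  - by move=> x y _ _; case: (dcos y a x).
  - by move=> y; rewrite mulr_ge0// gkernel_ge0.
  - exact: integrable_normr_gkernel.
  - move=> x y _ _; rewrite partial1of2E.
    case: (dcos y a x) => _ ->; rewrite normrN !normrM [`|gkernel _|]ger0_norm ?gkernel_ge0//.
    by apply: ler_piMr; [rewrite mulr_ge0// gkernel_ge0|exact: sin_max].
apply: DeriveDef.
  by apply/cvg_ex; eexists; under eq_fun do rewrite scaler1; exact: H.
by apply/cvg_lim => //; under eq_fun do rewrite scaler1; exact: H.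
Qed.

Let parts (a v : R) :
  \int[mu]_x (x * gkernel x * sin (v * x + a)) = v * C a v.
Proof.
have dF (x : R) : is_derive x 1 (fun x => sin (v * x + a) * gkernel x)
    (v * (cos (v * x + a) * gkernel x) - x * gkernel x * sin (v * x + a)).
  have -> : (fun x => sin (v * x + a) * gkernel x) =
    (sin \o (fun x => v * x + a)) * gkernel by [].
  have dg := is_derive_gkernel x.
  apply: is_derive_eq.
  by rewrite /GRing.scale/= ?mulr0 ?mulr1 ?add0r ?addr0; ring.
have cg : continuous (@gkernel R).
  move=> x; apply/differentiable_continuous/derivable1_diffP.
  by case: (is_derive_gkernel x).
have ca : continuous (fun x : R => v * x + a).
  move=> x; apply: cvgD; last exact: cvg_cst.
  by apply: cvgM; [exact: cvg_cst|exact: cvg_id].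
have iC : mu.-integrable setT
    (EFin \o (fun x => v * (cos (v * x + a) * gkernel x))).
  under eq_fun do rewrite mulrA.
  apply: (@integrable_bounded_gkernel _ `|v|).
    apply: measurable_scale; apply: measurable_cos_comp.
    exact: measurable_affine.
  by move=> x; rewrite normrM ler_piMr// cos_max.
have bnd (x : R) : `|sin (v * x + a) * gkernel x| <= gkernel x.
  rewrite normrM [`|gkernel _|]ger0_norm ?gkernel_ge0//.
  by apply: ler_piMl; [exact: gkernel_ge0|exact: sin_max].
have vanish (b : nat -> R) : (forall n, `|b n| <= gkernel n%:R) ->
    b n @[n --> \oo] --> (0 : R).
  move=> bg; apply: norm_cvg0.
  apply: (@squeeze_cvgr _ _ _ _ (cst 0) (fun n => gkernel n%:R)).
  - by apply: nearW => n; rewrite normr_ge0 bg.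
  - exact: cvg_cst.
  - exact: gkernel_cvg0.
have e0 : \int[mu]_x (v * (cos (v * x + a) * gkernel x)
                      - x * gkernel x * sin (v * x + a)) = 0.
  apply: (@Rintegral_derive_eq0 R _ _ dF).
  - move=> x; apply: cvgB.
      apply: cvgM; first exact: cvg_cst.
      apply: cvgM; last exact: cg.
      exact: (continuous_comp (ca x) (@continuous_cos R _)).
    apply: cvgM; first by apply: cvgM; [exact: cvg_id|exact: cg].
    exact: (continuous_comp (ca x) (@continuous_sin R _)).
  - by apply: integrable_real_sub => //; exact: intsin.
  - by apply: vanish => n; exact: bnd.
  - apply: vanish => n.
    by rewrite -[gkernel n%:R]/(expR _) -sqrrN; exact: bnd.
move: e0; rewrite RintegralB// => /eqP; rewrite subr_eq0 => /eqP <-.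
rewrite RintegralZl//; apply: (@integrable_bounded_gkernel _ 1).
  by apply: measurable_cos_comp; exact: measurable_affine.
by move=> x; exact: cos_max.
Qed.

Lemma Rintegral_cos_gkernel (a v : R) :
  \int[mu]_x (cos (v * x + a) * gkernel x) =
  cos a * expR (- (v ^+ 2 / 2)) * (normal_peak 1)^-1.
Proof.
have d0 (y : R) : is_derive y 1 (fun y => C a y * expR (y ^+ 2 / 2)) 0.
  have dC := derC a y.
  have -> : (fun y => C a y * expR (y ^+ 2 / 2)) =
      C a * (expR \o (fun y => 2^-1 * (y ^+ 2))).
    by apply/funext => z; rewrite /= mulrC [_ / 2]mulrC mulrC.
  apply: is_derive_eq; rewrite parts /GRing.scale/= /GRing.scale/=.
  by field.
have := is_derive_0_is_cst v 0 d0.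
rewrite expr0n/= mul0r expR0 mulr1 => /(congr1 ( *%R^~ (expR (- (v ^+ 2 / 2))))).
rewrite -mulrA -expRD subrr expR0 mulr1 {1}/C => ->.
rewrite /C; under eq_Rintegral do rewrite mul0r add0r.
rewrite RintegralZl//; last exact: integrable_gkernel.
suff -> : \int[mu]_x gkernel x = (normal_peak 1)^-1 by rewrite mulrAC.
have peak0 : (normal_peak 1 : R) != 0.
  by rewrite gt_eqF// normal_peak_gt0// oner_neq0.
apply: (mulfI peak0); rewrite mulfV//.
rewrite -RintegralZl//; last exact: integrable_gkernel.
rewrite /Rintegral; under eq_integral do rewrite -normal_pdf01.
by rewrite integral_normal_pdf.
Qed.

Lemma Ex_normal01 (f : R -> R) (M : R) : measurable_fun setT f ->
  (forall x, `|f x| <= M) ->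
  Ex (normal_prob 0 1) f = normal_peak 1 * \int[mu]_x (f x * gkernel x).
Proof.
move=> mf fM; rewrite ExE -RintegralZl//; last first.
  exact: integrable_bounded_gkernel fM.
rewrite /Rintegral; congr fine.
have fi := @bounded_integrable R _ _ (normal_prob 0 1) f M mf fM.
rewrite -(Radon_Nikodym_change_of_variables (normal_prob_dominates 0 1))//=.
transitivity (\int[mu]_x ((f x)%:E * (normal_pdf 0 1 x)%:E))%E; last first.
  by apply: eq_integral => x _; rewrite normal_pdf01 -EFinM mulrCA.
apply: ae_eq_integral => //.
- apply: emeasurable_funM; first exact/measurable_EFinP.
  apply: (measurable_int mu).
  by apply: Radon_Nikodym_integrable; exact: normal_prob_dominates.
- apply: emeasurable_funM; apply/measurable_EFinP => //.
  exact: measurable_normal_pdf.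
- apply: ae_eqe_mul2l => /=.
  rewrite Radon_NikodymE//=; first exact: normal_prob_dominates.
  move=> ?; case: cid => /= h [h1 h2 h3].
  apply: integral_ae_eq => //=.
  + by apply/measurable_EFinP; exact: measurable_normal_pdf.
  + by move=> E _ mE; rewrite -h3.
Qed.

Lemma Ex_cos_normal (a v : R) :
  Ex (normal_prob 0 1) (fun x => cos (v * x + a)) =
  cos a * expR (- (v ^+ 2 / 2)).
Proof.
rewrite (@Ex_normal01 _ 1).
- rewrite Rintegral_cos_gkernel mulrC mulfVK//.
  by rewrite gt_eqF// normal_peak_gt0// oner_neq0.
- by apply: measurable_cos_comp; exact: measurable_affine.
- by move=> x; exact: cos_max.
Qed.

End NormalCharacteristicFunction.

Section ProductExpectation.
Context {R : realType} {d1 d2 : measure_display}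
  {T1 : measurableType d1} {T2 : measurableType d2}.
Variables (P1 : probability T1 R) (P2 : probability T2 R).

Lemma Ex_prod_swap (f : T1 * T2 -> R) (M : R) : measurable_fun setT f ->
  (forall z, `|f z| <= M) ->
  Ex P1 (fun x => Ex P2 (fun y => f (x, y))) =
  Ex P2 (fun y => Ex P1 (fun x => f (x, y))).
Proof.
move=> mf fM.
have fi := @bounded_integrable _ _ _ (P1 \x P2)%E f M mf fM.
have i1 x : P2.-integrable setT (EFin \o (fun y => f (x, y))).
  apply: (@bounded_integrable _ _ _ _ _ M) => //.
  exact: measurableT_comp mf (measurable_pair1 x).
have i2 y : P1.-integrable setT (EFin \o (fun x => f (x, y))).
  apply: (@bounded_integrable _ _ _ _ _ M) => //.
  exact: measurableT_comp mf (measurable_pair2 y).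
transitivity (fine (\int[P1]_x \int[P2]_y (f (x, y))%:E)).
  by rewrite ExE; congr fine; apply: eq_integral => x _; rewrite EFin_Ex.
rewrite (@Fubini _ _ _ _ _ P1 P2 _ fi) [RHS]ExE; congr fine.
by apply: eq_integral => y _; rewrite [LHS]EFin_Ex.
Qed.

Lemma Ex_prod (f : T1 * T2 -> R) (M : R) : measurable_fun setT f ->
  (forall z, `|f z| <= M) ->
  Ex (P1 \x P2)%E f = Ex P2 (fun y => Ex P1 (fun x => f (x, y))).
Proof.
move=> mf fM.
have fi := @bounded_integrable _ _ _ (P1 \x P2)%E f M mf fM.
have i2 y : P1.-integrable setT (EFin \o (fun x => f (x, y))).
  apply: (@bounded_integrable _ _ _ _ _ M) => //.
  exact: measurableT_comp mf (measurable_pair2 y).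
rewrite ExE -(@integral21_prod_meas1 _ _ _ _ _ P1 P2 _ fi) [RHS]ExE.
by congr fine; apply: eq_integral => y _; rewrite [LHS]EFin_Ex.
Qed.

Lemma measurable_Ex_section (f : T1 * T2 -> R) (M : R) :
  measurable_fun setT f -> (forall z, `|f z| <= M) ->
  measurable_fun setT (fun y => Ex P1 (fun x => f (x, y))).
Proof.
move=> mf fM.
have fi := @bounded_integrable _ _ _ (P1 \x P2)%E f M mf fM.
have i2 y : P1.-integrable setT (EFin \o (fun x => f (x, y))).
  apply: (@bounded_integrable _ _ _ _ _ M) => //.
  exact: measurableT_comp mf (measurable_pair2 y).
apply/measurable_EFinP.
rewrite (_ : _ \o _ = fun y => (\int[P1]_x (EFin \o f) (x, y))%E).
  exact: (@measurable_fubini_G _ _ _ _ _ P1 P2 _ fi).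
by apply/funext => y /=; rewrite [RHS]EFin_Ex.
Qed.

End ProductExpectation.

Section GaussianVector.
Context {R : realType}.

(* The phase [a] encodes the sine part of the characteristic function. *)
Lemma gaussian_family_exists (k : nat) (S : 'I_k -> 'I_k -> R) :
  (forall u : 'I_k -> R, 0 <= \sum_i \sum_j S i j * u i * u j) ->
  exists (d' : measure_display) (T' : measurableType d')
    (Q : probability T' R) (G : 'I_k -> T' -> R),
    (forall i, measurable_fun setT (G i)) /\
    (forall (u : 'I_k -> R) (a : R),
      Ex Q (fun w => cos (\sum_i u i * G i w + a)) =
      cos a * expR (- ((\sum_i \sum_j S i j * u i * u j) / 2))).
Proof.
elim: k S => [|k IH] S S0.
  exists _, _, (normal_prob 0 1), (fun=> fun=> 0); split=> [[]//|u a].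
  rewrite [X in expR (- (X / 2))]big_ord0 mul0r oppr0 expR0 mulr1.
  by under eq_fun do rewrite big_ord0 add0r; rewrite Ex_cst.
pose a0 := S ord0 ord0.
pose c (j : 'I_k) := (S ord0 (lift ord0 j) + S (lift ord0 j) ord0) / 2.
pose S1 i j := S (lift ord0 i) (lift ord0 j).
pose tl (u : 'I_k.+1 -> R) (j : 'I_k) := u (lift ord0 j).
have qE u : \sum_i \sum_j S i j * u i * u j =
    a0 * u ord0 ^+ 2 + 2 * u ord0 * \sum_j c j * tl u j
    + \sum_i \sum_j S1 i j * tl u i * tl u j.
  rewrite big_ord_recl [X in X + _]big_ord_recl.
  rewrite [X in _ + X](eq_bigr (fun i => S (lift ord0 i) ord0 * tl u i * u ord0
      + \sum_j S1 i j * tl u i * tl u j)); last first.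
    by move=> i _; rewrite big_ord_recl.
  rewrite big_split/= addrA; congr (_ + _).
  rewrite -addrA; congr (_ + _); first by rewrite /a0 expr2 mulrA.
  rewrite -big_split/= mulr_sumr; apply: eq_bigr => j _.
  by rewrite /c /tl; field.
pose cons (x : R) (v : 'I_k -> R) (i : 'I_k.+1) :=
  if unlift ord0 i is Some j then v j else x.
have tlE x v : tl (cons x v) = v.
  by apply/funext => j; rewrite /tl /cons liftK.
have hdE x v : cons x v ord0 = x by rewrite /cons unlift_none.
have a0_ge0 : 0 <= a0.
  have := S0 (cons 1 (fun=> 0)); rewrite qE hdE tlE.
  rewrite expr1n mulr1 big1 ?mulr0 ?addr0; last by move=> j _; rewrite mulr0.
  by rewrite big1 ?addr0// => j _; rewrite big1// => i _; rewrite mulr0.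
have [a00|a0_neq0] := eqVneq a0 0.
  have c0 v : \sum_j c j * v j = 0.
    apply/eqP; rewrite -[_ == _]negbK; apply/negP => cv.
    pose q := \sum_i \sum_j S1 i j * v i * v j.
    have := S0 (cons (- (q + 1) / (2 * \sum_j c j * v j)) v).
    rewrite qE hdE tlE a00 mul0r add0r -/q.
    rewrite mulrAC -[X in X + _](_ : - (q + 1) = _); last by field.
    by lra.
  have [|d' [T' [Q [G [mG hG]]]]] := IH S1.
    move=> u; have := S0 (cons 0 u).
    by rewrite qE hdE tlE c0 !mulr0 expr0n mulr0 !add0r.
  exists d', T', Q,
    (fun i => if unlift ord0 i is Some j then G j else fun=> 0); split.
    by move=> i; case: unlift => [j|]; [exact: mG|exact: measurable_cst].
  move=> u a; rewrite qE c0 a00 mul0r mulr0 !add0r -hG.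
  congr Ex; apply/funext => w; rewrite big_ord_recl unlift_none mulr0 add0r.
  by congr (cos (_ + _)); apply: eq_bigr => j _; rewrite liftK.
have a0_gt0 : 0 < a0 by rewrite lt_neqAle eq_sym a0_neq0.
have s0 : Num.sqrt a0 != 0 by rewrite gt_eqF// sqrtr_gt0.
pose S2 i j := S1 i j - c i * c j / a0.
have q2E v : \sum_i \sum_j S2 i j * v i * v j =
    \sum_i \sum_j S1 i j * v i * v j - (\sum_j c j * v j) ^+ 2 / a0.
  rewrite expr2 mulr_suml mulr_suml -sumrB; apply: eq_bigr => i _.
  rewrite mulr_sumr mulr_suml -sumrB; apply: eq_bigr => j _.
  by rewrite /S2; field.
have [|d' [T' [Q [G [mG hG]]]]] := IH S2.
  move=> v; have := S0 (cons (- (\sum_j c j * v j) / a0) v).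
  rewrite qE hdE tlE q2E; congr (0 <= _).
  by field.
exists _, _, (normal_prob 0 1 \x Q)%E,
  (fun i => if unlift ord0 i is Some j
            then fun z => c j / Num.sqrt a0 * z.1 + G j z.2
            else fun z => Num.sqrt a0 * z.1); split.
  move=> i; case: unlift => [j|].
    apply: measurable_funD; first exact: measurable_scale.
    exact: measurableT_comp (mG j) _.
  exact: measurable_scale.
move=> u a.
pose s := Num.sqrt a0 * u ord0 + (\sum_j c j * tl u j) / Num.sqrt a0.
pose L w := \sum_j tl u j * G j w.
transitivity (Ex (normal_prob 0 1 \x Q)%E
    (fun z => cos (s * z.1 + (L z.2 + a)))).
  congr Ex; apply/funext => z; rewrite addrA; congr (cos (_ + a)).
  rewrite big_ord_recl unlift_none /s /L mulrDl -addrA; congr (_ + _).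
    by rewrite mulrCA mulrA.
  rewrite mulrAC mulr_suml mulr_suml -big_split/=; apply: eq_bigr => j _.
  by rewrite liftK /tl; ring.
have mL : measurable_fun setT L.
  by apply: measurable_sumr => j _; exact: measurable_scale.
rewrite (@Ex_prod _ _ _ _ _ _ _ _ 1); last 2 first.
- apply: measurable_cos_comp; apply: measurable_funD.
    exact: measurable_scale.
  apply: measurable_funD => //.
  exact: measurableT_comp mL _.
- by move=> z; exact: cos_max.
under eq_fun do rewrite /= Ex_cos_normal mulrC.
rewrite ExZ; last first.
  apply: (@bounded_integrable _ _ _ _ _ 1); last by move=> z; exact: cos_max.
  by apply: measurable_cos_comp; exact: measurable_funD.
rewrite hG mulrCA -expRD; congr (_ * expR _).
rewrite q2E qE /s -[in a0 * _](sqr_sqrtr a0_ge0) -[in _ / a0](sqr_sqrtr a0_ge0).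
by field.
Qed.

Lemma centred_normal_exists (k : nat) (S : 'M[R]_k) : psd S ->
  exists (d' : measure_display) (T' : measurableType d')
    (Q : probability T' R) (G : T' -> 'cV[R]_k),
    is_centred_normal Q G (fun u => (u^T *m S *m u) 0 0).
Proof.
move=> S0.
have qE (u : 'cV[R]_k) : (u^T *m S *m u) 0 0 =
    \sum_i \sum_j S i j * u i 0 * u j 0.
  rewrite mxE exchange_big/=; apply: eq_bigr => j _; rewrite mxE mulr_suml.
  by apply: eq_bigr => i _; rewrite !mxE [u i 0 * _]mulrC.
have [|d' [T' [Q [G [mG hG]]]]] := @gaussian_family_exists k S.
  move=> u; have := S0 (\col_i u i); rewrite qE.
  by under eq_bigr do under eq_bigr do rewrite !mxE.
exists d', T', Q, (fun w => \col_i G i w); split.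
  move=> i j; rewrite (_ : (fun w => _) = G i)//.
  by apply/funext => w; rewrite mxE.
have innerE u w : mx_inner u (\col_i G i w) = \sum_i u i 0 * G i w.
  by rewrite /mx_inner; apply: eq_bigr => i _; rewrite big_ord1 mxE.
move=> u; split.
  have := hG (fun i => u i 0) 0; rewrite cos0 mul1r qE => <-.
  by congr (fine (expectation Q _)); apply/funext => w; rewrite innerE addr0.
have := hG (fun i => u i 0) (- (pi / 2)).
rewrite cosN cos_pihalf mul0r => <-.
congr (fine (expectation Q _)); apply/funext => w; rewrite innerE.
by rewrite cosBpihalf.
Qed.

End GaussianVector.

(** * Characteristic functions and weak convergence *)

Section Tightness.
Context {R : realType} {d : measure_display} {T : measurableType d}.
Variable P : probability T R.

(* Both notions quantify over a measurable exceptional set, so they make sense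
   for functions that are not known to be measurable. *)
Definition tight (u : nat -> T -> R) := forall e : R, 0 < e ->
  exists M : R, \forall n \near \oo, exists E : set T,
    [/\ measurable E, prob P E <= e & forall w, ~ E w -> `|u n w| <= M].

Definition negligible_in_prob (u : nat -> T -> R) := forall e : R, 0 < e ->
  \forall n \near \oo, exists E : set T,
    [/\ measurable E, prob P E <= e & forall w, ~ E w -> `|u n w| <= e].

Lemma Ex_one_sub_gauss (f : T -> R) (s : R) : measurable_fun setT f ->
  Ex P (fun w => 1 - expR (- ((s * f w) ^+ 2 / 2))) =
  Ex (normal_prob 0 1) (fun v => 1 - Ex P (fun w => cos (v * s * f w))).
Proof.
move=> mf.
have mcos v : measurable_fun setT (fun w => cos (v * s * f w)).
  by apply: measurable_cos_comp; exact: measurable_scale.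
have bcos (g : T -> R) w : `|cos (g w)| <= 1 by exact: cos_max.
have mpair : measurable_fun setT (fun z : T * R => cos (z.2 * s * f z.1)).
  apply: measurable_cos_comp; apply: measurable_funM.
    by apply: measurable_funM => //; exact: measurable_snd.
  exact: measurableT_comp mf measurable_fst.
have := @Ex_prod_swap _ _ _ _ _ P (normal_prob 0 1)
  (fun z => cos (z.2 * s * f z.1)) 1 mpair (fun z => cos_max _).
rewrite /= => sw.
have gE w : Ex (normal_prob 0 1) (fun v => cos (v * s * f w)) =
    expR (- ((s * f w) ^+ 2 / 2)).
  have := Ex_cos_normal 0 (s * f w); rewrite cos0 mul1r => <-.
  congr Ex; apply/funext => v.
  by rewrite addr0 -mulrA mulrC.
rewrite !ExB ?Ex_cst.
- by rewrite -sw; congr (_ - Ex P _); apply/funext => w; rewrite gE.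
- exact: integrable_cst.
- apply: (@bounded_integrable _ _ _ _ _ 1).
    exact: (measurable_Ex_section P (normal_prob 0 1) mpair (fun z => cos_max _)).
  by move=> v; apply: Ex_bound => // w; exact: cos_max.
- exact: integrable_cst.
- apply: (@bounded_integrable _ _ _ _ _ 1).
    apply: measurable_expR_comp; apply: measurableT_comp => //.
    apply: measurable_funM => //; apply: measurable_funX.
    exact: measurable_scale.
  move=> w; rewrite ger0_norm ?expR_ge0// -[leRHS]expR0 ler_expR oppr_le0.
  by rewrite divr_ge0// sqr_ge0.
Qed.

Lemma tight_of_charfun (u : nat -> T -> R) (c : R) : 0 <= c ->
  (forall n, measurable_fun setT (u n)) ->
  (forall v : R, Ex P (fun w => cos (v * u n w)) @[n --> \oo] -->
     expR (- (c * v ^+ 2 / 2))) ->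
  tight u.
Proof.
move=> c0 mu cu e e0.
pose lim (m : nat) := Ex (normal_prob 0 1) (fun v => 1 - expR (- (c * (v / m.+1%:R) ^+ 2 / 2))).
pose h (m n : nat) := Ex P (fun w => 1 - expR (- ((m.+1%:R^-1 * u n w) ^+ 2 / 2))).
have exp01 (x : R) : 0 <= x -> 0 <= 1 - expR (- x) <= 1.
  by move=> x0; rewrite subr_ge0 -[leRHS]expR0 ler_expR oppr_le0 x0/= gerBl expR_ge0.
have cx0 (x : R) : 0 <= c * x ^+ 2 / 2 by rewrite divr_ge0// mulr_ge0// sqr_ge0.
have mexp (a : R) : measurable_fun setT (fun x : R => 1 - expR (- (c * (x * a) ^+ 2 / 2))).
  apply: measurable_funB => //; apply: measurable_expR_comp.
  apply: measurableT_comp => //; apply: measurable_funM => //.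
  apply: measurable_scale; apply: measurable_funX.
  exact: measurable_funM.
have hlim m : h m n @[n --> \oo] --> lim m.
  rewrite /h; under eq_fun do rewrite Ex_one_sub_gauss//.
  have mc n v : measurable_fun setT (fun w => cos (v / m.+1%:R * u n w)).
    by apply: measurable_cos_comp; exact: measurable_scale.
  have bc n v : `|Ex P (fun w => cos (v / m.+1%:R * u n w))| <= 1.
    by apply: Ex_bound => // w; exact: cos_max.
  apply: (cvg_Ex (g := fun=> 2)).
  - move=> n; apply: measurable_funB => //.
    apply: (@measurable_Ex_section _ _ _ _ _ P (normal_prob 0 1)
      (fun z => cos (z.2 / m.+1%:R * u n z.1)) 1); last by move=> z; exact: cos_max.
    apply: measurable_cos_comp; apply: measurable_funM.
      by apply: measurable_funM => //; exact: measurable_snd.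
    exact: measurableT_comp (mu n) measurable_fst.
  - by move=> v; apply: cvgB; [exact: cvg_cst|exact: cu].
  - exact: integrable_cst.
  - move=> n v; apply: le_trans (ler_normB _ _) _.
    by rewrite normr1 -[2]/(1 + 1) lerD2l.
have lim0 : lim m @[m --> \oo] --> (0 : R).
  have : lim m @[m --> \oo] --> Ex (normal_prob 0 1) (fun _ : R => (0 : R)).
    apply: (cvg_Ex (g := fun=> 1)).
    - by move=> n; exact: mexp.
    - move=> x; have -> : 0 = 1 - expR (- (c * (x * 0) ^+ 2 / 2)) :> R.
        by rewrite mulr0 expr0n mulr0 mul0r oppr0 expR0 subrr.
      apply: cvgB; first exact: cvg_cst.
      apply: (cvg_comp _ expR); last exact: continuous_expR.
      apply: cvgN; apply: cvgM; last exact: cvg_cst.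
      apply: cvgM; first exact: cvg_cst.
      apply: (cvg_comp _ (fun y => y ^+ 2)); last exact: exprn_continuous.
      by apply: cvgM; [exact: cvg_cst|exact: cvg_harmonic].
    - exact: integrable_cst.
    - by move=> n x; rewrite ger0_norm; have /andP[] := exp01 _ (cx0 (x / n.+1%:R)).
  by rewrite Ex_cst.
have [m hm] : exists m, lim m < e / 4.
  have e4 : 0 < e / 4 by rewrite divr_gt0.
  have /cvgr_lt/(_ _ e4)[m _ /(_ m (leqnn m))] := lim0.
  by exists m.
exists (2 * m.+1%:R).
have := hlim m => /cvgr_lt/(_ _ hm); apply: filterS => n hn.
exists [set w | 2 * m.+1%:R < `|u n w|].
have mE : measurable [set w | 2 * m.+1%:R < `|u n w|].
  by apply: measurable_gt_set; exact: measurableT_comp.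
split => //; last by move=> w /negP; rewrite -leNgt.
have : prob P [set w | 2 * m.+1%:R < `|u n w|] * (2 / 3) <= h m n.
  rewrite -Ex_indic// mulrC -ExZ; last first.
    apply: (@bounded_integrable _ _ _ _ _ 1); first exact: measurable_indic.
    by move=> w; rewrite indicE; case: (_ \in _); rewrite ?normr1 ?normr0.
  apply: Ex_le.
  - apply: integrable_scale; apply: (@bounded_integrable _ _ _ _ _ 1).
      exact: measurable_indic.
    by move=> w; rewrite indicE; case: (_ \in _); rewrite ?normr1 ?normr0.
  - apply: (@bounded_integrable _ _ _ _ _ 1).
      apply: measurable_funB => //; apply: measurable_expR_comp.
      apply: measurableT_comp => //; apply: measurable_funM => //.
      by apply: measurable_funX; exact: measurable_scale.
    move=> w; have := exp01 ((m.+1%:R^-1 * u n w) ^+ 2 / 2)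
      (divr_ge0 (sqr_ge0 _) (ler0n _ _)).
    by case/andP => ? ?; rewrite ger0_norm.
  - move=> w; rewrite indicE; case: (boolP (_ \in _)) => [|_]; last first.
      by rewrite mulr0; have /andP[] := exp01 ((m.+1%:R^-1 * u n w) ^+ 2 / 2)
        (divr_ge0 (sqr_ge0 _) (ler0n _ _)).
    rewrite inE/= => uw; rewrite mulr1 lerBrDr addrC -lerBrDr.
    have : 2 <= (m.+1%:R^-1 * u n w) ^+ 2 / 2.
      rewrite ler_pdivlMr// -real_normK ?num_real// normrM.
      have -> : 2 * 2 = 2 ^+ 2 :> R by rewrite expr2.
      rewrite lerXn2r// ?nnegrE ?mulr_ge0// ger0_norm ?invr_ge0//.
      by rewrite mulrC ler_pdivlMr// ltW.
    move=> x2; rewrite expRN invf_ple ?posrE ?expR_gt0//; last by lra.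
    apply: (le_trans _ (expR_ge1Dx _)).
    have -> : (1 - 2 / 3)^-1 = 1 + 2 :> R by field.
    by rewrite lerD2l.
by move: hn; lra.
Qed.

End Tightness.

Section TrigonometricPolynomials.
Context {R : realType} {k : nat}.
Implicit Types f g : 'cV[R]_k -> R.

Inductive trigpoly : ('cV[R]_k -> R) -> Prop :=
| trigpoly_cos (u : 'cV[R]_k) (a : R) :
    trigpoly (fun x => cos (mx_inner u x + a))
| trigpoly_add f g : trigpoly f -> trigpoly g ->
    trigpoly (fun x => f x + g x)
| trigpoly_scale (c : R) f : trigpoly f -> trigpoly (fun x => c * f x).

Lemma mx_inner_sum (u x : 'cV[R]_k) : mx_inner u x = \sum_i u i 0 * x i 0.
Proof. by apply: eq_bigr => i _; rewrite big_ord1. Qed.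

Lemma mx_innerDl (u v x : 'cV[R]_k) :
  mx_inner (u + v) x = mx_inner u x + mx_inner v x.
Proof.
rewrite !mx_inner_sum -big_split; apply: eq_bigr => i _.
by rewrite mxE mulrDl.
Qed.

Lemma mx_innerNl (u x : 'cV[R]_k) : mx_inner (- u) x = - mx_inner u x.
Proof.
by rewrite !mx_inner_sum -sumrN; apply: eq_bigr => i _; rewrite mxE mulNr.
Qed.

Lemma trigpoly_cst (c : R) : trigpoly (fun=> c).
Proof.
have -> : (fun=> c) = fun x : 'cV[R]_k => c * cos (mx_inner 0 x + 0).
  apply/funext => x; rewrite mx_inner_sum big1 ?addr0 ?cos0 ?mulr1// => i _.
  by rewrite mxE mul0r.
exact/trigpoly_scale/trigpoly_cos.
Qed.

Lemma trigpoly_mul f g : trigpoly f -> trigpoly g ->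
  trigpoly (fun x => f x * g x).
Proof.
move=> tf tg; elim: tf => [u a|f1 f2 _ h1 _ h2|c f1 _ h1].
- elim: tg => [v b|g1 g2 _ h1 _ h2|c g1 _ h1].
  + have -> : (fun x => cos (mx_inner u x + a) * cos (mx_inner v x + b)) =
        fun x => 2^-1 * (cos (mx_inner (u + v) x + (a + b))
                         + cos (mx_inner (u - v) x + (a - b))).
      apply/funext => x; rewrite !mx_innerDl mx_innerNl.
      set A := mx_inner u x; set C := mx_inner v x.
      have -> : A + C + (a + b) = (A + a) + (C + b) by ring.
      have -> : A - C + (a - b) = (A + a) - (C + b) by ring.
      rewrite (cosD (A + a) (C + b)) (cosB (A + a) (C + b)).
      by field.
    by apply: trigpoly_scale; apply: trigpoly_add; exact: trigpoly_cos.
  + under eq_fun do rewrite mulrDr; exact: trigpoly_add.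
  + under eq_fun do rewrite mulrCA; exact: trigpoly_scale.
- under eq_fun do rewrite mulrDl; exact: trigpoly_add.
- under eq_fun do rewrite -mulrA; exact: trigpoly_scale.
Qed.

Lemma trigpoly_sin (N : R) (j : 'I_k) : trigpoly (fun x => sin (x j 0 / N)).
Proof.
have -> : (fun x : 'cV[R]_k => sin (x j 0 / N)) =
    fun x => cos (mx_inner (\col_i ((i == j)%:R / N)) x + - (pi / 2)).
  apply/funext => x; rewrite cosBpihalf mx_inner_sum (bigD1 j)//= big1 ?addr0.
    by rewrite mxE eqxx mul1r mulrC.
  by move=> i /negbTE ij; rewrite mxE ij !mul0r.
exact: trigpoly_cos.
Qed.

Lemma trigpoly_bounded f : trigpoly f -> exists M : R, forall x, `|f x| <= M.
Proof.
elim=> [u a|f1 f2 _ [M1 h1] _ [M2 h2]|c f1 _ [M h]].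
- by exists 1 => x; exact: cos_max.
- by exists (M1 + M2) => x; rewrite (le_trans (ler_normD _ _))// lerD.
- by exists (`|c| * M) => x; rewrite normrM ler_wpM2l.
Qed.

Lemma measurable_trigpoly {d} {T : measurableType d} (S : T -> 'cV[R]_k) f :
  (forall i, measurable_fun setT (fun w => S w i 0)) -> trigpoly f ->
  measurable_fun setT (fun w => f (S w)).
Proof.
move=> mS; elim=> [u a|f1 f2 _ h1 _ h2|c f1 _ h].
- apply: measurable_cos_comp; apply: measurable_funD => //.
  under eq_fun do rewrite mx_inner_sum.
  by apply: measurable_sumr => i _; exact: measurable_scale.
- exact: measurable_funD.
- exact: measurable_scale.
Qed.

End TrigonometricPolynomials.

(* [bern s l h v] is the expectation of [h] at the end of a walk from [v] that
   goes through the coordinates listed in [l], incrementing coordinate [j] with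
   probability [s j].  With [l] listing each coordinate [m] times this is the
   multivariate Bernstein operator, and it is a polynomial in [s]. *)
Section Bernstein.
Context {R : realType} {k : nat}.
Implicit Types (s v : 'I_k -> R) (l : seq 'I_k) (h : ('I_k -> R) -> R).

Definition incr v (j : 'I_k) : 'I_k -> R := fun i => v i + (i == j)%:R.

Fixpoint bern s l h v : R :=
  if l is j :: l' then s j * bern s l' h (incr v j) + (1 - s j) * bern s l' h v
  else h v.

Lemma bern_le s l h1 h2 v : (forall j, 0 <= s j <= 1) ->
  (forall v, h1 v <= h2 v) -> bern s l h1 v <= bern s l h2 v.
Proof.
move=> s01 h12; elim: l v => [|j l IH] v //=.
by have /andP[? ?] := s01 j; rewrite lerD// ler_wpM2l ?subr_ge0.
Qed.

Lemma bernD s l h1 h2 v :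
  bern s l (fun v => h1 v + h2 v) v = bern s l h1 v + bern s l h2 v.
Proof. by elim: l v => [|j l IH] v //=; rewrite !IH; ring. Qed.

Lemma bernZ s l c h v : bern s l (fun v => c * h v) v = c * bern s l h v.
Proof. by elim: l v => [|j l IH] v //=; rewrite !IH; ring. Qed.

Lemma bern_cst s l c v : bern s l (fun=> c) v = c.
Proof. by elim: l v => [|j l IH] v //=; rewrite !IH; ring. Qed.

Lemma bern_sum s l (H : 'I_k -> ('I_k -> R) -> R) v :
  bern s l (fun v => \sum_i H i v) v = \sum_i bern s l (H i) v.
Proof.
elim: l v => [|j l IH] v //=; rewrite !IH !mulr_sumr -big_split/=.
by apply: eq_bigr.
Qed.

Lemma bern_sqr s l i c v :
  bern s l (fun v => (v i - c) ^+ 2) v =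
  (v i + (count_mem i l)%:R * s i - c) ^+ 2
  + (count_mem i l)%:R * (s i * (1 - s i)).
Proof.
elim: l v => [|j l IH] v /=; first by rewrite !mul0r !addr0.
rewrite !IH /incr; have [->|ij] := eqVneq j i.
  by rewrite natrD /= mulr1n; ring.
by rewrite natrD /= mulr0n; ring.
Qed.

Lemma bern_norm s l h (M : R) v : (forall j, 0 <= s j <= 1) ->
  (forall v, `|h v| <= M) -> `|bern s l h v| <= M.
Proof.
move=> s01 hM; rewrite ler_norml -(bern_cst s l (- M) v).
rewrite -[X in _ && (_ <= X)](bern_cst s l M v).
by apply/andP; split; apply: bern_le => // w; have := hM w;
  rewrite ler_norml => /andP[].
Qed.

Lemma trigpoly_bern (s : 'cV[R]_k -> 'I_k -> R) l h v :
  (forall j, trigpoly (fun x => s x j)) -> trigpoly (fun x => bern (s x) l h v).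
Proof.
move=> ts; elim: l v => [|j l IH] v /=; first exact: trigpoly_cst.
apply: trigpoly_add; apply: trigpoly_mul => //.
apply: trigpoly_add; first exact: trigpoly_cst.
by under eq_fun do rewrite -mulN1r; exact: trigpoly_scale.
Qed.

End Bernstein.

Lemma cube_modulus {R : realType} {k : nat} (f : 'cV[R]_k -> R) (L e : R) :
  continuous f -> 0 < e ->
  exists2 dl : R, 0 < dl & forall x y : 'cV[R]_k, (forall i, `|x i 0| <= L) ->
    (forall i, `|y i 0 - x i 0| < dl) -> `|f y - f x| <= e.
Proof.
move=> cf e0.
have cK : compact [set v : 'rV[R]_k | forall i, `[- L, L]%classic (v ord0 i)].
  apply: (@rV_compact _ _ (fun=> `[- L, L]%classic)) => i.
  exact: segment_compact.
move/compact_near_coveringP: cK => nK.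
pose Pr (dl : R) (v : 'rV[R]_k) := forall y : 'cV[R]_k,
  (forall i, `|y i 0 - v 0 i| < dl) -> `|f y - f v^T| <= e.
have [dl [dl0 h]] : exists dl : R, 0 < dl /\
    [set v : 'rV[R]_k | forall i, `[- L, L]%classic (v ord0 i)] `<=` Pr dl.
  have near0 : \forall dl \near (0 : R)^'+,
      [set v : 'rV[R]_k | forall i, `[- L, L]%classic (v ord0 i)] `<=` Pr dl.
    apply: nK => v _.
    have e2 : 0 < e / 2 by rewrite divr_gt0.
    have /cvgrPdist_lt/(_ _ e2) := cf v^T.
    move=> /nbhs_ballP[r /= r0 hr].
    exists (ball v (r / 2), [set dl | dl < r / 2]).
      split; first by apply: nbhsx_ballx; rewrite divr_gt0.
      by apply: nbhs_right_lt; rewrite divr_gt0.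
    move=> [v' dl] /= [[_ bv'] dlr] y yv'.
    have b1 : ball v^T r v'^T.
      split=> // i j; rewrite !mxE; apply: le_ball (bv' j i).
      by move: r0; lra.
    have b2 : ball v^T r y.
      split=> // i j; rewrite !ord1 mxE.
      have := bv' 0 i; rewrite -!ball_normE /= => b.
      have := yv' i => b'.
      rewrite -(subrKA (v' 0 i)) (le_lt_trans (ler_normD _ _))//.
      by rewrite [r]splitr ltrD// distrC (lt_trans b').
    have := hr _ b1; have := hr _ b2.
    rewrite -[f y - f v'^T](subrKA (f v^T)) => h1 h2.
    rewrite (le_trans (ler_normD _ _))// [e]splitr lerD// ltW//.
    by rewrite distrC.
  near (0 : R)^'+ => dl.
  by exists dl; split; near: dl; [exact: nbhs_right_gt|exact: near0].
exists dl => // x y xL xy.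
rewrite -[x]trmxK; apply: (h x^T); last by move=> i; rewrite mxE.
by move=> i /=; rewrite mxE in_itv/= -ler_norml.
Unshelve. all: by end_near. Qed.

Section TaylorBounds.
Context {R : realType}.

Lemma ge0_of_derive (f df : R -> R) :
  (forall x : R, is_derive x 1 f (df x)) -> f 0 = 0 ->
  (forall x, 0 <= x -> 0 <= df x) -> forall x, 0 <= x -> 0 <= f x.
Proof.
move=> dfx f0 df0 x; rewrite le_eqVlt => /predU1P[<-|x0]; first by rewrite f0.
have cf : {within `[0, x], continuous f}.
  apply: continuous_subspaceT => y.
  by apply/differentiable_continuous/derivable1_diffP; case: (dfx y).
have [c c0x] := MVT x0 (fun y _ => dfx y) cf.
rewrite f0 !subr0 => ->; rewrite mulr_ge0 ?(ltW x0)// df0//.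
by move: c0x; rewrite in_itv/= => /andP[/ltW].
Qed.

Lemma sin_le_id (x : R) : 0 <= x -> 0 <= x - sin x.
Proof.
move: x; apply: (@ge0_of_derive _ (fun x => 1 - cos x)).
- by rewrite sin0 subrr.
- by move=> x _; rewrite subr_ge0 cos_le1.
Qed.

Lemma cos_ge_taylor (x : R) : 0 <= x -> 0 <= cos x - 1 + x ^+ 2 / 2.
Proof.
move: x; apply: (@ge0_of_derive _ (fun x => x - sin x)).
- move=> x; have -> : (fun x : R => cos x - 1 + x ^+ 2 / 2) =
    cos - cst 1 + 2^-1 \*: (fun x : R => x ^+ 2).
    by apply/funext => y; rewrite /= /GRing.scale/= [_ / 2]mulrC.
  by apply: is_derive_eq; rewrite /GRing.scale/= ; field.
- by rewrite cos0 subrr expr0n mul0r addr0.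
- exact: sin_le_id.
Qed.

Lemma sin_ge_taylor (x : R) : 0 <= x -> 0 <= sin x - x + x ^+ 3 / 6.
Proof.
move: x; apply: (@ge0_of_derive _ (fun x => cos x - 1 + x ^+ 2 / 2)).
- move=> x; have -> : (fun x : R => sin x - x + x ^+ 3 / 6) =
    sin - id + 6^-1 \*: (fun x : R => x ^+ 3).
    by apply/funext => y; rewrite /= /GRing.scale/= [_ / 6]mulrC.
  by apply: is_derive_eq; rewrite /GRing.scale/= ; field.
- by rewrite sin0 subrr expr0n mul0r addr0.
- exact: cos_ge_taylor.
Qed.

Lemma cos_le_taylor (x : R) : 0 <= x ->
  0 <= 1 - x ^+ 2 / 2 + x ^+ 4 / 24 - cos x.
Proof.
move: x; apply: (@ge0_of_derive _ (fun x => sin x - x + x ^+ 3 / 6)).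
- move=> x; have -> : (fun x : R => 1 - x ^+ 2 / 2 + x ^+ 4 / 24 - cos x) =
    cst 1 - 2^-1 \*: (fun x : R => x ^+ 2) + 24^-1 \*: (fun x : R => x ^+ 4) - cos.
    by apply/funext => y; rewrite /= /GRing.scale/= [_ / 24]mulrC [_ / 2]mulrC.
  by apply: is_derive_eq; rewrite /GRing.scale/= ; field.
- by rewrite cos0 !expr0n !mul0r subr0 addr0 subrr.
- exact: sin_ge_taylor.
Qed.

Lemma sin_taylor (x : R) : `|sin x - x| <= `|x| ^+ 3 /\ `|sin x - x| <= x ^+ 2.
Proof.
wlog x0 : x / 0 <= x => [H|].
  have [/H//|/ltW xneg] := leP 0 x.
  have := H (- x); rewrite oppr_ge0 => /(_ xneg).
  rewrite sinN (_ : - sin x - - x = - (sin x - x)); last by ring.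
  by rewrite !normrN sqrrN.
have h1 := sin_le_id x0; have h2 := sin_ge_taylor x0.
have h3 := sin_geN1 x.
rewrite (ger0_norm x0) distrC ger0_norm//; split.
  by have := exprn_ge0 3 x0; lra.
have [x6|x6] := leP x 6; last by nra.
have : x ^+ 3 / 6 <= x ^+ 2 by rewrite exprSr; have := sqr_ge0 x; nra.
by lra.
Qed.

Lemma cos_taylor (x : R) : `|cos x - 1 + x ^+ 2 / 2| <= x ^+ 4 /\
  `|cos x - 1 + x ^+ 2 / 2| <= x ^+ 2.
Proof.
wlog x0 : x / 0 <= x => [H|].
  have [/H//|/ltW xneg] := leP 0 x.
  have := H (- x); rewrite oppr_ge0 => /(_ xneg).
  by rewrite cosN sqrrN -[4%N]/(2 * 2)%N !exprM sqrrN.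
have h1 := cos_ge_taylor x0; have h2 := cos_le_taylor x0.
rewrite ger0_norm//; split; first by have := exprn_ge0 4 x0; lra.
by have := cos_le1 x; have := sqr_ge0 x; lra.
Qed.

End TaylorBounds.

Lemma trigpoly_dense {R : realType} {k : nat} (f : 'cV[R]_k -> R) (M L e : R) :
  continuous f -> (forall x, `|f x| <= M) -> 0 < e -> 0 <= L ->
  exists2 g : 'cV[R]_k -> R, trigpoly g & (forall x, `|g x| <= M) /\
    (forall x : 'cV[R]_k, (forall i, `|x i 0| <= L) -> `|g x - f x| <= e).
Proof.
move=> cf fM e0 L0.
have M0 : 0 <= M by exact: le_trans (fM 0).
have e2 : 0 < e / 2 by rewrite divr_gt0.
have [dl dl0 hdl] := cube_modulus L cf e2.
pose C := 2 * M / dl ^+ 2 * (k%:R * (L ^+ 4 + 1)).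
have C0 : 0 <= C.
  by rewrite !mulr_ge0// ?invr_ge0 ?sqr_ge0 ?addr_ge0// exprn_ge0.
pose N := (Num.bound (C / (e / 2))).+1.
have NC : C / N%:R ^+ 2 <= e / 2.
  rewrite ler_pdivrMr ?exprn_gt0 ?ltr0n// mulrC -ler_pdivrMr//.
  apply: le_trans (ltW (archi_boundP _)) _; first by rewrite divr_ge0// ltW.
  apply: (@le_trans _ _ N%:R); first by rewrite ler_nat.
  by rewrite expr2 ler_peMr// ler1n.
pose m := (N ^ 4)%N.
pose s (x : 'cV[R]_k) (j : 'I_k) := (1 + sin (x j 0 / N%:R)) / 2.
pose l := flatten (nseq m (enum 'I_k)).
have count_rep m' i : count_mem i (flatten (nseq m' (enum 'I_k))) = m'.
  elim: m' => //= m' IH; rewrite count_cat IH.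
  by rewrite (count_uniq_mem _ (enum_uniq _)) mem_enum.
have cl i : count_mem i l = m by exact: count_rep.
pose pt (v : 'I_k -> R) : 'cV[R]_k := \col_i (N%:R * (2 * (v i / m%:R) - 1)).
pose g x := bern (s x) l (fun v => f (pt v)) (fun=> 0).
have s01 x j : 0 <= s x j <= 1.
  have := sin_max (x j 0 / N%:R); rewrite ler_norml => /andP[? ?].
  by rewrite /s; apply/andP; split; lra.
exists g.
  apply: trigpoly_bern => j; under eq_fun do rewrite /s mulrC.
  apply: trigpoly_scale; apply: trigpoly_add; first exact: trigpoly_cst.
  exact: trigpoly_sin.
split=> [x|x xL]; first by apply: bern_norm.
have dist v : `|f (pt v) - f x| <=
    e / 2 + 2 * M / dl ^+ 2 * \sum_i (pt v i 0 - x i 0) ^+ 2.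
  have c2 : 0 <= 2 * M / dl ^+ 2.
    by rewrite !mulr_ge0// invr_ge0 sqr_ge0.
  have sum0 : 0 <= \sum_i (pt v i 0 - x i 0) ^+ 2.
    by apply: sumr_ge0 => i _; exact: sqr_ge0.
  have [/forallP near|/forallPn [i far]] :=
    boolP [forall i, `|pt v i 0 - x i 0| < dl].
    by rewrite (le_trans (hdl x (pt v) xL near))// lerDl mulr_ge0.
  rewrite -leNgt in far.
  have f2 : `|f (pt v) - f x| <= 2 * M.
    by rewrite (le_trans (ler_normB _ _))// mulr2n mulrDl mul1r lerD.
  rewrite (le_trans f2)// (@le_trans _ _ (2 * M / dl ^+ 2 * dl ^+ 2))//.
    by rewrite divfK// gt_eqF// exprn_gt0.
  rewrite (@le_trans _ _ (2 * M / dl ^+ 2 * \sum_i (pt v i 0 - x i 0) ^+ 2))//.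
    rewrite ler_wpM2l// (bigD1 i)//= -[leLHS]addr0 lerD//.
      by rewrite -[leRHS]real_normK ?num_real// lerXn2r// nnegrE// ltW.
    by apply: sumr_ge0 => j _; exact: sqr_ge0.
  by rewrite lerDr ltW.
have second i : bern (s x) l (fun v => (pt v i 0 - x i 0) ^+ 2) (fun=> 0) <=
    (L ^+ 4 + 1) / N%:R ^+ 2.
  have N0 : 0 < N%:R :> R by rewrite ltr0n.
  have m0 : 0 < m%:R :> R by rewrite ltr0n expn_gt0.
  have mE : m%:R = N%:R ^+ 4 :> R by rewrite natrX.
  have -> : (fun v => (pt v i 0 - x i 0) ^+ 2) =
      fun v => (2 * N%:R / m%:R) ^+ 2 *
        (v i - m%:R / 2 * (1 + x i 0 / N%:R)) ^+ 2.
    apply/funext => v; rewrite mxE -exprMn; congr (_ ^+ 2); field.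
    by rewrite !gt_eqF.
  rewrite bernZ bern_sqr cl add0r.
  have -> : (2 * N%:R / m%:R) ^+ 2 *
      ((m%:R * s x i - m%:R / 2 * (1 + x i 0 / N%:R)) ^+ 2
       + m%:R * (s x i * (1 - s x i))) =
      N%:R ^+ 2 * (sin (x i 0 / N%:R) - x i 0 / N%:R) ^+ 2
      + 4 * N%:R ^+ 2 / m%:R * (s x i * (1 - s x i)).
    rewrite {1}/s; field.
    by rewrite !gt_eqF.
  rewrite [leRHS]mulrDl lerD//.
    have [_ h] := sin_taylor (x i 0 / N%:R).
    have h2 : (sin (x i 0 / N%:R) - x i 0 / N%:R) ^+ 2 <= (L / N%:R) ^+ 4.
      rewrite -real_normK ?num_real//.
      have -> : (L / N%:R) ^+ 4 = ((L / N%:R) ^+ 2) ^+ 2 by rewrite -exprM.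
      rewrite lerXn2r// ?nnegrE ?sqr_ge0// (le_trans h)//.
      rewrite -real_normK ?num_real// lerXn2r// ?nnegrE ?divr_ge0//.
      by rewrite normrM normfV [`|N%:R|]ger0_norm// ler_pM2r ?invr_gt0.
    apply: le_trans (ler_wpM2l (sqr_ge0 _) h2) _.
    have -> : N%:R ^+ 2 * (L / N%:R) ^+ 4 = L ^+ 4 / N%:R ^+ 2.
      by field; rewrite gt_eqF.
    exact: lexx.
  rewrite mE.
  have -> : 4 * N%:R ^+ 2 / N%:R ^+ 4 * (s x i * (1 - s x i)) =
      4 * (s x i * (1 - s x i)) / N%:R ^+ 2.
    by field; rewrite gt_eqF.
  rewrite ler_pM2r ?invr_gt0 ?exprn_gt0//.
  by have := sqr_ge0 (1 - 2 * s x i); lra.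
apply: (@le_trans _ _ (bern (s x) l (fun v => e / 2 + 2 * M / dl ^+ 2 *
    \sum_i (pt v i 0 - x i 0) ^+ 2) (fun=> 0))).
  rewrite ler_norml; apply/andP; split.
    rewrite lerBrDl -mulN1r -bernZ -[f x](bern_cst (s x) l _ (fun=> 0)) -bernD.
    apply: bern_le => // v.
    by have := dist v; rewrite ler_norml mulN1r => /andP[+ _]; lra.
  rewrite lerBlDl -[f x](bern_cst (s x) l _ (fun=> 0)) -bernD.
  apply: bern_le => // v.
  by have := dist v; rewrite ler_norml => /andP[_]; lra.
rewrite bernD bern_cst bernZ bern_sum [leRHS]splitr lerD2l.
apply: le_trans NC; rewrite /C -[leRHS]mulrA ler_wpM2l//.
  by rewrite !mulr_ge0// invr_ge0 sqr_ge0.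
apply: le_trans (ler_sum _ (fun i _ => second i)) _.
by rewrite sumr_const card_ord -mulrA mulr_natl.
Qed.

Section StochasticOrders.
Context {R : realType} {d : measure_display} {T : measurableType d}.
Variable P : probability T R.
Implicit Types u v : nat -> T -> R.

Lemma tight_le u v : tight P v -> (forall n w, `|u n w| <= `|v n w|) ->
  tight P u.
Proof.
move=> tv uv e e0; have [M hM] := tv e e0; exists M.
apply: filterS hM => n [E [mE pE bE]]; exists E; split=> // w Ew.
exact: le_trans (uv n w) (bE w Ew).
Qed.

Lemma tight_add u v : tight P u -> tight P v ->
  tight P (fun n w => u n w + v n w).
Proof.
move=> tu tv e e0; have e2 : 0 < e / 2 by rewrite divr_gt0.
have [M1 h1] := tu _ e2; have [M2 h2] := tv _ e2; exists (M1 + M2).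
apply: filterS2 h1 h2 => n [E1 [m1 p1 b1]] [E2 [m2 p2 b2]].
exists (E1 `|` E2); split; first exact: measurableU.
  by rewrite (le_trans (probU_le _ m1 m2))// [leRHS]splitr lerD.
move=> w /not_orP[n1 n2]; rewrite (le_trans (ler_normD _ _))// lerD//.
  exact: b1.
exact: b2.
Qed.

Lemma tight_bounded u (M : R) : (forall n w, `|u n w| <= M) -> tight P u.
Proof.
move=> uM e e0; exists M; apply: nearW => n; exists set0; split=> //.
by rewrite /prob measure0 ltW.
Qed.

Lemma tight_mul u v : tight P u -> tight P v ->
  tight P (fun n w => u n w * v n w).
Proof.
move=> tu tv e e0; have e2 : 0 < e / 2 by rewrite divr_gt0.
have [M1 h1] := tu _ e2; have [M2 h2] := tv _ e2; exists (M1 * M2).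
apply: filterS2 h1 h2 => n [E1 [m1 p1 b1]] [E2 [m2 p2 b2]].
exists (E1 `|` E2); split; first exact: measurableU.
  by rewrite (le_trans (probU_le _ m1 m2))// [leRHS]splitr lerD.
by move=> w /not_orP[n1 n2]; rewrite normrM ler_pM//; [exact: b1|exact: b2].
Qed.

Lemma tight_sum (I : finType) (A : pred I) (F : I -> nat -> T -> R) :
  (forall i, A i -> tight P (F i)) ->
  tight P (fun n w => \sum_(i | A i) F i n w).
Proof.
move=> tF.
have : tight P (\sum_(i | A i) F i).
  elim/big_rec: _ => [|i v Ai tv]; last exact: (tight_add (tF i Ai)).
  by apply: (@tight_bounded _ 0) => n w; rewrite normr0.
by congr tight; apply/funext => n; apply/funext => w; rewrite !fct_sumE.
Qed.

Lemma negl_tight u : negligible_in_prob P u -> tight P u.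
Proof. by move=> nu e e0; exists e; exact: nu. Qed.

Lemma negl_add u v : negligible_in_prob P u -> negligible_in_prob P v ->
  negligible_in_prob P (fun n w => u n w + v n w).
Proof.
move=> tu tv e e0; have e2 : 0 < e / 2 by rewrite divr_gt0.
have h1 := tu _ e2; have h2 := tv _ e2.
apply: filterS2 h1 h2 => n [E1 [m1 p1 b1]] [E2 [m2 p2 b2]].
exists (E1 `|` E2); split; first exact: measurableU.
  by rewrite (le_trans (probU_le _ m1 m2))// [leRHS]splitr lerD.
move=> w /not_orP[n1 n2]; rewrite (le_trans (ler_normD _ _))// [leRHS]splitr.
by rewrite lerD//; [exact: b1|exact: b2].
Qed.

Lemma negl_mul_tight u v : negligible_in_prob P u -> tight P v ->
  negligible_in_prob P (fun n w => u n w * v n w).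
Proof.
move=> tu tv e e0; have e2 : 0 < e / 2 by rewrite divr_gt0.
have [M h2] := tv _ e2.
pose M' := `|M| + 1.
have M'0 : 0 < M' by rewrite ltr_wpDl.
have e3 : 0 < Num.min (e / 2) (e / M') by rewrite lt_min e2 divr_gt0.
have h1 := tu _ e3.
apply: filterS2 h1 h2 => n [E1 [m1 p1 b1]] [E2 [m2 p2 b2]].
exists (E1 `|` E2); split; first exact: measurableU.
  rewrite (le_trans (probU_le _ m1 m2))// [leRHS]splitr lerD//.
  by rewrite (le_trans p1)// ge_min lexx.
move=> w /not_orP[n1 n2]; rewrite normrM.
rewrite (@le_trans _ _ (e / M' * M'))//; last by rewrite divfK// gt_eqF.
rewrite ler_pM//; first by rewrite (le_trans (b1 _ n1))// ge_min lexx orbT.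
by rewrite (le_trans (b2 _ n2))// (le_trans (ler_norm _))// lerDl.
Qed.

Lemma negl_sum (I : finType) (A : pred I) (F : I -> nat -> T -> R) :
  (forall i, A i -> negligible_in_prob P (F i)) ->
  negligible_in_prob P (fun n w => \sum_(i | A i) F i n w).
Proof.
move=> tF.
have : negligible_in_prob P (\sum_(i | A i) F i).
  elim/big_rec: _ => [|i v Ai tv]; last exact: (negl_add (tF i Ai)).
  move=> e e0; apply: nearW => n; exists set0; split=> //.
    by rewrite /prob measure0 ltW.
  by move=> w _; rewrite normr0 ltW.
by congr negligible_in_prob; apply/funext => n; apply/funext => w;
  rewrite !fct_sumE.
Qed.

Lemma negl_det (a : nat -> R) : a n @[n --> \oo] --> (0 : R) ->
  negligible_in_prob P (fun n _ => a n).
Proof.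
move=> a0 e e0; have /cvgr0_norm_le/(_ _ e0) := a0.
apply: filterS => n an; exists set0; split=> //.
by rewrite /prob measure0 ltW.
Qed.

Lemma negl_inv u (c : R) : c != 0 ->
  negligible_in_prob P (fun n w => u n w - c) ->
  negligible_in_prob P (fun n w => (u n w)^-1 - c^-1).
Proof.
move=> c0 nu e e0.
have nc : 0 < `|c| by rewrite normr_gt0.
pose e' := Num.min e (Num.min (`|c| / 2) (e * `|c| ^+ 2 / 2)).
have e'0 : 0 < e' by rewrite !lt_min e0 !divr_gt0// mulr_gt0// exprn_gt0.
apply: filterS (nu _ e'0) => n [E [mE pE bE]]; exists E; split=> //.
  by rewrite (le_trans pE)// ge_min lexx.
move=> w /bE; rewrite !le_min => /and3P[_ h1 h2].
have hu : `|c| / 2 <= `|u n w|.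
  by have := lerB_dist c (u n w); rewrite distrC => h; lra.
have u0 : u n w != 0 by rewrite -normr_gt0 (lt_le_trans _ hu)// divr_gt0.
have -> : (u n w)^-1 - c^-1 = - (u n w - c) * ((u n w)^-1 * c^-1).
  by field; rewrite u0 c0.
rewrite normrM normrN normrM !normfV -invfM ler_pdivrMr ?mulr_gt0 ?normr_gt0//.
rewrite (le_trans h2)// expr2 mulrA -!mulrA ler_pM2l// mulrCA [leRHS]mulrC.
by rewrite ler_pM2l.
Qed.

Lemma negl_le u v : negligible_in_prob P v ->
  (forall n w, `|u n w| <= `|v n w|) -> negligible_in_prob P u.
Proof.
move=> tv uv e e0; apply: filterS (tv e e0) => n [E [mE pE bE]].
by exists E; split=> // w Ew; exact: le_trans (uv n w) (bE w Ew).
Qed.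

Lemma negl_of_cvg_in_prob u (l : R) :
  (forall n, measurable_fun setT (u n)) -> cvg_in_prob P u l ->
  negligible_in_prob P (fun n w => u n w - l).
Proof.
move=> mu cu e e0; have /cvgr0_norm_le/(_ _ e0) := cu e e0.
apply: filterS => n pn; exists [set w | e < `|u n w - l|]; split.
- apply: measurable_gt_set; apply: measurableT_comp => //.
  exact: measurable_funB.
- exact: le_trans (ler_norm _) pn.
- by move=> w /negP; rewrite -leNgt.
Qed.

Lemma negl_of_ae_cvg u (l : R) : (forall n, measurable_fun setT (u n)) ->
  {ae P, forall w, u n w @[n --> \oo] --> l} ->
  negligible_in_prob P (fun n w => u n w - l).
Proof.
move=> mu cu; apply: negl_of_cvg_in_prob => // e e0.
have mE n : measurable [set w | e < `|u n w - l|].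
  apply: measurable_gt_set; apply: measurableT_comp => //.
  exact: measurable_funB.
under eq_fun do rewrite -Ex_indic//.
rewrite -(Ex_cst P 0); apply: (@cvg_Ex_ae _ _ _ P _ _ (fun=> 1)).
- by move=> n; exact: measurable_indic.
- exact: measurable_cst.
- apply: filterS cu => w cw; apply: cvg_near_cst.
  have /cvgrPdist_le/(_ _ e0) := cw; apply: filterS => n lu.
  rewrite indicE memNset//=; rewrite distrC in lu.
  by apply/negP; rewrite -leNgt.
- exact: integrable_cst.
- by move=> n w; rewrite indicE; case: (_ \in _); rewrite ?normr1 ?normr0.
Qed.

Lemma Ex_close (f g : T -> R) (E : set T) (M e : R) :
  measurable_fun setT f -> measurable_fun setT g -> measurable E ->
  (forall w, `|f w| <= M) -> (forall w, `|g w| <= M) -> 0 <= e ->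
  (forall w, ~ E w -> `|f w - g w| <= e) ->
  `|Ex P f - Ex P g| <= e + 2 * M * prob P E.
Proof.
move=> mf mg mE fM gM e0 fg.
have fi := bounded_integrable P mf fM; have gi := bounded_integrable P mg gM.
have Ei : P.-integrable setT (EFin \o (\1_E : T -> R)).
  apply: (@bounded_integrable _ _ _ _ _ 1); first exact: measurable_indic.
  by move=> w; rewrite indicE; case: (_ \in _); rewrite ?normr1 ?normr0.
rewrite -ExB// (le_trans (Ex_norm _))//; first exact: integrable_subr.
rewrite -Ex_indic// -(Ex_cst P e) -ExZ// -ExD//; last 2 first.
- exact: integrable_cst.
- exact: integrable_scale.
apply: Ex_le.
- exact/integrable_normr/integrable_subr.
- by apply: integrable_addr; [exact: integrable_cst|exact: integrable_scale].
move=> w; rewrite indicE; case: (boolP (w \in E)) => [_|/negP wE].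
  rewrite mulr1 (le_trans (ler_normB _ _))//.
  by have := fM w; have := gM w; lra.
by rewrite mulr0 addr0 fg// => Ew; apply: wE; rewrite inE.
Qed.

End StochasticOrders.

Section LevyContinuity.
Context {R : realType} {d d' : measure_display}
  {T : measurableType d} {T' : measurableType d'}.
Variables (P : probability T R) (Q : probability T' R) (k : nat).

Lemma measurable_continuous_comp (S : T -> 'cV[R]_k) (f : 'cV[R]_k -> R) :
  (forall i, measurable_fun setT (fun w => S w i 0)) -> bounded_continuous f ->
  measurable_fun setT (fun w => f (S w)).
Proof.
move=> mS [cf [M fM]].
have app (n : nat) : exists2 g : 'cV[R]_k -> R, trigpoly g &
    (forall x : 'cV[R]_k, (forall i, `|x i 0| <= n%:R) ->
     `|g x - f x| <= n.+1%:R^-1).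
  have [||g tg [_ hg]] := @trigpoly_dense R k f M n%:R n.+1%:R^-1 cf fM => //.
  by exists g.
have /choice[g hg] : forall n, exists g : 'cV[R]_k -> R, trigpoly g /\
    (forall x : 'cV[R]_k, (forall i, `|x i 0| <= n%:R) ->
     `|g x - f x| <= n.+1%:R^-1).
  by move=> n; have [g ? ?] := app n; exists g.
apply: (@measurable_fun_cvg _ _ _ setT (fun n w => g n (S w))).
  by move=> n; apply: measurable_trigpoly => //; exact: (hg n).1.
move=> w _; apply/subr_cvg0; apply: norm_cvg0.
apply: (@squeeze_cvgr _ _ _ _ (cst 0) (@harmonic R)).
- exists (Num.bound (\sum_i `|S w i 0|)) => // n /= bn.
  rewrite normr_ge0/=; apply: (hg n).2 => i.
  apply: (@le_trans _ _ (\sum_i `|S w i 0|)).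
    by rewrite (bigD1 i)//= lerDl sumr_ge0.
  apply: le_trans (ltW (archi_boundP _)) _; first exact: sumr_ge0.
  by rewrite ler_nat.
- exact: cvg_cst.
- exact: cvg_harmonic.
Qed.

End LevyContinuity.

Section LevyContinuityTheorem.
Context {R : realType} {d d' : measure_display}
  {T : measurableType d} {T' : measurableType d'}.
Variables (P : probability T R) (Q : probability T' R) (k : nat).

Lemma cvg_Ex_trigpoly (S : nat -> T -> 'cV[R]_k) (G : T' -> 'cV[R]_k)
  (g : 'cV[R]_k -> R) :
  (forall n i, measurable_fun setT (fun w => S n w i 0)) ->
  (forall i, measurable_fun setT (fun w => G w i 0)) ->
  (forall (u : 'cV[R]_k) (a : R),
    Ex P (fun w => cos (mx_inner u (S n w) + a)) @[n --> \oo] -->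
    Ex Q (fun w => cos (mx_inner u (G w) + a))) ->
  trigpoly g ->
  Ex P (fun w => g (S n w)) @[n --> \oo] --> Ex Q (fun w => g (G w)).
Proof.
move=> mS mG cc.
have intS n h : trigpoly h -> P.-integrable setT (EFin \o (fun w => h (S n w))).
  move=> th; have [M hM] := trigpoly_bounded th.
  by apply: (@bounded_integrable _ _ _ _ _ M) => //; exact: measurable_trigpoly.
have intG h : trigpoly h -> Q.-integrable setT (EFin \o (fun w => h (G w))).
  move=> th; have [M hM] := trigpoly_bounded th.
  by apply: (@bounded_integrable _ _ _ _ _ M) => //; exact: measurable_trigpoly.
elim=> [u a|f1 f2 t1 h1 t2 h2|c f1 t1 h1]; first exact: cc.
- rewrite ExD; [|exact: intG..].
  rewrite (_ : (fun n => _) =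
    fun n => Ex P (fun w => f1 (S n w)) + Ex P (fun w => f2 (S n w))).
    exact: cvgD.
  by apply/funext => n; rewrite ExD//; exact: intS.
- rewrite ExZ; last exact: intG.
  rewrite (_ : (fun n => _) = fun n => c * Ex P (fun w => f1 (S n w))).
    by apply: cvgM => //; exact: cvg_cst.
  by apply/funext => n; rewrite ExZ//; exact: intS.
Qed.

Lemma levy_continuity (S : nat -> T -> 'cV[R]_k) (G : T' -> 'cV[R]_k)
  (f : 'cV[R]_k -> R) :
  (forall n i, measurable_fun setT (fun w => S n w i 0)) ->
  (forall i, measurable_fun setT (fun w => G w i 0)) ->
  (forall (u : 'cV[R]_k) (a : R),
    Ex P (fun w => cos (mx_inner u (S n w) + a)) @[n --> \oo] -->
    Ex Q (fun w => cos (mx_inner u (G w) + a))) ->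
  (forall i, tight P (fun n w => S n w i 0)) ->
  (forall i, tight Q (fun _ w => G w i 0)) ->
  bounded_continuous f ->
  Ex P (fun w => f (S n w)) @[n --> \oo] --> Ex Q (fun w => f (G w)).
Proof.
move=> mS mG cc tS tG bf; have [cf [M fM]] := bf.
have M0 : 0 <= M by exact: le_trans (fM 0).
have tS' : tight P (fun n w => \sum_i `|S n w i 0|).
  apply: tight_sum => i _; apply: tight_le (tS i) _ => n w.
  by rewrite normr_id.
have tG' : tight Q (fun _ w => \sum_i `|G w i 0|).
  apply: tight_sum => i _; apply: tight_le (tG i) _ => n w.
  by rewrite normr_id.
apply/cvgrPdist_le => e e0.
pose dl := e / (5 * (2 * M + 1)).
have M1 : 0 < 2 * M + 1 by rewrite ltr_wpDl// mulr_ge0.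
have dl0 : 0 < dl by rewrite divr_gt0// mulr_gt0.
have dlM : 2 * M * dl <= e / 5.
  have -> : 2 * M * dl = e / 5 * (2 * M / (2 * M + 1)).
    by rewrite /dl; field; rewrite gt_eqF.
  apply: ler_piMr; first by rewrite divr_ge0// ltW.
  by rewrite ler_pdivrMr// mul1r lerDl.
have [L1 hL1] := tS' _ dl0; have [L2 hL2] := tG' _ dl0.
have [N0 _ /(_ N0 (leqnn N0)) [E2 [mE2 pE2 bE2]]] := hL2.
pose L := Num.max 0 (Num.max L1 L2).
have e5 : 0 < e / 5 by rewrite divr_gt0.
have [||g tg [gM gf]] := @trigpoly_dense R k f M L (e / 5) cf fM => //.
  by rewrite le_max lexx.
have coordle (x : 'cV[R]_k) i : `|x i 0| <= \sum_i `|x i 0|.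
  by rewrite (bigD1 i)//= lerDl sumr_ge0.
have hG : `|Ex Q (fun w => g (G w)) - Ex Q (fun w => f (G w))| <= e / 5 + e / 5.
  apply: (le_trans (@Ex_close _ _ _ Q _ _ E2 M (e / 5) _ _ mE2 _ _ (ltW e5) _)) => //.
  - exact: measurable_trigpoly.
  - exact: measurable_continuous_comp.
  - move=> w Ew; apply: gf => i; apply: le_trans (coordle _ i) _.
    have := bE2 w Ew; rewrite ger0_norm ?sumr_ge0// => /le_trans; apply.
    by rewrite /L !le_max lexx !orbT.
  - by rewrite lerD2l (le_trans _ dlM)// ler_wpM2l// mulr_ge0.
have cg := cvg_Ex_trigpoly mS mG cc tg.
move/cvgrPdist_le : cg => /(_ _ e5) hg.
apply: filterS2 hL1 hg => n [E1 [mE1 pE1 bE1]] hgn.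
have hS : `|Ex P (fun w => g (S n w)) - Ex P (fun w => f (S n w))| <= e / 5 + e / 5.
  apply: (le_trans (@Ex_close _ _ _ P _ _ E1 M (e / 5) _ _ mE1 _ _ (ltW e5) _)) => //.
  - exact: measurable_trigpoly.
  - exact: measurable_continuous_comp.
  - move=> w Ew; apply: gf => i; apply: le_trans (coordle _ i) _.
    have := bE1 w Ew; rewrite ger0_norm ?sumr_ge0// => /le_trans; apply.
    by rewrite /L !le_max lexx !orbT.
  - by rewrite lerD2l (le_trans _ dlM)// ler_wpM2l// mulr_ge0.
move: hG hS hgn; rewrite !ler_norml => /andP[? ?] /andP[? ?] /andP[? ?].
by apply/andP; split; lra.
Qed.

End LevyContinuityTheorem.

(* A Gaussian limit of the characteristic functions gives both the tightness
   and the weak convergence. *)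
Lemma cvg_dist_of_charfun {R : realType} {d : measure_display}
  {T : measurableType d} (P : probability T R) (k : nat) (S : nat -> T -> 'cV[R]_k) (V : 'M[R]_k) :
  psd V ->
  (forall n i, measurable_fun setT (fun w => S n w i 0)) ->
  (forall (u : 'cV[R]_k) (a : R),
    Ex P (fun w => cos (mx_inner u (S n w) + a)) @[n --> \oo] -->
    cos a * expR (- ((u^T *m V *m u) 0 0 / 2))) ->
  cvg_dist_normal P S (fun u => (u^T *m V *m u) 0 0).
Proof.
move=> V0 mS cc.
have [d0 [T0 [Q0 [G [mG hG]]]]] := centred_normal_exists V0.
exists d0, T0, Q0, G; split=> // f bf.
have mG' i : measurable_fun setT (fun w => G w i 0) by exact: mG.
have minner u : measurable_fun setT (fun w => mx_inner u (G w)).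
  under eq_fun do rewrite mx_inner_sum.
  by apply: measurable_sumr => i _; exact: measurable_scale.
have GE u a : Ex Q0 (fun w => cos (mx_inner u (G w) + a)) =
    cos a * expR (- ((u^T *m V *m u) 0 0 / 2)).
  have [hc hs] := hG u.
  under eq_fun do rewrite cosD mulrC [sin _ * _]mulrC.
  rewrite ExB.
  - rewrite ExZ; last first.
      apply: (@bounded_integrable _ _ _ _ _ 1); last by move=> w; exact: cos_max.
      exact: measurable_cos_comp.
    rewrite ExZ; last first.
      apply: (@bounded_integrable _ _ _ _ _ 1); last by move=> w; exact: sin_max.
      exact: measurable_sin_comp.
    by rewrite [Ex Q0 _]hc [Ex Q0 _]hs mulr0 subr0.
  - apply: integrable_scale.
    apply: (@bounded_integrable _ _ _ _ _ 1); last by move=> w; exact: cos_max.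
    exact: measurable_cos_comp.
  - apply: integrable_scale.
    apply: (@bounded_integrable _ _ _ _ _ 1); last by move=> w; exact: sin_max.
    exact: measurable_sin_comp.
pose ei (i : 'I_k) (v : R) : 'cV[R]_k := \col_j (v *+ (j == i)).
have eiE i v x : mx_inner (ei i v) x = v * x i 0.
  rewrite mx_inner_sum (bigD1 i)//= big1 ?addr0; first by rewrite mxE eqxx mulr1n.
  by move=> j /negbTE ji; rewrite mxE ji mulr0n mul0r.
have qei i v : ((ei i v)^T *m V *m ei i v) 0 0 = V i i * v ^+ 2.
  rewrite mxE (bigD1 i)//= big1 ?addr0; last first.
    by move=> j /negbTE ji; rewrite [ei i v j 0]mxE ji mulr0n mulr0.
  rewrite [ei i v i 0]mxE eqxx mulr1n mxE (bigD1 i)//= big1 ?addr0; last first.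
    by move=> j /negbTE ji; rewrite !mxE ji mulr0n mul0r.
  by rewrite !mxE eqxx mulr1n; ring.
have Vii i : 0 <= V i i.
  by have := V0 (ei i 1); rewrite qei expr1n mulr1.
apply: levy_continuity => //.
- by move=> u a; rewrite GE; exact: cc.
- move=> i; apply: (tight_of_charfun (Vii i)) => // v.
  have := cc (ei i v) 0; rewrite cos0 mul1r qei.
  by under eq_fun do under eq_fun do rewrite eiE addr0.
- move=> i; apply: (tight_of_charfun (Vii i)) => // v.
  have := GE (ei i v) 0; rewrite cos0 mul1r qei => <-.
  rewrite (_ : Ex Q0 _ = Ex Q0 (fun w => cos (v * G w i 0))).
    exact: cvg_cst.
  by congr Ex; apply/funext => w; rewrite eiE addr0.
Qed.

Section ComplexExponential.
Context {R : realType}.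
Local Notation C := (complex R).
Implicit Types (x y : R) (z : C).

Definition cexp x : C := Complex (cos x) (sin x).

Lemma cexpD x y : cexp (x + y) = cexp x * cexp y.
Proof.
rewrite /cexp cosD sinD /GRing.mul/=; congr Complex.
by rewrite addrC.
Qed.

Lemma cexp0 : cexp 0 = 1.
Proof. by rewrite /cexp cos0 sin0. Qed.

Lemma cexp_sum (I : finType) (A : pred I) (F : I -> R) :
  cexp (\sum_(i | A i) F i) = \prod_(i | A i) cexp (F i).
Proof. by apply: (big_morph cexp cexpD cexp0). Qed.

Lemma normc_ge0 z : 0 <= Normc.normc z.
Proof. by case: z => a b /=; exact: sqrtr_ge0. Qed.

Lemma normc_cexp x : Normc.normc (cexp x) = 1.
Proof. by rewrite /= cos2Dsin2 sqrtr1. Qed.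

Lemma normr_Re_le z : `|complex.Re z| <= Normc.normc z.
Proof. by case: z => a b /=; rewrite -sqrtr_sqr ler_wsqrtr// lerDl sqr_ge0. Qed.

Lemma normr_Im_le z : `|complex.Im z| <= Normc.normc z.
Proof. by case: z => a b /=; rewrite -sqrtr_sqr ler_wsqrtr// lerDr sqr_ge0. Qed.

Lemma normc_le_ReIm z :
  Normc.normc z <= `|complex.Re z| + `|complex.Im z|.
Proof.
case: z => a b /=; rewrite -[leRHS]ger0_norm ?addr_ge0// -sqrtr_sqr.
rewrite ler_wsqrtr// sqrrD !real_normK ?num_real// addrAC lerDl.
by rewrite mulrn_wge0// mulr_ge0.
Qed.

Lemma normc_real x : Normc.normc (Complex x 0) = `|x|.
Proof. by rewrite /= expr0n addr0 sqrtr_sqr. Qed.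

Lemma ReD (z z' : C) : complex.Re (z + z') = complex.Re z + complex.Re z'.
Proof. by case: z z' => ? ? []. Qed.

Lemma ImD (z z' : C) : complex.Im (z + z') = complex.Im z + complex.Im z'.
Proof. by case: z z' => ? ? []. Qed.

Lemma ReM (z z' : C) : complex.Re (z * z') =
  complex.Re z * complex.Re z' - complex.Im z * complex.Im z'.
Proof. by case: z z' => ? ? []. Qed.

Lemma ImM (z z' : C) : complex.Im (z * z') =
  complex.Re z * complex.Im z' + complex.Im z * complex.Re z'.
Proof. by case: z z' => ? ? []. Qed.

Lemma ReN z : complex.Re (- z) = - complex.Re z. Proof. by case: z. Qed.
Lemma ImN z : complex.Im (- z) = - complex.Im z. Proof. by case: z. Qed.

Lemma Re_sum (I : finType) (F : I -> C) :
  complex.Re (\sum_i F i) = \sum_i complex.Re (F i).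
Proof. by apply: (big_morph (@complex.Re R) ReD erefl). Qed.

Lemma Im_sum (I : finType) (F : I -> C) :
  complex.Im (\sum_i F i) = \sum_i complex.Im (F i).
Proof. by apply: (big_morph (@complex.Im R) ImD erefl). Qed.

Lemma complex_ext (z z' : C) : complex.Re z = complex.Re z' ->
  complex.Im z = complex.Im z' -> z = z'.
Proof. by case: z z' => ? ? [? ?] /= -> ->. Qed.

Lemma Complex_realM x y : Complex (x * y) 0 = Complex x 0 * Complex y 0 :> C.
Proof. by apply: complex_ext; rewrite /= ?mulr0 ?mul0r ?subr0 ?addr0. Qed.

Lemma Complex_real_prod (I : finType) (F : I -> R) :
  Complex (\prod_i F i) 0 = \prod_i Complex (F i) 0 :> C.
Proof.
by apply: (big_morph (fun x => Complex x 0 : C) Complex_realM).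
Qed.

Lemma normc_prod_le1 (I : finType) (A : pred I) (F : I -> C) :
  (forall i, Normc.normc (F i) <= 1) ->
  Normc.normc (\prod_(i | A i) F i) <= 1.
Proof.
move=> F1; elim/big_rec: _ => [|i z _ z1]; first by rewrite Normc.normc1.
by rewrite Normc.normcM mulr_ile1// normc_ge0.
Qed.

Lemma normc_prod_sub (n : nat) (F G : 'I_n -> C) (e : R) :
  (forall i, Normc.normc (F i) <= 1) -> (forall i, Normc.normc (G i) <= 1) ->
  (forall i, Normc.normc (F i - G i) <= e) ->
  Normc.normc (\prod_i F i - \prod_i G i) <= n%:R * e.
Proof.
elim: n F G => [|n IH] F G F1 G1 FG.
  by rewrite !big_ord0 subrr Normc.normc0 mul0r.
rewrite !big_ord_recl.
set f := F _; set g := G _; set PF := \prod_i _; set PG := \prod_i _.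
have -> : f * PF - g * PG = (f - g) * PF + g * (PF - PG) by ring.
apply: le_trans (le_normcD _ _) _; rewrite !Normc.normcM -natr1 mulrDl mul1r addrC.
apply: lerD.
  have hI : Normc.normc (PF - PG) <= n%:R * e by apply: IH.
  apply: le_trans hI; rewrite -[leRHS]mul1r.
  by apply: ler_wpM2r; [exact: normc_ge0|exact: G1].
apply: le_trans (ler_wpM2l (normc_ge0 _) (normc_prod_le1 _ _)) _ => //.
by rewrite mulr1; exact: FG.
Qed.

Definition ccvg (z : nat -> C) (l : C) :=
  complex.Re (z n) @[n --> \oo] --> complex.Re l /\
  complex.Im (z n) @[n --> \oo] --> complex.Im l.

Lemma ccvg_cst l : ccvg (fun=> l) l.
Proof. by split; exact: cvg_cst. Qed.

Lemma ccvgD (z z' : nat -> C) (l l' : C) : ccvg z l -> ccvg z' l' ->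
  ccvg (fun n => z n + z' n) (l + l').
Proof.
move=> [h1 h2] [h3 h4]; split.
  by rewrite ReD; under eq_fun do rewrite ReD; exact: cvgD.
by rewrite ImD; under eq_fun do rewrite ImD; exact: cvgD.
Qed.

Lemma ccvgM (z z' : nat -> C) (l l' : C) : ccvg z l -> ccvg z' l' ->
  ccvg (fun n => z n * z' n) (l * l').
Proof.
move=> [h1 h2] [h3 h4]; split.
  by rewrite ReM; under eq_fun do rewrite ReM; apply: cvgB; exact: cvgM.
by rewrite ImM; under eq_fun do rewrite ImM; apply: cvgD; exact: cvgM.
Qed.

Lemma ccvg_sum (I : finType) (z : I -> nat -> C) (l : I -> C) :
  (forall i, ccvg (z i) (l i)) ->
  ccvg (fun n => \sum_i z i n) (\sum_i l i).
Proof.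
move=> h; have : ccvg (\sum_i z i) (\sum_i l i).
  elim/big_rec2: _ => [|i y x _ hh]; first exact: ccvg_cst.
  exact: (ccvgD (h i)).
by congr ccvg; apply/funext => n; rewrite fct_sumE.
Qed.

Lemma ccvg_prod (I : finType) (z : I -> nat -> C) (l : I -> C) :
  (forall i, ccvg (z i) (l i)) ->
  ccvg (fun n => \prod_i z i n) (\prod_i l i).
Proof.
move=> h; have : ccvg (\prod_i z i) (\prod_i l i).
  elim/big_rec2: _ => [|i y x _ hh]; first exact: ccvg_cst.
  exact: (ccvgM (h i)).
by congr ccvg; apply/funext => n; rewrite fct_prodE.
Qed.

Lemma ccvg_unique (z : nat -> C) (l l' : C) : ccvg z l -> ccvg z l' -> l = l'.
Proof.
by move=> [h1 h2] [h3 h4]; apply: complex_ext;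
  [exact: cvg_unique h1 h3|exact: cvg_unique h2 h4].
Qed.

Lemma ccvg_cexp (x : nat -> R) l : x n @[n --> \oo] --> l ->
  ccvg (fun n => cexp (x n)) (cexp l).
Proof.
by move=> xl; split=> /=;
  [exact: (cvg_comp _ _ xl (@continuous_cos R l))
  |exact: (cvg_comp _ _ xl (@continuous_sin R l))].
Qed.

Lemma ccvg_sub0 (z z' : nat -> C) (l : C) : ccvg z l ->
  Normc.normc (z' n - z n) @[n --> \oo] --> (0 : R) -> ccvg z' l.
Proof.
move=> [h1 h2] h0.
have hb (x : nat -> R) : (forall n, `|x n| <= Normc.normc (z' n - z n)) ->
    x n @[n --> \oo] --> (0 : R).
  move=> hx; apply: norm_cvg0.
  apply: (@squeeze_cvgr _ _ _ _ (cst 0) _ _ _ _ _ h0); last exact: cvg_cst.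
  by apply: nearW => n; rewrite normr_ge0 hx.
split.
  rewrite -[complex.Re l]add0r (_ : (fun n => complex.Re _) =
      fun n => complex.Re (z' n - z n) + complex.Re (z n)).
    by apply: cvgD => //; apply: hb => n; exact: normr_Re_le.
  by apply/funext => n; rewrite ReD ReN subrK.
rewrite -[complex.Im l]add0r (_ : (fun n => complex.Im _) =
    fun n => complex.Im (z' n - z n) + complex.Im (z n)).
  by apply: cvgD => //; apply: hb => n; exact: normr_Im_le.
by apply/funext => n; rewrite ImD ImN subrK.
Qed.

End ComplexExponential.

Section ComplexExpectation.
Context {R : realType} {d : measure_display} {T : measurableType d}.
Variable P : probability T R.
Local Notation C := (complex R).

Definition cmeasurable (f : T -> C) :=
  measurable_fun setT (fun w => complex.Re (f w)) /\
  measurable_fun setT (fun w => complex.Im (f w)).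

Definition CE (f : T -> C) : C :=
  Complex (Ex P (fun w => complex.Re (f w))) (Ex P (fun w => complex.Im (f w))).

Lemma cmeasurableM (f g : T -> C) : cmeasurable f -> cmeasurable g ->
  cmeasurable (fun w => f w * g w).
Proof.
move=> [f1 f2] [g1 g2]; split.
  under eq_fun do rewrite ReM.
  by apply: measurable_funB; exact: measurable_funM.
under eq_fun do rewrite ImM.
by apply: measurable_funD; exact: measurable_funM.
Qed.

Lemma cmeasurable_cst (z : C) : cmeasurable (fun=> z).
Proof. by split; exact: measurable_cst. Qed.

Lemma cmeasurable_cexp (x : T -> R) : measurable_fun setT x ->
  cmeasurable (fun w => cexp (x w)).
Proof.
by move=> mx; split; [exact: measurable_cos_comp|exact: measurable_sin_comp].
Qed.

Lemma CE_sub_le (f g : T -> C) (h : T -> R) : cmeasurable f -> cmeasurable g ->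
  (exists M, forall w, Normc.normc (f w) <= M) ->
  (exists M, forall w, Normc.normc (g w) <= M) ->
  P.-integrable setT (EFin \o h) ->
  (forall w, Normc.normc (f w - g w) <= h w) ->
  Normc.normc (CE f - CE g) <= 2 * Ex P h.
Proof.
move=> [f1 f2] [g1 g2] [M fM] [N gN] hi fg.
have i1 : P.-integrable setT (EFin \o (fun w => complex.Re (f w))).
  by apply: (@bounded_integrable _ _ _ _ _ M) => // w; exact: le_trans (normr_Re_le _) _.
have i2 : P.-integrable setT (EFin \o (fun w => complex.Im (f w))).
  by apply: (@bounded_integrable _ _ _ _ _ M) => // w; exact: le_trans (normr_Im_le _) _.
have i3 : P.-integrable setT (EFin \o (fun w => complex.Re (g w))).
  by apply: (@bounded_integrable _ _ _ _ _ N) => // w; exact: le_trans (normr_Re_le _) _.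
have i4 : P.-integrable setT (EFin \o (fun w => complex.Im (g w))).
  by apply: (@bounded_integrable _ _ _ _ _ N) => // w; exact: le_trans (normr_Im_le _) _.
apply: le_trans (normc_le_ReIm _) _.
rewrite /= -!ExB// -[2]/(1 + 1) mulrDl !mul1r; apply: lerD.
  apply: le_trans (Ex_norm (integrable_subr i1 i3)) _.
  apply: Ex_le => //; first exact/integrable_normr/integrable_subr.
  by move=> w; rewrite -ReN -ReD; exact: le_trans (normr_Re_le _) _.
apply: le_trans (Ex_norm (integrable_subr i2 i4)) _.
apply: Ex_le => //; first exact/integrable_normr/integrable_subr.
by move=> w; rewrite -ImN -ImD; exact: le_trans (normr_Im_le _) _.
Qed.

Lemma ccvg_CE (F : nat -> T -> C) (f : T -> C) (M : R) :
  (forall n, cmeasurable (F n)) -> (forall w, ccvg (F^~ w) (f w)) ->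
  (forall n w, Normc.normc (F n w) <= M) -> ccvg (fun n => CE (F n)) (CE f).
Proof.
move=> mF cF FM; split=> /=; apply: (@cvg_Ex _ _ _ P _ _ (fun=> M)).
- by move=> n; have [] := mF n.
- by move=> w; have [] := cF w.
- exact: integrable_cst.
- by move=> n w; exact: le_trans (normr_Re_le _) _.
- by move=> n; have [] := mF n.
- by move=> w; have [] := cF w.
- exact: integrable_cst.
- by move=> n w; exact: le_trans (normr_Im_le _) _.
Qed.

Lemma CEZ (z : C) (f : T -> C) : cmeasurable f -> (exists M, forall w, Normc.normc (f w) <= M) ->
  CE (fun w => z * f w) = z * CE f.
Proof.
move=> [f1 f2] [M fM].
have i1 : P.-integrable setT (EFin \o (fun w => complex.Re (f w))).
  by apply: (@bounded_integrable _ _ _ _ _ M) => // w; exact: le_trans (normr_Re_le _) _.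
have i2 : P.-integrable setT (EFin \o (fun w => complex.Im (f w))).
  by apply: (@bounded_integrable _ _ _ _ _ M) => // w; exact: le_trans (normr_Im_le _) _.
apply: complex_ext => /=.
  under eq_fun do rewrite ReM; rewrite ReM/= ExB ?ExZ//; exact: integrable_scale.
by under eq_fun do rewrite ImM; rewrite ImM/= ExD ?ExZ//; exact: integrable_scale.
Qed.

Definition finite_rv (F : finType) (W : T -> F) :=
  forall f : F, measurable [set w | W w = f].

Lemma finite_rvE (F : finType) (W : T -> F) (g : F -> R) w :
  g (W w) = \sum_f g f * \1_[set w | W w = f] w.
Proof.
rewrite (bigD1 (W w))//= indicE mem_set// mulr1 big1 ?addr0// => f fW.
by rewrite indicE memNset ?mulr0//= => Wf; rewrite Wf eqxx in fW.
Qed.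

Lemma measurable_finite_rv (F : finType) (W : T -> F) (g : F -> R) :
  finite_rv W -> measurable_fun setT (fun w => g (W w)).
Proof.
move=> mW; under eq_fun do rewrite finite_rvE.
apply: measurable_sumr => f _; apply: measurable_scale.
exact: measurable_indic.
Qed.

Lemma integrable_finite_rv (F : finType) (W : T -> F) (g : F -> R) :
  finite_rv W -> P.-integrable setT (EFin \o (fun w => g (W w))).
Proof.
move=> mW; apply: (@bounded_integrable _ _ _ _ _ (\sum_f `|g f|)).
  exact: measurable_finite_rv.
by move=> w; rewrite (bigD1 (W w))//= lerDl sumr_ge0.
Qed.

Lemma Ex_finite_rv (F : finType) (W : T -> F) (g : F -> R) : finite_rv W ->
  Ex P (fun w => g (W w)) = \sum_f g f * prob P [set w | W w = f].
Proof.
move=> mW; under eq_fun do rewrite finite_rvE.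
have iE f : P.-integrable setT (EFin \o (\1_[set w | W w = f] : T -> R)).
  apply: (@bounded_integrable _ _ _ _ _ 1); first exact: measurable_indic.
  by move=> w; rewrite indicE; case: (_ \in _); rewrite ?normr1 ?normr0.
rewrite Ex_sum; last by move=> f _; exact: integrable_scale.
by apply: eq_bigr => f _; rewrite ExZ// Ex_indic.
Qed.

Lemma CE_finite_rv (F : finType) (W : T -> F) (g : F -> C) : finite_rv W ->
  CE (fun w => g (W w)) = \sum_f g f * Complex (prob P [set w | W w = f]) 0.
Proof.
move=> mW; apply: complex_ext => /=.
  rewrite Re_sum (Ex_finite_rv (fun f => complex.Re (g f)))//.
  by apply: eq_bigr => f _; rewrite ReM/= mulr0 subr0.
rewrite Im_sum (Ex_finite_rv (fun f => complex.Im (g f)))//.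
by apply: eq_bigr => f _; rewrite ImM/= mulr0 add0r.
Qed.

Lemma cmeasurable_finite_rv (F : finType) (W : T -> F) (g : F -> C) :
  finite_rv W -> cmeasurable (fun w => g (W w)).
Proof.
move=> mW; split.
  exact: (measurable_finite_rv (fun f => complex.Re (g f))).
exact: (measurable_finite_rv (fun f => complex.Im (g f))).
Qed.

Lemma finite_rv_pair (F F' : finType) (W : T -> F) (W' : T -> F') :
  finite_rv W -> finite_rv W' -> finite_rv (fun w => (W w, W' w)).
Proof.
move=> mW mW' [f f'].
rewrite (_ : [set w | _] = [set w | W w = f] `&` [set w | W' w = f']).
  exact: measurableI.
by apply/seteqP; split=> [w /= [-> ->]|w /= [-> ->]].
Qed.

Lemma finite_rv_ffun (I F : finType) (W : I -> T -> F) :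
  (forall i, finite_rv (W i)) -> finite_rv (fun w => [ffun i => W i w]).
Proof.
move=> mW f.
rewrite (_ : [set w | _] = \bigcap_(i in [set: I]) [set w | W i w = f i]).
  apply: fin_bigcap_measurable; first exact: finite_finset.
  by move=> i _; exact: mW.
apply/seteqP; split=> [w /= <- i _|w /= h]; first by rewrite ffunE.
by apply/ffunP => i; rewrite ffunE h.
Qed.

End ComplexExpectation.

(** * Conditional independence of the units *)

Section Discretization.
Context {R : realType}.

Definition gridN (m : nat) : nat := (2 * (m * m))%N.
Definition code (m : nat) (x : R) : 'I_(gridN m).+1 :=
  inord (Num.truncn (m%:R * (x + m%:R))).
Definition decode (m : nat) (c : 'I_(gridN m).+1) : R := c%:R / m%:R - m%:R.

Lemma measurable_code (m : nat) (c : 'I_(gridN m).+1) :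
  measurable [set x : R | code m x = c].
Proof.
pose y (x : R) := m%:R * (x + m%:R).
have my : measurable_fun setT y.
  by apply: measurable_scale; exact: measurable_funD.
rewrite (_ : [set x | _] =
    \bigcup_(j in [set j | inord j = c]) [set x | Num.truncn (y x) = j]); last first.
  apply/seteqP; split=> [x /= <-|x [j /= hj xj]]; last by rewrite /code xj.
  by exists (Num.truncn (y x)).
apply: bigcup_measurable => j _.
have mlt c' : measurable [set x | y x < c'].
  rewrite (_ : [set x | _] = [set x | - c' < - y x]).
    by apply: measurable_gt_set; exact: measurableT_comp.
  by apply/seteqP; split=> x /=; rewrite ltrN2.
case: j => [|j].
  rewrite (_ : [set x | _] = [set x | y x < 1])//.
  by apply/seteqP; split=> x /=; rewrite -[1]/(1%:R) -truncn_le_nat leqn0 => /eqP.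
rewrite (_ : [set x | _] = [set x | y x < j.+2%:R] `\` [set x | y x < j.+1%:R]).
  exact: measurableD.
apply/seteqP; split=> x /=; rewrite -!truncn_le_nat.
  by move=> ->; split=> //; rewrite ltnn.
by move=> [h1 /negP]; rewrite -ltnNge => h2; apply/eqP; rewrite eqn_leq h1.
Qed.

Lemma cvg_decode (x : R) : decode (code m x) @[m --> \oo] --> x.
Proof.
apply/subr_cvg0; apply: norm_cvg0.
apply: (@squeeze_cvgr _ _ _ _ (cst 0) (fun m : nat => m%:R^-1)).
- exists (Num.bound `|x|).+1 => // m /= xm.
  have m0 : (0 < m)%N by exact: leq_trans xm.
  have m0' : 0 < m%:R :> R by rewrite ltr0n.
  have xlem : `|x| <= m%:R.
    apply: le_trans (ltW (archi_boundP (normr_ge0 x))) _.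
    by rewrite ler_nat ltnW.
  move: xlem; rewrite ler_norml => /andP[xl xr].
  have y0 : 0 <= m%:R * (x + m%:R).
    by rewrite mulr_ge0// -lerBlDr sub0r.
  have /andP[t1 t2] := truncn_itv y0.
  rewrite normr_ge0 /decode /code inordK; last first.
    rewrite ltnS -(ler_nat R) (le_trans t1)// /gridN !natrM.
    by rewrite mulrCA ler_wpM2l//; lra.
  set t := Num.truncn _ in t1 t2 *.
  have -> : t%:R / m%:R - m%:R - x = (t%:R - m%:R * (x + m%:R)) / m%:R.
    by field; rewrite gt_eqF.
  rewrite normrM normfV [`|m%:R|]ger0_norm// ler_piMl ?invr_ge0//.
  by rewrite ler_norml; rewrite -natr1 in t2; apply/andP; split; lra.
- exact: cvg_cst.
- rewrite -(cvg_shiftS (fun n => n%:R^-1 : R)); exact: cvg_harmonic.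
Qed.

End Discretization.

Section Independence.
Context {R : realType} {d : measure_display} {T : measurableType d}.
Variables (P : probability T R) (k p : nat) (zT : finType).
Variables (Y : nat -> 'I_k -> T -> R) (Z : nat -> T -> zT)
          (X : nat -> 'I_p -> T -> R) (A : nat -> T -> 'I_k) (pi : 'I_k -> R).
Hypotheses (hC1 : C1 P Y Z X) (hC2 : C2 P Y Z X A pi).

Lemma card_set_bool n (b : 'I_n -> bool) :
  #|[set i | b i]%classic| = (\sum_i b i)%N.
Proof.
rewrite -sum1_card big_mkcond/=; apply: eq_bigr => i _.
suff -> : (i \in in_set [set i | b i]%classic) = b i by case: (b i).
by rewrite unfold_in; apply/asboolP/idP.
Qed.

Lemma nZE n z w : nZ Z n z w = (\sum_(i < n) (Z i w == z))%N.
Proof. exact: card_set_bool. Qed.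

Lemma ntZE n t z w :
  ntZ Z A n t z w = (\sum_(i < n) ((Z i w == z) && (A i w == t)))%N.
Proof. exact: card_set_bool. Qed.

Lemma ntE n t w : nt A n t w = (\sum_(i < n) (A i w == t))%N.
Proof. exact: card_set_bool. Qed.

Definition pz (z : zT) : R := prob P [set w | Z 0%N w = z].

Lemma measurable_Z i z : measurable [set w | Z i w = z].
Proof. by case: hC1 => _ [_ [mZ _]]. Qed.

Lemma measurable_preimage_real (f : T -> R) (S : set R) :
  measurable_fun setT f -> measurable S -> measurable [set w | S (f w)].
Proof. by move=> mf mS; have := mf measurableT S mS; rewrite setTI. Qed.

Lemma measurable_rect i SY (z : zT) SX :
  (forall t, measurable (SY t)) -> (forall j, measurable (SX j)) ->
  measurable (rect_ev Y Z X i SY [set z]%SET SX).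
Proof.
move=> mSY mSX; have [mY [mX [mZ _]]] := hC1.
rewrite (_ : rect_ev _ _ _ _ _ _ _ =
   (\bigcap_(t in [set: 'I_k]) [set w | SY t (Y i t w)]) `&`
   ([set w | Z i w = z] `&` \bigcap_(j in [set: 'I_p]) [set w | SX j (X i j w)])).
  apply: measurableI.
    apply: fin_bigcap_measurable; first exact: finite_finset.
    by move=> t _; exact: measurable_preimage_real.
  apply: measurableI => //; apply: fin_bigcap_measurable.
    exact: finite_finset.
  by move=> t _; exact: measurable_preimage_real.
rewrite /rect_ev; apply/seteqP; split=> w /=.
  by move=> [h1 [/finset.set1P h2 h3]]; split=> [t _|]//; split=> // j _.
move=> [h1 [h2 h3]]; split=> [t|]; first exact: h1.
by split=> [|j]; [rewrite finset.in_set1; apply/eqP|exact: h3].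
Qed.

Lemma prob_rect n (SY : 'I_n -> 'I_k -> set R) (zs : 'I_n -> zT)
    (SX : 'I_n -> 'I_p -> set R) :
  (forall i t, measurable (SY i t)) -> (forall i j, measurable (SX i j)) ->
  prob P [set w | forall i : 'I_n, (forall t, SY i t (Y i t w)) /\
     Z i w = zs i /\ (forall j, SX i j (X i j w))] =
  \prod_(i < n) prob P (rect_ev Y Z X 0%N (SY i) [set zs i]%SET (SX i)).
Proof.
move=> mSY mSX.
have [_ [_ [_ [ind [idd _]]]]] := hC1.
pose SY' (i : nat) := if insub i is Some i' then SY i' else fun=> setT.
pose SX' (i : nat) := if insub i is Some i' then SX i' else fun=> setT.
pose SZ' (i : nat) := if insub i is Some i' then [set zs i']%SET else finset.setT.
have mSY' i t : measurable (SY' i t) by rewrite /SY'; case: insub.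
have mSX' i t : measurable (SX' i t) by rewrite /SX'; case: insub.
have := ind n SY' SZ' SX' mSY' mSX' => /(congr1 fine).
rewrite -[LHS]/(prob P _).
have -> : \bigcap_(i in [set i | (i < n)%N]) rect_ev Y Z X i (SY' i) (SZ' i) (SX' i) =
   [set w | forall i : 'I_n, (forall t, SY i t (Y i t w)) /\
     Z i w = zs i /\ (forall j, SX i j (X i j w))].
  apply/seteqP; split=> w /= h i.
    have := h i (ltn_ord i); rewrite /rect_ev /SY' /SX' /SZ'/= valK.
    by rewrite finset.in_set1 => -[? [/eqP ? ?]].
  move=> lin; have := h (Ordinal lin); rewrite /rect_ev /SY' /SX' /SZ'/=.
  by rewrite insubT/= finset.in_set1 => -[? [/eqP ? ?]].
move=> ->.
have -> : (\prod_(i < n) P (rect_ev Y Z X i (SY' i) (SZ' i) (SX' i)))%E =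
    (\prod_(i < n) prob P (rect_ev Y Z X 0%N (SY i) [set zs i]%SET (SX i)))%:E.
  rewrite -prodEFin; apply: eq_bigr => i _.
  rewrite /SY' /SX' /SZ' valK idd// probE//.
  exact: measurable_rect.
by [].
Qed.

Lemma prob_Z i z : prob P [set w | Z i w = z] = pz z.
Proof.
have [_ [_ [_ [_ [idd _]]]]] := hC1.
have E i' : rect_ev Y Z X i' (fun=> setT) [set z]%SET (fun=> setT) =
    [set w | Z i' w = z].
  rewrite /rect_ev; apply/seteqP; split=> w /=.
    by move=> [_ [/finset.set1P]].
  by move=> zw; split=> //; split=> //; apply/finset.set1P.
by rewrite /pz -(E i) -(E 0%N) /prob idd.
Qed.

Lemma rect_set1T z : prob P (rect_ev Y Z X 0%N (fun=> setT) [set z]%SET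
  (fun=> setT)) = pz z.
Proof.
rewrite /pz; congr prob; rewrite /rect_ev; apply/seteqP; split=> w /=.
  by move=> [_ [/finset.set1P]].
by move=> zw; split=> //; split=> //; apply/finset.set1P.
Qed.

(* The almost sure limit of [0 / 0 = 0] cannot be the positive [pi t]. *)
Lemma pz_gt0 (t : 'I_k) z : 0 < pi t -> 0 < pz z.
Proof.
move=> pit; rewrite lt_neqAle prob_ge0 andbT; apply/eqP => pz0.
have [_ [_ cv]] := hC2.
have nz : {ae P, forall w, forall i, ~ (Z i w = z)}.
  apply: ae_foralln => i; exists [set w | Z i w = z].
  split; first exact: measurable_Z.
    apply: (eq_trans (probE P (measurable_Z i z))).
    by rewrite prob_Z -pz0.
  by move=> w /= /contrapT.
have [w [nw cw]] : exists w, (forall i, ~ (Z i w = z)) /\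
    ((fun n => (ntZ Z A n t z w)%:R / (nZ Z n z w)%:R : R) @ \oo --> pi t).
  apply/not_existsP => h.
  have : {ae P, forall w : T, False}.
    apply: filterS2 nz (cv z t) => w h1 h2; exact: (h w (conj h1 h2)).
  move=> /(prob_eq1 measurable0); rewrite /prob measure0 /= => /eqP.
  by rewrite eq_sym oner_eq0.
have : (fun n => (ntZ Z A n t z w)%:R / (nZ Z n z w)%:R : R) @ \oo --> (0 : R).
  rewrite (_ : (fun n => _) = fun=> 0); first exact: cvg_cst.
  apply/funext => n; rewrite (_ : nZ Z n z w = 0%N) ?invr0 ?mulr0//.
  rewrite nZE big1// => i _; case: eqP => // /nw[].
move=> c0; have pt0 : pi t = 0 by exact: cvg_unique cw c0.
by rewrite pt0 ltxx in pit.
Qed.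

Hypothesis pzpos : forall z, 0 < pz z.

Definition AZev n (a : 'I_n -> 'I_k) (zs : 'I_n -> zT) : set T :=
  [set w | forall i : 'I_n, A i w = a i] `&` [set w | forall i : 'I_n, Z i w = zs i].

Lemma prob_AZ_rect n (a : 'I_n -> 'I_k) (zs : 'I_n -> zT)
    (SY : 'I_n -> 'I_k -> set R) (SX : 'I_n -> 'I_p -> set R) :
  (forall i t, measurable (SY i t)) -> (forall i j, measurable (SX i j)) ->
  prob P (AZev a zs `&` [set w | forall i : 'I_n,
     (forall t, SY i t (Y i t w)) /\ (forall j, SX i j (X i j w))]) =
  prob P (AZev a zs) * \prod_(i < n)
    (prob P (rect_ev Y Z X 0%N (SY i) [set zs i]%SET (SX i)) / pz (zs i)).
Proof.
move=> mSY mSX; have [mA [ci _]] := hC2; have [mY [mX [mZ _]]] := hC1.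
have := ci n a zs SY SX mSY mSX.
set EA := [set w | _]; set EYX := [set w | _]; set EZ := [set w | _] => /= eP.
have mEA : measurable EA.
  rewrite (_ : EA = \bigcap_(i in [set: 'I_n]) [set w | A i w = a i]).
    apply: fin_bigcap_measurable; first exact: finite_finset.
    by move=> i _; exact: mA.
  by apply/seteqP; split=> w /= h i; [move=> _; exact: h|exact: h].
have mEZ : measurable EZ.
  rewrite (_ : EZ = \bigcap_(i in [set: 'I_n]) [set w | Z i w = zs i]).
    apply: fin_bigcap_measurable; first exact: finite_finset.
    by move=> i _; exact: mZ.
  by apply/seteqP; split=> w /= h i; [move=> _; exact: h|exact: h].
have mEYX : measurable EYX.
  rewrite (_ : EYX = \bigcap_(i in [set: 'I_n])
     ((\bigcap_(t in [set: 'I_k]) [set w | SY i t (Y i t w)]) `&`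
      \bigcap_(j in [set: 'I_p]) [set w | SX i j (X i j w)])).
    apply: fin_bigcap_measurable; first exact: finite_finset.
    move=> i _; apply: measurableI; (apply: fin_bigcap_measurable;
      first exact: finite_finset) => t _; exact: measurable_preimage_real.
  apply/seteqP; split=> w /= h i.
    by move=> _; have [h1 h2] := h i; split=> t _; [exact: h1|exact: h2].
  by have [h1 h2] := h i I; split=> t; [exact: h1|exact: h2].
have pZ : prob P EZ = \prod_(i < n) pz (zs i).
  have := @prob_rect n (fun _ _ => setT) zs (fun _ _ => setT).
  under [X in _ -> _ -> _ = X]eq_bigr do rewrite rect_set1T.
  move=> <-//; congr prob; apply/seteqP; split=> w /= h i.
    by split=> //; split=> //; exact: h.
  by have [_ []] := h i.
have pYXZ : prob P (EYX `&` EZ) = \prod_(i < n)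
    prob P (rect_ev Y Z X 0%N (SY i) [set zs i]%SET (SX i)).
  rewrite -prob_rect//; congr prob; apply/seteqP; split=> w /=.
    by move=> [h1 h2] i; have [? ?] := h1 i; split=> //; split=> //; exact: h2.
  by move=> h; split=> i; have [? []] := h i.
have mI1 := measurableI _ _ mEA mEYX.
have mI2 := measurableI _ _ mI1 mEZ.
have mI3 := measurableI _ _ mEA mEZ.
have mI4 := measurableI _ _ mEYX mEZ.
move: eP; rewrite !probE// -!EFinM => -[] eP.
have Z0 : \prod_(i < n) pz (zs i) != 0.
  by apply/prodf_neq0 => i _; rewrite gt_eqF.
rewrite big_split/= prodfV -pYXZ -/(AZev a zs).
rewrite -[X in prob P X](_ : EA `&` EYX `&` EZ = _); last first.
  by rewrite /AZev -/EA -/EZ -!setIA [EYX `&` _]setIC.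
apply: (mulIf Z0); rewrite -{1}pZ eP /AZev -/EA -/EZ.
by rewrite mulrA mulfVK.
Qed.

Definition Af n w : {ffun 'I_n -> 'I_k} := [ffun i : 'I_n => A i w].
Definition Zf n w : {ffun 'I_n -> zT} := [ffun i : 'I_n => Z i w].

Definition unit_coord i (c : 'I_k + 'I_p) (w : T) : R :=
  match c with inl t => Y i t w | inr j => X i j w end.

Lemma measurable_unit_coord i c : measurable_fun setT (unit_coord i c).
Proof. by have [mY [mX _]] := hC1; case: c => [t|j]; [exact: mY|exact: mX]. Qed.

Definition codes m i (w : T) : {ffun 'I_k + 'I_p -> 'I_(gridN m).+1} :=
  [ffun c => code m (unit_coord i c w)].

Lemma finite_rv_codes m i : finite_rv (codes m i).
Proof.
apply: (finite_rv_ffun (W := fun c w => code m (unit_coord i c w))) => c f.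
apply: (measurable_preimage_real (S := [set x | code m x = f])).
  exact: measurable_unit_coord.
exact: measurable_code.
Qed.

Lemma finite_rv_A i : finite_rv (A i).
Proof. by have [mA _] := hC2; exact: mA. Qed.

Lemma finite_rv_Z i : finite_rv (Z i).
Proof. exact: measurable_Z. Qed.

Lemma finite_rv_AZ n : finite_rv (fun w => (Af n w, Zf n w)).
Proof.
apply: finite_rv_pair; apply: finite_rv_ffun => i.
  exact: finite_rv_A.
exact: finite_rv_Z.
Qed.

Lemma prob_AZ n (a : {ffun 'I_n -> 'I_k}) (zs : {ffun 'I_n -> zT}) :
  prob P [set w | (Af n w, Zf n w) = (a, zs)] = prob P (AZev a zs).
Proof.
congr prob; apply/seteqP; split=> w /=.
  by move=> [<- <-]; split=> i /=; rewrite ffunE.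
by move=> [h1 h2]; congr pair; apply/ffunP => i; rewrite ffunE ?h1 ?h2.
Qed.

Definition cond_code m (f : {ffun 'I_k + 'I_p -> 'I_(gridN m).+1}) z : R :=
  prob P [set w | (codes m 0 w, Z 0%N w) = (f, z)] / pz z.

Lemma prob_AZ_codes m n (a : {ffun 'I_n -> 'I_k}) (zs : {ffun 'I_n -> zT})
    (g : {ffun 'I_n -> {ffun 'I_k + 'I_p -> 'I_(gridN m).+1}}) :
  prob P [set w | ((Af n w, Zf n w), [ffun i : 'I_n => codes m i w]) =
     ((a, zs), g)] =
  prob P [set w | (Af n w, Zf n w) = (a, zs)] *
  \prod_(i < n) cond_code (g i) (zs i).
Proof.
rewrite prob_AZ.
have := @prob_AZ_rect n a zs
  (fun i t => [set x | code m x = g i (inl t)])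
  (fun i j => [set x | code m x = g i (inr j)])
  (fun i t => measurable_code _) (fun i j => measurable_code _).
rewrite (_ : _ `&` _ = [set w | ((Af n w, Zf n w),
    [ffun i : 'I_n => codes m i w]) = ((a, zs), g)]); last first.
  apply/seteqP; split=> w /=.
    move=> [[h1 h2] h3]; congr (_, _); first congr (_, _).
    - by apply/ffunP => i; rewrite ffunE h1.
    - by apply/ffunP => i; rewrite ffunE h2.
    - apply/ffunP => i; rewrite ffunE; have [h4 h5] := h3 i.
      by apply/ffunP => -[t|j]; rewrite ffunE ?h4 ?h5.
  move=> [<- <- <-]; split; first by split=> i /=; rewrite ffunE.
  by move=> i; split=> t; rewrite !ffunE.
move=> ->; congr (_ * _); apply: eq_bigr => i _; rewrite /cond_code.
congr (prob P _ / _); rewrite /rect_ev; apply/seteqP; split=> w /=.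
  move=> [h1 [/finset.set1P -> h3]]; congr (_, _).
  by apply/ffunP => -[t|j]; rewrite ffunE ?h1 ?h3.
move=> [<- <-]; split; first by move=> t; rewrite ffunE.
by split; [exact/finset.set1P|move=> j; rewrite ffunE].
Qed.

Definition psi (l : 'I_k -> zT -> ('I_k + 'I_p -> R) -> R) t z : complex R :=
  Complex
    (condE_Z P (Z 0%N) (fun w => cos (l t z (unit_coord 0 ^~ w))) z)
    (condE_Z P (Z 0%N) (fun w => sin (l t z (unit_coord 0 ^~ w))) z).

Definition decodes m (f : {ffun 'I_k + 'I_p -> 'I_(gridN m).+1}) c : R :=
  decode (f c).

Definition psi_code m (l : 'I_k -> zT -> ('I_k + 'I_p -> R) -> R) t z
    : complex R :=
  Complex
    (condE_Z P (Z 0%N) (fun w => cos (l t z (decodes (codes m 0 w)))) z)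
    (condE_Z P (Z 0%N) (fun w => sin (l t z (decodes (codes m 0 w)))) z).

Lemma condE_Z_codes m (h : {ffun 'I_k + 'I_p -> 'I_(gridN m).+1} -> R) z :
  condE_Z P (Z 0%N) (fun w => h (codes m 0 w)) z =
  \sum_f h f * cond_code f z.
Proof.
have mW := finite_rv_pair (@finite_rv_codes m 0) (@finite_rv_Z 0).
rewrite /condE_Z (Ex_finite_rv P (fun x => h x.1 * (x.2 == z)%:R) mW).
transitivity ((\sum_f \sum_z' h f * (z' == z)%:R *
    prob P [set w | (codes m 0 w, Z 0%N w) = (f, z')]) / pz z).
  by rewrite pair_bigA/=; congr (_ / _); apply: eq_bigr => -[f z'] _.
rewrite mulr_suml.
apply: eq_bigr => f _; rewrite (bigD1 z)//= big1 ?addr0; last first.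
  by move=> z' /negbTE ->; rewrite mulr0 mul0r.
by rewrite eqxx mulr1 -mulrA.
Qed.

Lemma psi_codeE m l t z : psi_code m l t z =
  \sum_f cexp (l t z (decodes f)) * Complex (cond_code (m := m) f z) 0.
Proof.
apply: complex_ext; rewrite ?Re_sum ?Im_sum /=.
  rewrite (condE_Z_codes (fun f => cos (l t z (decodes f)))).
  by apply: eq_bigr => f _; rewrite /= mulr0 subr0.
rewrite (condE_Z_codes (fun f => sin (l t z (decodes f)))).
by apply: eq_bigr => f _; rewrite /= mulr0 add0r.
Qed.

Lemma CE_factor_codes m n (H : {ffun 'I_n -> 'I_k} -> {ffun 'I_n -> zT} -> complex R) l :
  CE P (fun w => H (Af n w) (Zf n w) *
     \prod_(i < n) cexp (l (A i w) (Z i w) (decodes (codes m i w)))) =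
  CE P (fun w => H (Af n w) (Zf n w) *
     \prod_(i < n) psi_code m l (A i w) (Z i w)).
Proof.
have mW1 := @finite_rv_AZ n.
have mW2 : finite_rv (fun w => [ffun i : 'I_n => codes m i w]).
  by apply: finite_rv_ffun => i; exact: finite_rv_codes.
have mW := finite_rv_pair mW1 mW2.
pose G1 (x : ({ffun 'I_n -> 'I_k} * {ffun 'I_n -> zT}) *
    {ffun 'I_n -> {ffun 'I_k + 'I_p -> 'I_(gridN m).+1}}) :=
  H x.1.1 x.1.2 * \prod_(i < n) cexp (l (x.1.1 i) (x.1.2 i) (decodes (x.2 i))).
pose G2 (x : {ffun 'I_n -> 'I_k} * {ffun 'I_n -> zT}) :=
  H x.1 x.2 * \prod_(i < n) psi_code m l (x.1 i) (x.2 i).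
transitivity (CE P (fun w => G1 ((Af n w, Zf n w), [ffun i : 'I_n => codes m i w]))).
  congr CE; apply/funext => w; rewrite /G1/=; congr (_ * _).
  by apply: eq_bigr => i _; rewrite !ffunE.
transitivity (CE P (fun w => G2 (Af n w, Zf n w))); last first.
  congr CE; apply/funext => w; rewrite /G2/=; congr (_ * _).
  by apply: eq_bigr => i _; rewrite !ffunE.
rewrite (CE_finite_rv P G1 mW) (CE_finite_rv P G2 mW1).
transitivity (\sum_y \sum_g G1 (y, g) * Complex (prob P
  [set w | (Af n w, Zf n w, [ffun i : 'I_n => codes m i w]) = (y, g)]) 0).
  by rewrite pair_bigA/=; apply: eq_bigr => -[y g] _.
apply: eq_bigr => -[a zs] _; rewrite /G1 /G2/=.
under eq_bigr do rewrite prob_AZ_codes.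
under [in RHS]eq_bigr do rewrite psi_codeE.
rewrite bigA_distr_bigA/= mulrAC mulr_sumr; apply: eq_bigr => g _.
rewrite Complex_realM Complex_real_prod [in RHS]big_split/=.
by rewrite -!mulrA; congr (_ * _); rewrite mulrCA.
Qed.

Lemma measurable_coord_fun (l : ('I_k + 'I_p -> R) -> R) i :
  (forall (v : nat -> 'I_k + 'I_p -> R) v', (forall c, v n c @[n --> \oo] --> v' c) ->
     l (v n) @[n --> \oo] --> l v') ->
  measurable_fun setT (fun w => l (unit_coord i ^~ w)).
Proof.
move=> cl; apply: (@measurable_fun_cvg _ _ _ setT
    (fun m w => l (decodes (codes m i w)))).
  by move=> m; apply: (measurable_finite_rv (fun f => l (decodes f)));
    exact: finite_rv_codes.
move=> w _; apply: cl => c; under eq_fun do rewrite /decodes ffunE.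
exact: cvg_decode.
Qed.

Lemma CE_factor n (H : {ffun 'I_n -> 'I_k} -> {ffun 'I_n -> zT} -> complex R)
    (l : 'I_k -> zT -> ('I_k + 'I_p -> R) -> R) :
  (forall t z (v : nat -> 'I_k + 'I_p -> R) v',
     (forall c, v n c @[n --> \oo] --> v' c) ->
     l t z (v n) @[n --> \oo] --> l t z v') ->
  CE P (fun w => H (Af n w) (Zf n w) *
     \prod_(i < n) cexp (l (A i w) (Z i w) (unit_coord i ^~ w))) =
  CE P (fun w => H (Af n w) (Zf n w) *
     \prod_(i < n) psi l (A i w) (Z i w)).
Proof.
move=> cl.
pose M := \sum_x Normc.normc (H x.1 x.2).
have HM w : Normc.normc (H (Af n w) (Zf n w)) <= M.
  rewrite /M (bigD1 (Af n w, Zf n w))//= lerDl sumr_ge0// => x _.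
  exact: normc_ge0.
have mH : cmeasurable (fun w => H (Af n w) (Zf n w)).
  exact: (cmeasurable_finite_rv (fun x => H x.1 x.2) (@finite_rv_AZ n)).
have cdec i w c : decodes (codes m i w) c @[m --> \oo] --> unit_coord i c w.
  by under eq_fun do rewrite /decodes ffunE; exact: cvg_decode.
apply: (@ccvg_unique _ (fun m => CE P (fun w => H (Af n w) (Zf n w) *
     \prod_(i < n) cexp (l (A i w) (Z i w) (decodes (codes m i w)))))).
  apply: (@ccvg_CE _ _ _ _ _ _ M).
  - move=> m.
    have mW2 : finite_rv (fun w => [ffun i : 'I_n => codes m i w]).
      by apply: finite_rv_ffun => i; exact: finite_rv_codes.
    have mW := finite_rv_pair (@finite_rv_AZ n) mW2.
    have := cmeasurable_finite_rv (R := R) (fun x :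
      ({ffun 'I_n -> 'I_k} * {ffun 'I_n -> zT}) *
      {ffun 'I_n -> {ffun 'I_k + 'I_p -> 'I_(gridN m).+1}} => H x.1.1 x.1.2 *
      \prod_(i < n) cexp (l (x.1.1 i) (x.1.2 i) (decodes (x.2 i)))) mW.
    congr cmeasurable; apply/funext => w /=; congr (_ * _).
    by apply: eq_bigr => i _; rewrite !ffunE.
  - move=> w; apply: ccvgM; first exact: ccvg_cst.
    by apply: ccvg_prod => i; apply: ccvg_cexp; apply: cl => c; exact: cdec.
  - move=> m w; rewrite Normc.normcM -[M]mulr1 ler_pM ?normc_ge0//.
    by apply: normc_prod_le1 => i; rewrite normc_cexp.
under eq_fun do rewrite CE_factor_codes.
have psic t z : ccvg (fun m => psi_code m l t z) (psi l t z).
  have mz : measurable_fun setT (fun w => (Z 0%N w == z)%:R : R).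
    exact: (measurable_finite_rv (fun z' => (z' == z)%:R) (@finite_rv_Z 0)).
  split=> /=; apply: cvgM => //; try exact: cvg_cst.
    apply: (@cvg_Ex _ _ _ P _ _ (fun=> 1)).
    - move=> m; apply: measurable_funM => //; apply: measurable_cos_comp.
      by apply: (measurable_finite_rv (fun f => l t z (decodes f)));
        exact: finite_rv_codes.
    - move=> w; apply: cvgM; last exact: cvg_cst.
      have cw : l t z (decodes (codes m 0 w)) @[m --> \oo] -->
          l t z (unit_coord 0 ^~ w) by apply: cl => c; exact: cdec.
      exact: (cvg_comp _ _ cw (@continuous_cos R _)).
    - exact: integrable_cst.
    - move=> m w; rewrite normrM mulr_ile1// ?cos_max//.
      by case: (_ == _); rewrite ?normr1 ?normr0.
  apply: (@cvg_Ex _ _ _ P _ _ (fun=> 1)).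
  - move=> m; apply: measurable_funM => //; apply: measurable_sin_comp.
    by apply: (measurable_finite_rv (fun f => l t z (decodes f)));
      exact: finite_rv_codes.
  - move=> w; apply: cvgM; last exact: cvg_cst.
    have cw : l t z (decodes (codes m 0 w)) @[m --> \oo] -->
        l t z (unit_coord 0 ^~ w) by apply: cl => c; exact: cdec.
    exact: (cvg_comp _ _ cw (@continuous_sin R _)).
  - exact: integrable_cst.
  - move=> m w; rewrite normrM mulr_ile1// ?sin_max//.
    by case: (_ == _); rewrite ?normr1 ?normr0.
pose G (f : 'I_k -> zT -> complex R) (x : {ffun 'I_n -> 'I_k} * {ffun 'I_n -> zT}) :=
  H x.1 x.2 * \prod_(i < n) f (x.1 i) (x.2 i).
have GE f : CE P (fun w => H (Af n w) (Zf n w) * \prod_(i < n) f (A i w) (Z i w)) =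
    \sum_x G f x * Complex (prob P [set w | (Af n w, Zf n w) = x]) 0.
  rewrite -(CE_finite_rv P (G f) (@finite_rv_AZ n)).
  congr CE; apply/funext => w; rewrite /G/=; congr (_ * _).
  by apply: eq_bigr => i _; rewrite !ffunE.
under eq_fun do rewrite GE.
rewrite GE; apply: ccvg_sum => x; apply: ccvgM; last exact: ccvg_cst.
apply: ccvgM; first exact: ccvg_cst.
by apply: ccvg_prod => i; exact: psic.
Qed.

End Independence.

(** * The conditional central limit theorem *)

Section SmallCharacteristicFunction.
Context {R : realType} {d : measure_display} {T : measurableType d}.
Variable P : probability T R.

Lemma expRN_taylor (y : R) : 0 <= y -> `|expR (- y) - 1 + y| <= y ^+ 2.
Proof.
move=> y0; have h1 := expR_ge1Dx (- y).
have h2 : expR (- y) <= 1 - y + y ^+ 2.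
  rewrite expRN -[leLHS]mul1r ler_pdivrMr ?expR_gt0//.
  have h3 := expR_ge1Dx y.
  apply: (@le_trans _ _ ((1 - y + y ^+ 2) * (1 + y))).
    by have := exprn_ge0 3 y0; lra.
  by rewrite ler_wpM2l//; have := sqr_ge0 (y - 1); have := sqr_ge0 y; lra.
by rewrite ger0_norm; lra.
Qed.

Lemma normr_expRN_sub (x y : R) : 0 <= x -> 0 <= y ->
  `|expR (- x) - expR (- y)| <= `|x - y|.
Proof.
wlog xy : x y / x <= y.
  move=> H x0 y0; have [xy|/ltW yx] := leP x y; first exact: H.
  by rewrite distrC [leRHS]distrC H.
move=> x0 y0; rewrite ger0_norm ?subr_ge0 ?ler_expR ?lerN2// distrC.
rewrite ger0_norm ?subr_ge0//.
have -> : expR (- x) - expR (- y) = expR (- x) * (1 - expR (- (y - x))).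
  by rewrite mulrBr mulr1 -expRD; congr (_ - expR _); ring.
have h : 1 - expR (- (y - x)) <= y - x by have := expR_ge1Dx (- (y - x)); lra.
apply: le_trans h; apply: ler_piMl.
  by rewrite subr_ge0 -[leRHS]expR0 ler_expR oppr_le0 subr_ge0.
by rewrite -[leRHS]expR0 ler_expR oppr_le0.
Qed.

Lemma integrable_boundedM (f g : T -> R) (M : R) : measurable_fun setT g ->
  (forall w, `|g w| <= M) -> P.-integrable setT (EFin \o f) ->
  P.-integrable setT (EFin \o (fun w => f w * g w)).
Proof.
move=> mg gM fi; apply: (@le_integrable_real _ _ _ _ _ (fun w => M * `|f w|)).
- by apply: measurable_funM => //; exact: integrable_measurable fi.
- by move=> w; rewrite normrM mulrC ler_wpM2r.
- exact/integrable_scale/integrable_normr.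
Qed.

Lemma integrable_of_sqr (f : T -> R) : measurable_fun setT f ->
  P.-integrable setT (EFin \o (fun w => f w ^+ 2)) ->
  P.-integrable setT (EFin \o f).
Proof.
move=> mf fi; apply: (@le_integrable_real _ _ _ _ _ (fun w => 1 + f w ^+ 2)) => //.
  move=> w; rewrite -[f w ^+ 2]real_normK ?num_real//.
  by have := sqr_ge0 (`|f w| - 1); have := normr_ge0 (f w); nra.
by apply: integrable_addr => //; exact: integrable_cst.
Qed.

Lemma cvg_inv_sqrt : (Num.sqrt n%:R)^-1 @[n --> \oo] --> (0 : R).
Proof.
rewrite -(cvg_shiftS (fun n => (Num.sqrt n%:R)^-1 : R)) /=.
under eq_fun do rewrite -sqrtrV//.
have := cvg_comp _ (@Num.sqrt R) (@cvg_harmonic R) (@sqrt_continuous R 0).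
by rewrite sqrtr0.
Qed.

Variables (rho xi : T -> R) (M : R).
Hypotheses (mrho : measurable_fun setT rho) (rho0 : forall w, 0 <= rho w <= M)
  (rho1 : Ex P rho = 1) (mxi : measurable_fun setT xi)
  (ixi : P.-integrable setT (EFin \o (fun w => xi w ^+ 2))).

Let rhoM w : `|rho w| <= M.
Proof. by have /andP[h1 h2] := rho0 w; rewrite ger0_norm. Qed.

Let irho : P.-integrable setT (EFin \o rho).
Proof. exact: bounded_integrable rhoM. Qed.

Definition wchar (x : T -> R) : complex R :=
  Complex (Ex P (fun w => cos (x w) * rho w)) (Ex P (fun w => sin (x w) * rho w)).

Lemma normc_wchar_le1 (x : T -> R) : measurable_fun setT x ->
  Normc.normc (wchar x) <= 1.
Proof.
move=> mx; rewrite /wchar /=.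
set a := Ex P _; set b := Ex P _; set r := Num.sqrt _.
have r2 : r ^+ 2 = a ^+ 2 + b ^+ 2 by rewrite sqr_sqrtr// addr_ge0// sqr_ge0.
have r0 : 0 <= r by exact: sqrtr_ge0.
have ic : P.-integrable setT (EFin \o (fun w => cos (x w) * rho w)).
  apply: (@integrable_boundedM _ _ M) => //.
  apply: (@bounded_integrable _ _ _ _ _ 1); last by move=> w; exact: cos_max.
  exact: measurable_cos_comp.
have is_ : P.-integrable setT (EFin \o (fun w => sin (x w) * rho w)).
  apply: (@integrable_boundedM _ _ M) => //.
  apply: (@bounded_integrable _ _ _ _ _ 1); last by move=> w; exact: sin_max.
  exact: measurable_sin_comp.
have rE : r = Ex P (fun w => r * rho w) by rewrite ExZ// rho1 mulr1.
have abE : a ^+ 2 + b ^+ 2 =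
    Ex P (fun w => a * (cos (x w) * rho w) + b * (sin (x w) * rho w)).
  by rewrite ExD ?ExZ//; exact: integrable_scale.
have : r ^+ 2 <= r.
  rewrite r2 abE [leRHS]rE; apply: Ex_le.
  - by apply: integrable_addr; exact: integrable_scale.
  - exact: integrable_scale.
  move=> w; rewrite mulrA [b * _]mulrA -mulrDl ler_wpM2r//.
    by have /andP[] := rho0 w.
  apply: le_trans (ler_norm _) _.
  rewrite -ler_sqr ?nnegrE// real_normK ?num_real// r2.
  have cs := cos2Dsin2 (x w).
  have -> : a ^+ 2 + b ^+ 2 = (a ^+ 2 + b ^+ 2) * (cos (x w) ^+ 2 + sin (x w) ^+ 2).
    by rewrite cs mulr1.
  by have := sqr_ge0 (a * sin (x w) - b * cos (x w)); lra.
rewrite expr2; have [->//|rn0] := eqVneq r 0.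
by rewrite -{3}[r]mulr1 ler_pM2l// lt_neqAle eq_sym rn0.
Qed.

Hypothesis xi0 : Ex P (fun w => xi w * rho w) = 0.
Local Notation s2 := (Ex P (fun w => xi w ^+ 2 * rho w)).

Let is2 : P.-integrable setT (EFin \o (fun w => xi w ^+ 2 * rho w)).
Proof. exact: (@integrable_boundedM _ _ M). Qed.

Lemma s2_ge0 : 0 <= s2.
Proof.
by apply: Ex_ge0 => w; rewrite mulr_ge0 ?sqr_ge0//; have /andP[] := rho0 w.
Qed.

Let small (h : R -> R) : measurable_fun setT h ->
  (forall x, `|h x| <= `|x| ^+ 3 /\ `|h x| <= x ^+ 2) ->
  Ex P (fun w => n%:R * h (xi w / Num.sqrt n%:R) * rho w) @[n --> \oo] --> (0 : R).
Proof.
move=> mh hh; rewrite -[X in _ --> X](Ex_cst P 0).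
apply: (@cvg_Ex _ _ _ P _ _ (fun w => xi w ^+ 2 * rho w)).
- move=> n; apply: measurable_funM => //; apply: measurable_scale.
  by apply: (measurableT_comp mh); exact: measurable_funM.
- move=> w; rewrite -[X in _ --> X](mul0r (rho w)).
  apply: cvgM; last exact: cvg_cst.
  apply: norm_cvg0.
  apply: (@squeeze_cvgr _ _ _ _ (cst 0)
    (fun n => `|xi w| ^+ 3 * (Num.sqrt n%:R)^-1)).
  + exists 1%N => // n /= n0; rewrite normr_ge0 normrM.
    have s0 : 0 < Num.sqrt n%:R :> R by rewrite sqrtr_gt0 ltr0n.
    have [h1 _] := hh (xi w / Num.sqrt n%:R).
    rewrite [`|n%:R|]ger0_norm//.
    apply: le_trans (ler_wpM2l (ler0n _ _) h1) _.
    rewrite normrM normfV (ger0_norm (ltW s0)).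
    rewrite -[X in X * _](sqr_sqrtr (ler0n R n)).
    have -> : Num.sqrt n%:R ^+ 2 * (`|xi w| / Num.sqrt n%:R) ^+ 3 =
        `|xi w| ^+ 3 / Num.sqrt n%:R by field; rewrite gt_eqF.
    by [].
  + exact: cvg_cst.
  + rewrite -[X in _ --> X](mulr0 (`|xi w| ^+ 3)); apply: cvgM; first exact: cvg_cst.
    exact: cvg_inv_sqrt.
- exact: is2.
- move=> n w; have /andP[r0 _] := rho0 w.
  rewrite normrM [`|rho w|]ger0_norm// ler_wpM2r// normrM [`|n%:R|]ger0_norm//.
  have [_ h1] := hh (xi w / Num.sqrt n%:R).
  apply: le_trans (ler_wpM2l (ler0n _ _) h1) _.
  rewrite exprMn exprVn sqr_sqrtr// mulrCA.
  have [->|n0] := eqVneq n 0%N; first by rewrite mul0r mulr0 sqr_ge0.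
  by rewrite mulfV ?mulr1// pnatr_eq0.
Qed.

Lemma wchar_small :
  n%:R * Normc.normc (wchar (fun w => xi w / Num.sqrt n%:R)
     - Complex (expR (- (s2 / (2 * n%:R)))) 0) @[n --> \oo] --> (0 : R).
Proof.
have mcos : measurable_fun setT (fun x : R => cos x - 1 + x ^+ 2 / 2).
  apply: measurable_funD.
    by apply: measurable_funB => //; exact: measurable_cos_comp.
  by apply: measurable_funM => //; exact: measurable_funX.
have msin : measurable_fun setT (fun x : R => sin x - x).
  by apply: measurable_funB => //; exact: measurable_sin_comp.
have hcos (x : R) : `|cos x - 1 + x ^+ 2 / 2| <= `|x| ^+ 3 /\
    `|cos x - 1 + x ^+ 2 / 2| <= x ^+ 2.
  have [h1 h2] := cos_taylor x; split=> //.
  have [x1|x1] := leP `|x| 1.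
    apply: le_trans h1 _; rewrite -[x ^+ 4]ger0_norm ?exprn_even_ge0// normrX.
    by rewrite exprSr ler_piMr// exprn_ge0.
  apply: le_trans h2 _; rewrite -[x ^+ 2]real_normK ?num_real//.
  by rewrite [leRHS]exprSr ler_peMr ?exprn_ge0// ltW.
have c1 := small mcos hcos; have c2 := small msin (@sin_taylor R).
pose a n := Ex P (fun w => n%:R * (cos (xi w / Num.sqrt n%:R) - 1
  + (xi w / Num.sqrt n%:R) ^+ 2 / 2) * rho w).
pose b n := Ex P (fun w =>
  n%:R * (sin (xi w / Num.sqrt n%:R) - xi w / Num.sqrt n%:R) * rho w).
pose c (n : nat) : R := (s2 / 2) ^+ 2 / n%:R.
have cc : c n @[n --> \oo] --> (0 : R).
  rewrite -[X in _ --> X](mulr0 ((s2 / 2) ^+ 2)); apply: cvgM; first exact: cvg_cst.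
  rewrite -(cvg_shiftS (fun n => n%:R^-1 : R)); exact: cvg_harmonic.
apply: (@squeeze_cvgr _ _ _ _ (cst 0) (fun n => `|a n| + c n + `|b n|)).
- exists 1%N => // n n0.
  have n0' : 0 < n%:R :> R by rewrite ltr0n.
  apply/andP; split; first by rewrite mulr_ge0// normc_ge0.
  apply: le_trans (ler_wpM2l (ler0n _ _) (normc_le_ReIm _)) _.
  have s0 : 0 < Num.sqrt n%:R :> R by rewrite sqrtr_gt0.
  have mx : measurable_fun setT (fun w => xi w / Num.sqrt n%:R).
    exact: measurable_funM.
  have ic : P.-integrable setT (EFin \o (fun w => cos (xi w / Num.sqrt n%:R) * rho w)).
    apply: (@integrable_boundedM _ _ M) => //.
    apply: (@bounded_integrable _ _ _ _ _ 1); last by move=> w; exact: cos_max.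
    exact: measurable_cos_comp.
  have is_ : P.-integrable setT (EFin \o (fun w => sin (xi w / Num.sqrt n%:R) * rho w)).
    apply: (@integrable_boundedM _ _ M) => //.
    apply: (@bounded_integrable _ _ _ _ _ 1); last by move=> w; exact: sin_max.
    exact: measurable_sin_comp.
  have ix : P.-integrable setT (EFin \o (fun w => xi w * rho w)).
    by apply: (@integrable_boundedM _ _ M) => //; exact: integrable_of_sqr.
  have aE : a n = n%:R * (Ex P (fun w => cos (xi w / Num.sqrt n%:R) * rho w) - 1)
      + s2 / 2.
    rewrite /a (_ : (fun w => _) = fun w =>
      n%:R * (cos (xi w / Num.sqrt n%:R) * rho w - rho w)
      + 2^-1 * (xi w ^+ 2 * rho w)).
      rewrite ExD; [|exact/integrable_scale/integrable_subr|exact: integrable_scale].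
      rewrite !ExZ// ?ExB ?rho1//; first by rewrite [_ / 2]mulrC.
      exact: integrable_subr.
    apply/funext => w; rewrite exprMn exprVn sqr_sqrtr//; field.
    by rewrite gt_eqF.
  have bE : b n = n%:R * Ex P (fun w => sin (xi w / Num.sqrt n%:R) * rho w).
    rewrite /b (_ : (fun w => _) = fun w =>
      n%:R * (sin (xi w / Num.sqrt n%:R) * rho w)
      - n%:R / Num.sqrt n%:R * (xi w * rho w)).
      rewrite ExB; [|exact: integrable_scale..].
      by rewrite !ExZ// xi0 mulr0 subr0.
    by apply/funext => w; field; rewrite gt_eqF.
  have nn (x : R) : n%:R * `|x| = `|n%:R * x| by rewrite normrM ger0_norm.
  rewrite mulrDr !nn.
  rewrite /= subr0 -bE lerD2r.
  have eb := @expRN_taylor (s2 / (2 * n%:R)).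
  have y0 : 0 <= s2 / (2 * n%:R) by rewrite divr_ge0 ?s2_ge0// mulr_ge0.
  have cE : n%:R * (s2 / (2 * n%:R)) ^+ 2 = c n.
    by rewrite /c; field; rewrite gt_eqF.
  have -> : n%:R * (Ex P (fun w => cos (xi w / Num.sqrt n%:R) * rho w)
      - expR (- (s2 / (2 * n%:R)))) =
      a n - n%:R * (expR (- (s2 / (2 * n%:R))) - 1 + s2 / (2 * n%:R)).
    by rewrite aE; field; rewrite gt_eqF.
  apply: le_trans (ler_normB _ _) _; rewrite lerD2l normrM ger0_norm// -cE.
  by rewrite ler_wpM2l// eb.
- exact: cvg_cst.
- rewrite -[X in _ --> X]addr0 -[X in _ --> X + _]addr0.
  apply: cvgD; first apply: cvgD => //.
    by rewrite -(normr0 R); exact: cvg_norm c1.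
  by rewrite -(normr0 R); exact: cvg_norm c2.
Qed.

End SmallCharacteristicFunction.

Lemma negl_Ex_cvg0 {R : realType} {d : measure_display} {T : measurableType d}
    (P : probability T R) (u : nat -> T -> R) (M : R) :
  (forall n, measurable_fun setT (u n)) -> (forall n w, `|u n w| <= M) ->
  negligible_in_prob P u -> Ex P (fun w => `|u n w|) @[n --> \oo] --> (0 : R).
Proof.
move=> mu uM nu.
have M0 : 0 <= `|M| + 1 by rewrite addr_ge0.
apply/cvgr0Pnorm_le => e e0.
have e' : 0 < Num.min (e / 2) (e / (4 * (`|M| + 1))).
  by rewrite lt_min !divr_gt0// mulr_gt0// ltr_wpDl.
apply: filterS (nu _ e') => n [E [mE pE bE]].
have mun : measurable_fun setT (fun w => `|u n w|) by exact: measurableT_comp.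
have M'0 : 0 < `|M| + 1 by rewrite ltr_wpDl.
have b2 w : `|u n w| <= `|M| + 1.
  by rewrite (le_trans (uM n w))// (le_trans (ler_norm _))// lerDl.
have := @Ex_close _ _ _ P (fun w => `|u n w|) (fun=> 0) E (`|M| + 1)
  (Num.min (e / 2) (e / (4 * (`|M| + 1)))) mun (measurable_cst _) mE.
rewrite Ex_cst subr0 => h; apply: le_trans (h _ _ (ltW e') _) _.
- by move=> w; rewrite normr_id.
- by move=> w; rewrite normr0.
- by move=> w Ew; rewrite subr0 normr_id; exact: bE.
rewrite [leRHS]splitr lerD//; first by rewrite ge_min lexx.
apply: (@le_trans _ _ (2 * (`|M| + 1) * (e / (4 * (`|M| + 1))))).
  rewrite ler_wpM2l ?mulr_ge0// (le_trans pE)// ge_min lexx.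
  by rewrite orbT.
have -> : 2 * (`|M| + 1) * (e / (4 * (`|M| + 1))) = e / 2.
  by field; rewrite gt_eqF.
by [].
Qed.

Section ZStatistics.
Context {R : realType} {d : measure_display} {T : measurableType d}.
Variables (P : probability T R) (k p : nat) (zT : finType).
Variables (Y : nat -> 'I_k -> T -> R) (Z : nat -> T -> zT)
          (X : nat -> 'I_p -> T -> R) (A : nat -> T -> 'I_k) (pi : 'I_k -> R).
Hypotheses (hC1 : C1 P Y Z X) (hC2 : C2 P Y Z X A pi).
Hypothesis pzpos : forall z, 0 < pz P Z z.
Local Notation pz := (pz P Z).

Lemma prob_Zf n (zs : {ffun 'I_n -> zT}) :
  prob P [set w | Zf Z n w = zs] = \prod_i pz (zs i).
Proof.
have := @prob_rect _ _ _ _ _ _ _ _ _ _ hC1 n (fun _ _ => setT) zs (fun _ _ => setT).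
under [X in _ -> _ -> _ = X]eq_bigr do rewrite rect_set1T.
move=> <-//; congr prob; apply/seteqP; split=> w /= h.
  by move=> i; split=> //; split=> //; rewrite -h ffunE.
by apply/ffunP => i; rewrite ffunE; have [_ []] := h i.
Qed.

Lemma finite_rv_Zf n : finite_rv (Zf Z n).
Proof. by apply: finite_rv_ffun => i; exact: (finite_rv_Z hC1). Qed.

Lemma Ex_Z0 (g : zT -> R) : Ex P (fun w => g (Z 0%N w)) = \sum_z g z * pz z.
Proof. exact: (Ex_finite_rv P g (@finite_rv_Z _ _ _ _ _ _ _ _ _ _ hC1 0)). Qed.

Lemma CE_Z_iid n (g : zT -> complex R) :
  CE P (fun w => \prod_(i < n) g (Z i w)) = (CE P (fun w => g (Z 0%N w))) ^+ n.
Proof.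
rewrite (CE_finite_rv P g (@finite_rv_Z _ _ _ _ _ _ _ _ _ _ hC1 0)).
transitivity (CE P (fun w => \prod_(i < n) g (Zf Z n w i))).
  by congr CE; apply/funext => w; apply: eq_bigr => i _; rewrite ffunE.
rewrite (CE_finite_rv P (fun zs : {ffun 'I_n -> zT} => \prod_(i < n) g (zs i))
  (@finite_rv_Zf n)).
rewrite -[in RHS](card_ord n) -prodr_const bigA_distr_bigA/=.
apply: eq_bigr => zs _; rewrite prob_Zf Complex_real_prod -big_split/=.
by apply: eq_bigr.
Qed.

Lemma Z_clt (g : zT -> R) : Ex P (fun w => g (Z 0%N w)) = 0 ->
  ccvg (fun n => CE P (fun w =>
      cexp ((Num.sqrt n%:R)^-1 * \sum_(i < n) g (Z i w))))
    (Complex (expR (- (Ex P (fun w => g (Z 0%N w) ^+ 2) / 2))) 0).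
Proof.
move=> g0; set tau := Ex P _.
have fz := @finite_rv_Z _ _ _ _ _ _ _ _ _ _ hC1 0.
have mg : measurable_fun setT (fun w => g (Z 0%N w)).
  exact: measurable_finite_rv.
have ig : P.-integrable setT (EFin \o (fun w => g (Z 0%N w) ^+ 2)).
  exact: (integrable_finite_rv P (fun z => g z ^+ 2) fz).
have m1 : measurable_fun setT (fun _ : T => 1 : R) by exact: measurable_cst.
have r0 : T -> (0 : R) <= (1 : R) <= (1 : R) by rewrite ler01 lexx.
have r1 := Ex_cst P 1.
have xi0 : Ex P (fun w => g (Z 0%N w) * 1) = 0.
  by under eq_fun do rewrite mulr1.
have tauE : Ex P (fun w => g (Z 0%N w) ^+ 2 * 1) = tau.
  by under eq_fun do rewrite mulr1.
have sm := wchar_small m1 r0 r1 mg ig xi0; rewrite tauE in sm.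
pose ph n := CE P (fun w => cexp (g (Z 0%N w) / Num.sqrt n%:R)).
have phE n : ph n = wchar P (fun=> 1) (fun w => g (Z 0%N w) / Num.sqrt n%:R).
  by rewrite /ph /CE /wchar /=; congr Complex; congr Ex; apply/funext => w;
    rewrite mulr1.
have E n : CE P (fun w => cexp ((Num.sqrt n%:R)^-1 * \sum_(i < n) g (Z i w))) =
    (ph n) ^+ n.
  rewrite -(CE_Z_iid n (fun z => cexp (g z / Num.sqrt n%:R))).
  congr CE; apply/funext => w; rewrite mulr_sumr cexp_sum.
  by apply: eq_bigr => i _; rewrite mulrC.
apply: (ccvg_sub0 (ccvg_cst _)).
apply: (@squeeze_cvgr _ _ _ _ (cst 0) _ _ _ _ _ sm); last exact: cvg_cst.
exists 1%N => // n n0; rewrite normc_ge0 andTb E.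
have n0' : 0 < n%:R :> R by rewrite ltr0n.
have -> : Complex (expR (- (tau / 2))) 0 =
    \prod_(i < n) Complex (expR (- (tau / (2 * n%:R)))) 0 :> complex R.
  rewrite prodr_const card_ord -(card_ord n) -prodr_const -Complex_real_prod.
  rewrite prodr_const card_ord -expRM_natl; congr (Complex (expR _) 0).
  by rewrite -mulr_natl; field; rewrite gt_eqF.
rewrite -[X in _ ^+ X](card_ord n) -prodr_const.
have tau0 : 0 <= tau by apply: Ex_ge0 => w; exact: sqr_ge0.
apply: normc_prod_sub => i.
- rewrite phE; apply: (normc_wchar_le1 m1 r0 r1).
  exact: measurable_funM.
- rewrite normc_real ger0_norm ?expR_ge0// -[leRHS]expR0 ler_expR oppr_le0.
  by rewrite divr_ge0// mulr_ge0.
- by rewrite phE.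
Qed.

Lemma negl_near_eq (u v : nat -> T -> R) :
  (\forall n \near \oo, forall w, u n w = v n w) ->
  negligible_in_prob P v -> negligible_in_prob P u.
Proof.
move=> uv nv e e0; apply: filterS2 uv (nv e e0) => n uvn [E [mE pE bE]].
by exists E; split=> // w Ew; rewrite uvn; exact: bE.
Qed.

Lemma Z_clt_tight (g : zT -> R) : Ex P (fun w => g (Z 0%N w)) = 0 ->
  tight P (fun n w => (Num.sqrt n%:R)^-1 * \sum_(i < n) g (Z i w)).
Proof.
move=> g0; have fz := @finite_rv_Z _ _ _ _ _ _ _ _ _ _ hC1.
apply: (@tight_of_charfun _ _ _ _ _ (Ex P (fun w => g (Z 0%N w) ^+ 2))).
- by apply: Ex_ge0 => w; exact: sqr_ge0.
- move=> n; apply: measurable_scale; apply: measurable_sumr => i _.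
  exact: measurable_finite_rv.
move=> v; have vg0 : Ex P (fun w => v * g (Z 0%N w)) = 0.
  by rewrite ExZ ?g0 ?mulr0//; exact: integrable_finite_rv.
have [/= cv _] := @Z_clt (fun z => v * g z) vg0.
rewrite (_ : Ex P (fun w => (v * g (Z 0%N w)) ^+ 2) =
    Ex P (fun w => g (Z 0%N w) ^+ 2) * v ^+ 2) in cv; last first.
  under eq_fun do rewrite exprMn.
  by rewrite ExZ 1?mulrC//; exact: (integrable_finite_rv P (fun z => g z ^+ 2)).
rewrite (_ : (fun n => Ex P (fun w => cos (v * _))) = fun n => Ex P (fun w =>
    cos ((Num.sqrt n%:R)^-1 * \sum_(i < n) v * g (Z i w))))//.
apply/funext => n; congr Ex; apply/funext => w; congr cos.
by rewrite mulrCA mulr_sumr.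
Qed.

Lemma sum_pz : \sum_z pz z = 1.
Proof.
have := Ex_Z0 (fun=> 1); rewrite Ex_cst => ->.
by apply: eq_bigr => z _; rewrite mul1r.
Qed.

Lemma nZ_lln z : negligible_in_prob P (fun n w => (nZ Z n z w)%:R / n%:R - pz z).
Proof.
pose g z' : R := (z' == z)%:R - pz z.
have g0 : Ex P (fun w => g (Z 0%N w)) = 0.
  rewrite Ex_Z0; under eq_bigr do rewrite mulrBl.
  rewrite sumrB -mulr_sumr sum_pz mulr1 (bigD1 z)//= eqxx mul1r big1 ?addr0 ?subrr//.
  by move=> z' /negbTE ->; rewrite mul0r.
have := negl_mul_tight (negl_det P (@cvg_inv_sqrt R)) (Z_clt_tight g0).
apply: negl_near_eq; exists 1%N => // n /= n0 w.
have n0' : 0 < n%:R :> R by rewrite ltr0n.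
rewrite mulrA -expr2 exprVn sqr_sqrtr// /g sumrB sumr_const card_ord -natr_sum.
by rewrite -nZE -mulr_natr; field; rewrite gt_eqF.
Qed.

Lemma nZ_le n z w : (nZ Z n z w <= n)%N.
Proof.
rewrite nZE -[leqRHS](card_ord n) -sum1_card; apply: leq_sum => i _.
by case: (_ == _).
Qed.

Lemma ntZ_le n t z w : (ntZ Z A n t z w <= nZ Z n z w)%N.
Proof.
by rewrite nZE ntZE; apply: leq_sum => i _; case: (_ == _) => //; case: (_ == _).
Qed.

Definition nZf n z (zs : {ffun 'I_n -> zT}) : nat := (\sum_i (zs i == z))%N.
Definition ntZf n t z (a : {ffun 'I_n -> 'I_k}) (zs : {ffun 'I_n -> zT}) : nat :=
  (\sum_i ((zs i == z) && (a i == t)))%N.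

Lemma nZfE n z w : nZ Z n z w = nZf z (Zf Z n w).
Proof. by rewrite nZE; apply: eq_bigr => i _; rewrite ffunE. Qed.

Lemma ntZfE n t z w : ntZ Z A n t z w = ntZf t z (Af A n w) (Zf Z n w).
Proof. by rewrite ntZE; apply: eq_bigr => i _; rewrite !ffunE. Qed.

Lemma measurable_AZ n (h : {ffun 'I_n -> 'I_k} -> {ffun 'I_n -> zT} -> R) :
  measurable_fun setT (fun w => h (Af A n w) (Zf Z n w)).
Proof.
exact: (measurable_finite_rv (fun x => h x.1 x.2)
  (@finite_rv_AZ _ _ _ _ _ _ _ _ _ _ _ _ hC1 hC2 n)).
Qed.

Lemma ntZ_lln t z :
  negligible_in_prob P (fun n w => (ntZ Z A n t z w)%:R / n%:R - pi t * pz z).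
Proof.
have [_ [_ cv]] := hC2.
have h1 : negligible_in_prob P
    (fun n w => (ntZ Z A n t z w)%:R / (nZ Z n z w)%:R - pi t).
  apply: negl_of_ae_cvg; last exact: cv.
  move=> n; under eq_fun do rewrite ntZfE nZfE.
  exact: (measurable_AZ (fun a zs => (ntZf t z a zs)%:R / (nZf z zs)%:R)).
have b (n : nat) w : `|(nZ Z n z w)%:R / n%:R| <= 1 :> R.
  rewrite ger0_norm ?divr_ge0//; have [->|n0] := posnP n.
    by rewrite invr0 mulr0.
  by rewrite ler_pdivrMr ?ltr0n// mul1r ler_nat nZ_le.
have h2 := negl_mul_tight h1 (tight_bounded P b).
have h3 := negl_mul_tight (nZ_lln z) (@tight_bounded _ _ _ P (fun _ _ => pi t) `|pi t|
  (fun _ _ => lexx _)).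
apply: negl_near_eq (negl_add h2 h3); apply: nearW => n w.
have [e|nz] := eqVneq (nZ Z n z w) 0%N.
  have := ntZ_le n t z w; rewrite e leqn0 => /eqP ->.
  by rewrite !mul0r; ring.
rewrite mulrBl mulrA divfK ?pnatr_eq0//; ring.
Qed.

Lemma nt_lln t : negligible_in_prob P (fun n w => (nt A n t w)%:R / n%:R - pi t).
Proof.
have := @negl_sum _ _ _ P zT xpredT _ (fun z _ => ntZ_lln t z).
apply: negl_near_eq; apply: nearW => n w.
rewrite sumrB -mulr_sumr sum_pz mulr1 -mulr_suml; congr (_ / _ - _).
rewrite -natr_sum ntE; congr _%:R.
under [RHS]eq_bigr do rewrite ntZE.
rewrite exchange_big/=; apply: eq_bigr => i _.
rewrite (bigD1 (Z i w))//= eqxx/= big1 ?addn0// => z.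
by rewrite eq_sym => /negbTE ->.
Qed.

End ZStatistics.

Lemma cvg_sumr {R : realType} {U : Type} {F : set_system U} {FF : Filter F}
    (I : finType) (f : I -> U -> R) (l : I -> R) :
  (forall i, f i x @[x --> F] --> l i) ->
  (\sum_i f i x) @[x --> F] --> \sum_i l i.
Proof.
move=> h; rewrite (_ : (fun x => _) = \sum_i f i).
  elim/big_rec2: _ => [|i y x _ hh]; first exact: cvg_cst.
  by apply: cvgD; [exact: h|exact: hh].
by apply/funext => x; rewrite fct_sumE.
Qed.

Section MasterCLT.
Context {R : realType} {d : measure_display} {T : measurableType d}.
Variables (P : probability T R) (k p : nat) (zT : finType).
Variables (Y : nat -> 'I_k -> T -> R) (Z : nat -> T -> zT)
          (X : nat -> 'I_p -> T -> R) (A : nat -> T -> 'I_k) (pi : 'I_k -> R)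
          (Omg : zT -> 'M[R]_k).
Hypotheses (hC1 : C1 P Y Z X) (hC2 : C2 P Y Z X A pi) (hC3 : C3 P Z A pi Omg).
Hypothesis pzpos : forall z, 0 < pz P Z z.
Hypothesis pi0 : forall t, 0 <= pi t.
Local Notation pz := (pz P Z).
Local Notation fzn i := (@finite_rv_Z _ _ _ _ _ _ _ _ _ _ hC1 i).

Definition rho z (w : T) : R := (Z 0%N w == z)%:R / pz z.

Lemma measurable_rho z : measurable_fun setT (rho z).
Proof. exact: (measurable_finite_rv (fun z' => (z' == z)%:R / pz z) (fzn 0)). Qed.

Lemma rho_bound z w : 0 <= rho z w <= (pz z)^-1.
Proof.
have p0 := ltW (pzpos z); rewrite /rho; case: (_ == _).
  by rewrite mul1r invr_ge0 p0 lexx.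
by rewrite mul0r lexx invr_ge0.
Qed.

Lemma Ex_rho z : Ex P (rho z) = 1.
Proof.
rewrite /rho (Ex_Z0 hC1 (fun z' => (z' == z)%:R / pz z)) (bigD1 z)//= eqxx.
rewrite mul1r mulVf ?gt_eqF// big1 ?addr0// => z' /negbTE ->.
by rewrite !mul0r.
Qed.

Lemma condE_ZE (f : T -> R) z : P.-integrable setT (EFin \o f) ->
  condE_Z P (Z 0%N) f z = Ex P (fun w => f w * rho z w).
Proof.
move=> fi; rewrite /condE_Z mulrC -ExZ.
  by congr Ex; apply/funext => w; rewrite /rho mulrC mulrA.
apply: (@integrable_boundedM _ _ _ _ _ _ 1) => //.
  exact: (measurable_finite_rv (fun z' => (z' == z)%:R) (fzn 0)).
by move=> w; case: (_ == _); rewrite ?normr1 ?normr0.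
Qed.

Definition Dmat n (a : {ffun 'I_n -> 'I_k}) (zs : {ffun 'I_n -> zT}) :
    'M[R]_(k, #|zT|) :=
  \matrix_(t < k, c < #|zT|) (Num.sqrt n%:R *
    ((ntZf t (enum_val c) a zs)%:R / (nZf (enum_val c) zs)%:R - pi t)).

Local Notation fZf n := (@finite_rv_Zf _ _ _ _ _ _ _ _ _ _ hC1 n).

Definition stratumE n (f : T -> R) (zs : {ffun 'I_n -> zT}) : R :=
  Ex P (fun w => f w * \1_[set w | Zf Z n w = zs] w).

Lemma condE_ZnE n (f : T -> R) w0 :
  condE_Zn P Z n f w0 = stratumE f (Zf Z n w0) / \prod_i pz (Zf Z n w0 i).
Proof.
rewrite /condE_Zn -(prob_Zf hC1) (_ : Zev Z n w0 = [set w | Zf Z n w = Zf Z n w0])//.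
apply/seteqP; split=> w /= hw.
  by apply/ffunP => i; rewrite !ffunE; exact: hw.
move=> i lin; have /ffunP/(_ (Ordinal lin)) := hw.
by rewrite !ffunE.
Qed.

Lemma prod_pz_gt0 n (zs : {ffun 'I_n -> zT}) : 0 < \prod_i pz (zs i).
Proof. by apply: prodr_gt0 => i _. Qed.

Lemma indic_Zf_norm n (zs : {ffun 'I_n -> zT}) w :
  `|\1_[set w | Zf Z n w = zs] w : R| <= 1.
Proof. by rewrite indicE; case: (_ \in _); rewrite ?normr1 ?normr0. Qed.

Lemma measurable_indic_Zf n (zs : {ffun 'I_n -> zT}) :
  measurable_fun setT (\1_[set w | Zf Z n w = zs] : T -> R).
Proof. by apply: measurable_indic; exact: (fZf n). Qed.

Lemma condE_Zn_bound n (f : T -> R) w0 : measurable_fun setT f ->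
  (forall w, `|f w| <= 1) -> `|condE_Zn P Z n f w0| <= 1.
Proof.
move=> mf f1; rewrite condE_ZnE normrM normfV.
rewrite [X in _ / X]ger0_norm ?(ltW (prod_pz_gt0 _))//.
rewrite ler_pdivrMr ?prod_pz_gt0// mul1r -(prob_Zf hC1) -Ex_indic; last exact: (fZf n).
have i1 : P.-integrable setT (EFin \o (\1_[set w | Zf Z n w = Zf Z n w0] : T -> R)).
  by apply: (@bounded_integrable _ _ _ _ _ 1); [exact: measurable_indic_Zf|exact: indic_Zf_norm].
have i2 : P.-integrable setT (EFin \o
    (fun w => f w * \1_[set w | Zf Z n w = Zf Z n w0] w)).
  apply: (@integrable_boundedM _ _ _ _ _ _ 1).
  - exact: measurable_indic_Zf.
  - exact: indic_Zf_norm.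
  - exact: bounded_integrable f1.
apply: le_trans (Ex_norm i2) _; apply: Ex_le => //.
  exact: integrable_normr.
move=> w; have i0 : 0 <= \1_[set w | Zf Z n w = Zf Z n w0] w :> R.
  by rewrite indicE; case: (_ \in _).
by rewrite normrM (ger0_norm i0); exact: ler_piMl.
Qed.

Lemma measurable_condE_Zn n (f : T -> R) :
  measurable_fun setT (fun w => condE_Zn P Z n f w).
Proof.
under eq_fun do rewrite condE_ZnE.
exact: (measurable_finite_rv
  (fun zs : {ffun 'I_n -> zT} => stratumE f zs / \prod_i pz (zs i)) (fZf n)).
Qed.

Lemma tower n (G : {ffun 'I_n -> zT} -> R) (f : T -> R) (M : R) :
  measurable_fun setT f -> (forall w, `|f w| <= M) ->
  Ex P (fun w => G (Zf Z n w) * f w) =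
  Ex P (fun w0 => G (Zf Z n w0) * condE_Zn P Z n f w0).
Proof.
move=> mf fM; have ih := bounded_integrable P mf fM.
under [in RHS]eq_fun do rewrite condE_ZnE.
rewrite (Ex_finite_rv P (fun zs : {ffun 'I_n -> zT} =>
  G zs * (stratumE f zs / \prod_i pz (zs i))) (fZf n)).
under eq_bigr => zs _.
  rewrite (prob_Zf hC1) -mulrA divfK; last by rewrite gt_eqF// prod_pz_gt0.
  over.
have iq zs : P.-integrable setT (EFin \o (fun w => f w *
    \1_[set w | Zf Z n w = zs] w)).
  apply: (@integrable_boundedM _ _ _ _ _ _ 1) => //.
    exact: measurable_indic_Zf.
  exact: indic_Zf_norm.
under eq_bigr do rewrite -ExZ//.
rewrite -Ex_sum; last by move=> zs _; exact: integrable_scale.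
congr Ex; apply/funext => w; rewrite (bigD1 (Zf Z n w))//= indicE mem_set//.
rewrite mulr1 big1 ?addr0// => zs zsw; rewrite indicE memNset ?mulr0//=.
by move=> e; rewrite e eqxx in zsw.
Qed.

(* (C3) as it is used: conditionally on the strata the factor [cos] or [sin] of
   the balance statistic may be replaced by its Gaussian limit. *)
Lemma C3_factor (W : 'M[R]_(k, #|zT|)) (h : R -> R) :
  continuous h -> (forall x, `|h x| <= 1) ->
  exists c : R,
  (h = cos -> c = expR (- (Dform P Z Omg W / 2))) /\ (h = sin -> c = 0) /\
  (forall G : forall n, {ffun 'I_n -> zT} -> R, (forall n zs, `|G n zs| <= 1) ->
    (Ex P (fun w => G n (Zf Z n w) * h (mx_inner W (Dmat (Af A n w) (Zf Z n w))))
     - c * Ex P (fun w => G n (Zf Z n w))) @[n --> \oo] --> (0 : R)).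
Proof.
move=> ch h1; have [d' [T' [Q [G0 [[mG0 hG0] cf]]]]] := hC3.
have bc : bounded_continuous (fun M => h (mx_inner W M)).
  split; last by exists 1 => x; exact: h1.
  move=> M; apply: (@continuous_comp _ _ _ (mx_inner W) h); last exact: ch.
  rewrite /continuous_at /mx_inner; 
  apply: (@cvg_sumr R _ (nbhs M) (nbhs_filter M)) => i.
  apply: (@cvg_sumr R _ (nbhs M) (nbhs_filter M)) => j.
  by apply: cvgM; [exact: cvg_cst|exact: coord_continuous].
exists (fine ('E_Q[fun w => h (mx_inner W (G0 w))])%E); split; last split.
- by move=> ->; have [] := hG0 W.
- by move=> ->; have [] := hG0 W.
move=> G G1.
have fZ n := @finite_rv_Zf _ _ _ _ _ _ _ _ _ _ hC1 n.
set c := fine _.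
have cae := cf _ bc.
pose D n w : 'M[R]_(k, #|zT|) := Dmat (Af A n w) (Zf Z n w).
have DE n w : \matrix_(t < k, c < #|zT|)
        (Num.sqrt n%:R * ((ntZ Z A n t (enum_val c) w)%:R / (nZ Z n (enum_val c) w)%:R
                          - pi t)) = D n w.
  by apply/matrixP => i j; rewrite !mxE ntZfE nZfE.
pose ce n w0 := condE_Zn P Z n (fun w => h (mx_inner W (D n w))) w0.
have mD n : measurable_fun setT (fun w => h (mx_inner W (D n w))).
  exact: (measurable_AZ hC1 hC2 (fun a zs => h (mx_inner W (Dmat a zs)))).
have ce1 n w : `|ce n w| <= 1 by exact: condE_Zn_bound.
have mce n : measurable_fun setT (ce n) by exact: measurable_condE_Zn.
have mGn n : measurable_fun setT (fun w => G n (Zf Z n w)).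
  exact: (measurable_finite_rv (G n) (fZ n)).
have iG n : P.-integrable setT (EFin \o (fun w => G n (Zf Z n w))).
  exact: (integrable_finite_rv P (G n) (fZ n)).
have E n : Ex P (fun w => G n (Zf Z n w) * h (mx_inner W (D n w)))
     - c * Ex P (fun w => G n (Zf Z n w)) =
     Ex P (fun w => G n (Zf Z n w) * (ce n w - c)).
  have i1 : P.-integrable setT (EFin \o (fun w => G n (Zf Z n w) * ce n w)).
    apply: (@bounded_integrable _ _ _ _ _ 1).
      by apply: measurable_funM; [exact: mGn|exact: mce].
    by move=> w; rewrite normrM mulr_ile1//; exact: ce1.
  rewrite (tower (G n) (mD n) (fun w => h1 _)) -ExZ// -ExB//.
    by congr Ex; apply/funext => w; rewrite /ce; ring.
  exact: integrable_scale.
rewrite (funext E).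
rewrite -[X in _ --> X](Ex_cst P 0).
apply: (@cvg_Ex_ae _ _ _ P _ _ (fun=> 1 + `|c|)).
- by move=> n; apply: measurable_funM => //; exact: measurable_funB.
- exact: measurable_cst.
- apply: filterS cae => w cw; apply: norm_cvg0.
  have cw0 : `|ce n w - c| @[n --> \oo] --> (0 : R).
    rewrite -(normr0 R); apply: cvg_norm; apply/subr_cvg0.
    rewrite (_ : (fun n => ce n w) = fun n => condE_Zn P Z n (fun w => h
      (mx_inner W (\matrix_(t < k, c < #|zT|) (Num.sqrt n%:R *
       ((ntZ Z A n t (enum_val c) w)%:R / (nZ Z n (enum_val c) w)%:R - pi t))))) w)//.
    by apply/funext => n; rewrite /ce; congr condE_Zn; apply/funext => w';
      rewrite DE.
  apply: (@squeeze_cvgr _ _ _ _ (cst 0) _ _ _ _ _ cw0); last exact: cvg_cst.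
  by apply: nearW => n; rewrite normr_ge0 normrM ler_piMl.
- exact: integrable_cst.
- move=> n w; rewrite normrM; apply: le_trans (ler_piMl _ (G1 _ _)) _ => //.
  by rewrite (le_trans (ler_normB _ _))// lerD2r.
Qed.

Section Limit.
Variables (l : 'I_k -> zT -> ('I_k + 'I_p -> R) -> R) (g : zT -> R)
  (W : 'M[R]_(k, #|zT|)).
Hypothesis cl : forall t z (v : nat -> 'I_k + 'I_p -> R) v',
  (forall c, v n c @[n --> \oo] --> v' c) ->
  l t z (v n) @[n --> \oo] --> l t z v'.
Local Notation xi t z := (fun w => l t z (unit_coord Y X 0 ^~ w)).
Hypothesis xi2 : forall t z, P.-integrable setT (EFin \o (fun w => xi t z w ^+ 2)).
Hypothesis xi0 : forall t z, condE_Z P (Z 0%N) (xi t z) z = 0.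
Hypothesis g0 : Ex P (fun w => g (Z 0%N w)) = 0.

Local Notation s2 t z := (condE_Z P (Z 0%N) (fun w => xi t z w ^+ 2) z).

Let mxi t z i : measurable_fun setT (fun w => l t z (unit_coord Y X i ^~ w)).
Proof. by apply: (measurable_coord_fun hC1) => v v'; exact: cl. Qed.

Let ln n t z v : R := l t z v / Num.sqrt n%:R.

Let tau1 : R := \sum_t \sum_z pi t * pz z * s2 t z.

Let s2_nneg t z : 0 <= s2 t z.
Proof. by rewrite condE_ZE//; apply: (s2_ge0 P _ (rho_bound z)). Qed.

Let tau1_ge0 : 0 <= tau1.
Proof.
apply: sumr_ge0 => t _; apply: sumr_ge0 => z _.
apply: mulr_ge0; last exact: s2_nneg.
by apply: mulr_ge0; [exact: pi0|exact: ltW].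
Qed.

Let psiE n t z : psi P Y Z X (ln n) t z =
  wchar P (rho z) (fun w => xi t z w / Num.sqrt n%:R).
Proof.
rewrite /psi /wchar /ln; congr Complex; rewrite condE_ZE//.
  apply: (@bounded_integrable _ _ _ _ _ 1); last by move=> w; exact: cos_max.
  by apply: measurable_cos_comp; exact: measurable_funM.
apply: (@bounded_integrable _ _ _ _ _ 1); last by move=> w; exact: sin_max.
by apply: measurable_sin_comp; exact: measurable_funM.
Qed.

Let psi_le1 n t z : Normc.normc (psi P Y Z X (ln n) t z) <= 1.
Proof.
rewrite psiE; apply: (normc_wchar_le1 (measurable_rho z) (rho_bound z) (Ex_rho z)).
exact: measurable_funM.
Qed.

Let err n t z : R := n%:R * Normc.normc (psi P Y Z X (ln n) t z -
  Complex (expR (- (s2 t z / (2 * n%:R)))) 0).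

Let err_cvg t z : err n t z @[n --> \oo] --> (0 : R).
Proof.
have h0 : Ex P (fun w => xi t z w * rho z w) = 0.
  by rewrite -condE_ZE ?xi0//; exact: integrable_of_sqr.
have := wchar_small (measurable_rho z) (rho_bound z) (Ex_rho z) (mxi t z 0) (xi2 t z) h0.
by rewrite /err -condE_ZE//; under eq_fun do rewrite -psiE.
Qed.

Let Psi n w := \prod_(i < n) psi P Y Z X (ln n) (A i w) (Z i w).

Let gaussian_weight n w : R :=
  expR (- ((\sum_t \sum_z (ntZ Z A n t z w)%:R / n%:R * s2 t z) / 2)).

Let Psi_sub n w : (0 < n)%N ->
  Normc.normc (Psi n w - Complex (gaussian_weight n w) 0) <=
  \sum_t \sum_z err n t z.
Proof.
move=> n0; have n0' : 0 < n%:R :> R by rewrite ltr0n.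
have -> : Complex (gaussian_weight n w) 0 =
    \prod_(i < n) Complex (expR (- (s2 (A i w) (Z i w) / (2 * n%:R)))) 0.
  rewrite -Complex_real_prod -expR_sum sumrN; congr (Complex (expR (- _)) 0).
  transitivity (\sum_(i < n) \sum_t \sum_z
     ((Z i w == z) && (A i w == t))%:R * (s2 t z / (2 * n%:R))).
    rewrite [RHS]exchange_big/= mulr_suml; apply: eq_bigr => t _.
    rewrite [RHS]exchange_big/= mulr_suml; apply: eq_bigr => z _.
    rewrite ntZE natr_sum -!mulrA mulr_suml; apply: eq_bigr => i _.
    by congr (_ * _); rewrite invfM; ring.
  apply: eq_bigr => i _.
  rewrite (bigD1 (A i w))//= (bigD1 (Z i w))//= !eqxx mul1r.
  rewrite big1 ?addr0; last first.
    by move=> z; rewrite eq_sym => /negbTE ->; rewrite mul0r.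
  rewrite big1 ?addr0// => t; rewrite eq_sym => /negbTE tA.
  by rewrite big1// => z _; rewrite tA andbF mul0r.
pose nm t z := Normc.normc (psi P Y Z X (ln n) t z -
  Complex (expR (- (s2 t z / (2 * n%:R)))) 0).
have nm0 t z : 0 <= nm t z by exact: normc_ge0.
pose e := \sum_t \sum_z nm t z.
have -> : \sum_t \sum_z err n t z = n%:R * e.
  by rewrite /err mulr_sumr; apply: eq_bigr => t _; rewrite mulr_sumr.
apply: normc_prod_sub => i; first exact: psi_le1.
  rewrite normc_real ger0_norm ?expR_ge0// -[leRHS]expR0 ler_expR oppr_le0.
  by rewrite divr_ge0// mulr_ge0.
suff : nm (A i w) (Z i w) <= e by [].
rewrite /e (bigD1 (A i w))//= (bigD1 (Z i w))//= -addrA lerDl.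
apply: addr_ge0; first by apply: sumr_ge0.
by apply: sumr_ge0 => t _; apply: sumr_ge0.
Qed.

Let Psi_negl : negligible_in_prob P
  (fun n w => Normc.normc (Psi n w - Complex (expR (- (tau1 / 2))) 0)).
Proof.
have n1 : negligible_in_prob P (fun n w => \sum_t \sum_z err n t z).
  have c0 : (\sum_t \sum_z err n t z) @[n --> \oo] -->
      \sum_(t < k) \sum_(z : zT) (0 : R).
    apply: cvg_sumr => t; apply: cvg_sumr => z; exact: err_cvg.
  apply: negl_det; move: c0; rewrite big1// => t _; rewrite big1//.
have n2 : negligible_in_prob P (fun n w => \sum_t \sum_z
    ((ntZ Z A n t z w)%:R / n%:R - pi t * pz z) * s2 t z).
  apply: negl_sum => t _; apply: negl_sum => z _.
  apply: negl_mul_tight; first exact: (ntZ_lln hC1 hC2).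
  exact: (@tight_bounded _ _ _ P _ `|s2 t z|).
move=> e e0; have e2 : 0 < e / 2 by rewrite divr_gt0.
have pos : \forall n \near \oo, (0 < n)%N by exists 1%N.
near=> n.
have n0 : (0 < n)%N by near: n.
have [E1 [m1 p1 b1]] : exists E : set T, [/\ measurable E, prob P E <= e / 2 &
    forall w, ~ E w -> `|\sum_t \sum_z err n t z| <= e / 2].
  by near: n; exact: n1.
have [E2 [m2 p2 b2]] : exists E : set T, [/\ measurable E, prob P E <= e / 2 &
    forall w, ~ E w -> `|\sum_t \sum_z
    ((ntZ Z A n t z w)%:R / n%:R - pi t * pz z) * s2 t z| <= e / 2].
  by near: n; exact: n2.
exists (E1 `|` E2); split; first exact: measurableU.
  by rewrite (le_trans (probU_le _ m1 m2))// [leRHS]splitr lerD.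
move=> w /not_orP[h1 h2]; rewrite ger0_norm ?normc_ge0//.
have -> : Psi n w - Complex (expR (- (tau1 / 2))) 0 =
    (Psi n w - Complex (gaussian_weight n w) 0)
    + (Complex (gaussian_weight n w) 0 - Complex (expR (- (tau1 / 2))) 0).
  by ring.
apply: le_trans (le_normcD _ _) _; rewrite [leRHS]splitr lerD//.
  apply: le_trans (Psi_sub w n0) _; apply: le_trans (ler_norm _) _; exact: (b1 w).
rewrite (_ : Complex _ 0 - Complex _ 0 =
  Complex (gaussian_weight n w - expR (- (tau1 / 2))) 0); last first.
  by apply: complex_ext; rewrite /= ?subrr.
rewrite normc_real /gaussian_weight.
apply: le_trans (normr_expRN_sub _ _) _.
- rewrite divr_ge0// sumr_ge0// => t _; rewrite sumr_ge0// => z _.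
  by rewrite mulr_ge0// divr_ge0.
- by rewrite divr_ge0.
rewrite -mulrBl normrM [`|2^-1|]ger0_norm//.
have -> : \sum_t \sum_z (ntZ Z A n t z w)%:R / n%:R * s2 t z - tau1 =
    \sum_t \sum_z ((ntZ Z A n t z w)%:R / n%:R - pi t * pz z) * s2 t z.
  rewrite /tau1 -sumrB; apply: eq_bigr => t _; rewrite -sumrB.
  by apply: eq_bigr => z _; rewrite mulrBl.
apply: le_trans (b2 w h2); rewrite ler_pdivrMr//.
by rewrite ler_peMr// ler1n.
Unshelve. all: by end_near. Qed.

Let Dn n w := mx_inner W (Dmat (Af A n w) (Zf Z n w)).
Let IIn n w := (Num.sqrt n%:R)^-1 * \sum_(i < n) g (Z i w).
Let In n w := (Num.sqrt n%:R)^-1 *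
  \sum_(i < n) l (A i w) (Z i w) (unit_coord Y X i ^~ w).

Let IIf n (zs : {ffun 'I_n -> zT}) := (Num.sqrt n%:R)^-1 * \sum_i g (zs i).
Let IIE n w : IIn n w = IIf (Zf Z n w).
Proof. by congr (_ * _); apply: eq_bigr => i _; rewrite ffunE. Qed.

Let mII n : measurable_fun setT (IIn n).
Proof.
rewrite (funext (IIE n)).
exact: (measurable_finite_rv (@IIf n) (@finite_rv_Zf _ _ _ _ _ _ _ _ _ _ hC1 n)).
Qed.

Let mDn n : measurable_fun setT (Dn n).
Proof. exact: (measurable_AZ hC1 hC2 (fun a zs => mx_inner W (Dmat a zs))). Qed.

Lemma measurable_unit_sum n : measurable_fun setT (In n).
Proof.
apply: measurable_scale; apply: measurable_sumr => i _.
rewrite (_ : (fun w => _) = fun w => \sum_(x : 'I_k * zT)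
    l x.1 x.2 (unit_coord Y X i ^~ w) * ((A i w, Z i w) == x)%:R).
  apply: measurable_sumr => x _; apply: measurable_funM; first exact: mxi.
  have fA : finite_rv (A i) by have [mA _] := hC2; exact: mA.
  exact: (measurable_finite_rv (fun y => (y == x)%:R) (finite_rv_pair fA (fzn i))).
apply/funext => w; rewrite (bigD1 (A i w, Z i w))//= eqxx mulr1 big1 ?addr0//.
by move=> x; rewrite eq_sym => /negbTE ->; rewrite mulr0.
Qed.

Let CE_step1 n : CE P (fun w => cexp (In n w + (IIn n w + Dn n w))) =
  CE P (fun w => cexp (IIn n w + Dn n w) * Psi n w).
Proof.
have cln t z (v : nat -> 'I_k + 'I_p -> R) v' :
    (forall c, v m c @[m --> \oo] --> v' c) ->
    ln n t z (v m) @[m --> \oo] --> ln n t z v'.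
  by move=> vv; apply: cvgM; [exact: cl|exact: cvg_cst].
pose H (a : {ffun 'I_n -> 'I_k}) (zs : {ffun 'I_n -> zT}) : complex R :=
  cexp (IIf zs + mx_inner W (Dmat a zs)).
have := CE_factor hC1 hC2 pzpos H cln.
rewrite (_ : (fun w => H _ _ * \prod_(i < n) cexp _) =
  fun w => cexp (In n w + (IIn n w + Dn n w))).
  move=> ->; congr CE; apply/funext => w; congr (_ * _).
  by rewrite /H IIE.
apply/funext => w; rewrite /H -IIE -/(Dn n w) [RHS]cexpD [LHS]mulrC; congr (_ * _).
by rewrite -cexp_sum /In /ln -mulr_suml mulrC.
Qed.

Let cmPsi n : cmeasurable (Psi n).
Proof.
have := cmeasurable_finite_rv (fun x : {ffun 'I_n -> 'I_k} * {ffun 'I_n -> zT} =>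
  \prod_(i < n) psi P Y Z X (ln n) (x.1 i) (x.2 i))
  (@finite_rv_AZ _ _ _ _ _ _ _ _ _ _ _ _ hC1 hC2 n).
congr cmeasurable; apply/funext => w; rewrite /Psi/=.
by apply: eq_bigr => i _; rewrite !ffunE.
Qed.

Let C1c : complex R := Complex (expR (- (tau1 / 2))) 0.

Let normC1c : Normc.normc C1c <= 1.
Proof.
rewrite normc_real ger0_norm ?expR_ge0// -[leRHS]expR0 ler_expR oppr_le0.
by rewrite divr_ge0.
Qed.

Let Psi_le1 n w : Normc.normc (Psi n w) <= 1.
Proof. by apply: normc_prod_le1 => i; exact: psi_le1. Qed.

Let step1 : Normc.normc (CE P (fun w => cexp (In n w + (IIn n w + Dn n w)))
   - C1c * CE P (fun w => cexp (IIn n w + Dn n w))) @[n --> \oo] --> (0 : R).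
Proof.
have mc n : cmeasurable (fun w => cexp (IIn n w + Dn n w)).
  by apply: cmeasurable_cexp; exact: measurable_funD.
have mN n : measurable_fun setT (fun w => Normc.normc (Psi n w - C1c)).
  have := measurable_finite_rv (fun x : {ffun 'I_n -> 'I_k} * {ffun 'I_n -> zT} =>
    Normc.normc (\prod_(i < n) psi P Y Z X (ln n) (x.1 i) (x.2 i) - C1c))
    (@finite_rv_AZ _ _ _ _ _ _ _ _ _ _ _ _ hC1 hC2 n).
  congr measurable_fun; apply/funext => w; congr (Normc.normc (_ - _)).
  by apply: eq_bigr => i _; rewrite !ffunE.
have N2 n w : `|Normc.normc (Psi n w - C1c)| <= 2.
  rewrite ger0_norm ?normc_ge0//; apply: le_trans (le_normcD _ _) _.
  by rewrite normcN -[2]/(1 + 1) lerD.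
have h := negl_Ex_cvg0 mN N2 Psi_negl.
have h2 : 2 * Ex P (fun w => `|Normc.normc (Psi n w - C1c)|) @[n --> \oo] --> (0 : R).
  by rewrite -[X in _ --> X](mulr0 2); apply: cvgM => //; exact: cvg_cst.
apply: (@squeeze_cvgr _ _ _ _ (cst 0) _ _ _ _ _ h2); last exact: cvg_cst.
apply: nearW => n; rewrite normc_ge0 andTb CE_step1 -CEZ//; last first.
  by exists 1 => w; rewrite normc_cexp.
apply: CE_sub_le.
- exact: cmeasurableM.
- by apply: cmeasurableM => //; exact: cmeasurable_cst.
- by exists 1 => w; rewrite Normc.normcM normc_cexp mul1r.
- by exists 1 => w; rewrite Normc.normcM normc_cexp mulr1.
- apply: (@bounded_integrable _ _ _ _ _ 2); first exact: measurableT_comp.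
  by move=> w; rewrite normr_id.
move=> w; rewrite ger0_norm ?normc_ge0// [C1c * _]mulrC -mulrBr Normc.normcM.
by rewrite normc_cexp mul1r.
Qed.

Let step2 : ccvg (fun n => CE P (fun w => cexp (IIn n w + Dn n w)))
  (Complex (expR (- (Dform P Z Omg W / 2))) 0 *
   Complex (expR (- (Ex P (fun w => g (Z 0%N w) ^+ 2) / 2))) 0).
Proof.
have [c [cc [_ hc]]] := C3_factor W (@continuous_cos R) (@cos_max R).
have [c' [_ [cs hs]]] := C3_factor W (@continuous_sin R) (@sin_max R).
rewrite cc// in hc; rewrite cs// in hs => {c cc c' cs}.
set cD := expR (- (Dform P Z Omg W / 2)) in hc *.
have [zr zi] := Z_clt hC1 g0.
pose Gc n zs := cos (@IIf n zs); pose Gs n zs := sin (@IIf n zs).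
have GcE n : Ex P (fun w => Gc n (Zf Z n w)) = Ex P (fun w => cos (IIn n w)).
  by congr Ex; apply/funext => w; rewrite IIE.
have GsE n : Ex P (fun w => Gs n (Zf Z n w)) = Ex P (fun w => sin (IIn n w)).
  by congr Ex; apply/funext => w; rewrite IIE.
have mGc n : measurable_fun setT (fun w => Gc n (Zf Z n w)).
  exact: (measurable_finite_rv (Gc n) (@finite_rv_Zf _ _ _ _ _ _ _ _ _ _ hC1 n)).
have mGs n : measurable_fun setT (fun w => Gs n (Zf Z n w)).
  exact: (measurable_finite_rv (Gs n) (@finite_rv_Zf _ _ _ _ _ _ _ _ _ _ hC1 n)).
have hcc := hc Gc (fun n zs => cos_max _).
have hcs := hc Gs (fun n zs => sin_max _).
have hsc := hs Gc (fun n zs => cos_max _).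
have hss := hs Gs (fun n zs => sin_max _).
have bi (f1 f2 : T -> R) : measurable_fun setT f1 -> measurable_fun setT f2 ->
    (forall w, `|f1 w| <= 1) -> (forall w, `|f2 w| <= 1) ->
    P.-integrable setT (EFin \o (fun w => f1 w * f2 w)).
  move=> m1 m2 b1 b2; apply: (@bounded_integrable _ _ _ _ _ 1).
    exact: measurable_funM.
  by move=> w; rewrite normrM mulr_ile1.
have cosM f : `|cos f| <= 1 :> R by exact: cos_max.
have sinM f : `|sin f| <= 1 :> R by exact: sin_max.
split.
- rewrite ReM/= mulr0 subr0.
  rewrite (_ : (fun n => Ex P _) = fun n =>
     (Ex P (fun w => Gc n (Zf Z n w) * cos (Dn n w)) - cD * Ex P (fun w => Gc n (Zf Z n w)))
     - (Ex P (fun w => Gs n (Zf Z n w) * sin (Dn n w)) - 0 * Ex P (fun w => Gs n (Zf Z n w)))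
     + cD * Ex P (fun w => cos (IIn n w))).
    have hm : cD * Ex P (fun w => cos (IIn n w)) @[n --> \oo] -->
        cD * expR (- (Ex P (fun w => g (Z 0%N w) ^+ 2) / 2)).
      by apply: cvgM; [exact: cvg_cst|exact: zr].
    have := cvgD (cvgB hcc hss) hm; rewrite subr0 add0r => h.
    by apply: h.
  apply/funext => n; rewrite mul0r subr0 GcE [RHS]addrAC subrK -ExB.
  + by congr Ex; apply/funext => w; rewrite /Gc /Gs -!IIE cosD.
  + apply: bi; [exact: mGc|exact: measurable_cos_comp|..];
      by move=> w; exact: cos_max.
  + apply: bi; [exact: mGs|exact: measurable_sin_comp|..];
      by move=> w; exact: sin_max.
- rewrite ImM/= mul0r addr0.
  rewrite (_ : (fun n => Ex P _) = fun n =>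
     (Ex P (fun w => Gs n (Zf Z n w) * cos (Dn n w)) - cD * Ex P (fun w => Gs n (Zf Z n w)))
     + (Ex P (fun w => Gc n (Zf Z n w) * sin (Dn n w)) - 0 * Ex P (fun w => Gc n (Zf Z n w)))
     + cD * Ex P (fun w => sin (IIn n w))).
    have hm : cD * Ex P (fun w => sin (IIn n w)) @[n --> \oo] --> cD * 0.
      by apply: cvgM; [exact: cvg_cst|exact: zi].
    have := cvgD (cvgD hcs hsc) hm; rewrite addr0 add0r => h.
    by apply: h.
  apply/funext => n; rewrite mul0r subr0 GsE [RHS]addrAC subrK -ExD.
  + by congr Ex; apply/funext => w; rewrite /Gc /Gs -!IIE sinD.
  + apply: bi; [exact: mGs|exact: measurable_cos_comp|..];
      by move=> w; (exact: cos_max || exact: sin_max).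
  + apply: bi; [exact: mGc|exact: measurable_sin_comp|..];
      by move=> w; (exact: cos_max || exact: sin_max).
Qed.

Lemma master_clt :
  ccvg (fun n => CE P (fun w => cexp (In n w + (IIn n w + Dn n w))))
    (Complex (expR (- ((tau1 + Ex P (fun w => g (Z 0%N w) ^+ 2)
                        + Dform P Z Omg W) / 2))) 0).
Proof.
have := ccvg_sub0 (ccvgM (ccvg_cst C1c) step2) step1.
congr ccvg; rewrite /C1c -!Complex_realM -!expRD; congr (Complex (expR _) 0).
by field.
Qed.

End Limit.

End MasterCLT.

(** * Population moments and the limit variance *)

Section SquareIntegrable.
Context {R : realType} {d : measure_display} {T : measurableType d}.
Variable P : probability T R.

Definition L2 (f : T -> R) := measurable_fun setT f /\
  P.-integrable setT (EFin \o (fun w => f w ^+ 2)).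

Lemma L2_integrable f : L2 f -> P.-integrable setT (EFin \o f).
Proof. by move=> [mf fi]; exact: integrable_of_sqr. Qed.

Lemma L2_scale (c : R) f : L2 f -> L2 (fun w => c * f w).
Proof.
move=> [mf fi]; split; first exact: measurable_scale.
by under eq_fun do rewrite exprMn; exact: integrable_scale.
Qed.

Lemma L2_add f g : L2 f -> L2 g -> L2 (fun w => f w + g w).
Proof.
move=> [mf fi] [mg gi]; split; first exact: measurable_funD.
apply: (@le_integrable_real _ _ _ _ _ (fun w => 2 * f w ^+ 2 + 2 * g w ^+ 2)).
- by apply: measurable_funX; exact: measurable_funD.
- move=> w; rewrite ger0_norm ?sqr_ge0//.
  by have := sqr_ge0 (f w - g w); lra.
- by apply: integrable_addr; exact: integrable_scale.
Qed.

Lemma L2_sub f g : L2 f -> L2 g -> L2 (fun w => f w - g w).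
Proof.
move=> lf lg; under eq_fun do rewrite -mulN1r.
by apply: L2_add => //; exact: L2_scale.
Qed.

Lemma L2_bounded (M : R) (f : T -> R) : measurable_fun setT f -> (forall w, `|f w| <= M) ->
  L2 f.
Proof.
move=> mf fM; split=> //; apply: (@bounded_integrable _ _ _ _ _ (M ^+ 2)).
  exact: measurable_funX.
move=> w; rewrite normrX lerXn2r ?nnegrE//.
exact: le_trans (fM w).
Qed.

Lemma L2_cst (c : R) : L2 (fun=> c).
Proof. by apply: (@L2_bounded `|c|). Qed.

Lemma L2_sum (I : finType) (F : I -> T -> R) : (forall i, L2 (F i)) ->
  L2 (fun w => \sum_i F i w).
Proof.
move=> lF; rewrite (_ : (fun w => _) = \sum_i F i).
  elim/big_rec: _ => [|i f _ lf]; first exact: L2_cst.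
  exact: (L2_add (lF i) lf).
by apply/funext => w; rewrite fct_sumE.
Qed.

Lemma L2_mul_integrable f g : L2 f -> L2 g ->
  P.-integrable setT (EFin \o (fun w => f w * g w)).
Proof.
move=> [mf fi] [mg gi].
apply: (@le_integrable_real _ _ _ _ _ (fun w => f w ^+ 2 + g w ^+ 2)).
- exact: measurable_funM.
- move=> w; rewrite normrM -[f w ^+ 2]real_normK ?num_real//.
  rewrite -[g w ^+ 2]real_normK ?num_real//.
  by have := sqr_ge0 (`|f w| - `|g w|); have := sqr_ge0 (`|f w| + `|g w|); lra.
- exact: integrable_addr.
Qed.

End SquareIntegrable.

Section StratumCentring.
Context {R : realType} {d : measure_display} {T : measurableType d}.
Variables (P : probability T R) (zT : finType) (Z0 : T -> zT).
Hypothesis fz : finite_rv Z0.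
Local Notation pz z := (prob P [set w | Z0 w = z]).
Hypothesis pz_pos : forall z, 0 < pz z.
Local Notation condZ f z := (condE_Z P Z0 f z).
Implicit Types (f g : T -> R) (h : zT -> R).

Lemma L2_finite_rv h : L2 P (fun w => h (Z0 w)).
Proof.
split; first exact: measurable_finite_rv.
exact: (integrable_finite_rv P (fun z => h z ^+ 2) fz).
Qed.

Lemma integrable_stratum f z : P.-integrable setT (EFin \o f) ->
  P.-integrable setT (EFin \o (fun w => f w * (Z0 w == z)%:R)).
Proof.
apply: (@integrable_boundedM _ _ _ _ _ _ 1).
  exact: (measurable_finite_rv (fun z' => (z' == z)%:R) fz).
by move=> w; case: (_ == _); rewrite (normr1, normr0).
Qed.

Lemma sum_condE (f : zT -> T -> R) :
  (forall z, P.-integrable setT (EFin \o f z)) ->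
  \sum_z pz z * condZ (f z) z = Ex P (fun w => f (Z0 w) w).
Proof.
move=> fi; under eq_bigr => z _ do rewrite /condE_Z mulrC divfK ?gt_eqF//.
rewrite -Ex_sum => [|z _]; last exact: integrable_stratum.
congr Ex; apply/funext => w; rewrite (bigD1 (Z0 w))//= eqxx mulr1 big1 ?addr0//.
by move=> z; rewrite eq_sym => /negbTE ->; rewrite mulr0.
Qed.

Lemma condE_linear f g (a b : R) z : P.-integrable setT (EFin \o f) ->
  P.-integrable setT (EFin \o g) ->
  condZ (fun w => a * f w + b * g w) z = a * condZ f z + b * condZ g z.
Proof.
move=> fi gi; rewrite /condE_Z !mulrA -mulrDl; congr (_ / _).
have iF := integrable_stratum z fi; have iG := integrable_stratum z gi.
rewrite -(ExZ a iF) -(ExZ b iG) -ExD; [|exact: integrable_scale..].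
by congr Ex; apply/funext => w; ring.
Qed.

Lemma condE_scale f (a : R) z : P.-integrable setT (EFin \o f) ->
  condZ (fun w => a * f w) z = a * condZ f z.
Proof.
move=> fi; rewrite -[RHS]addr0 -[X in _ + X](mul0r (condZ f z)) -condE_linear//.
by congr (condE_Z _ _ _ _); apply/funext => w; rewrite mul0r addr0.
Qed.

Lemma condE_sub_cst f (b : R) z : P.-integrable setT (EFin \o f) ->
  condZ (fun w => f w - b) z = condZ f z - b.
Proof.
move=> fi; have c1 : condZ (fun=> 1) z = 1.
  rewrite /condE_Z; under eq_fun do rewrite mul1r.
  rewrite (Ex_finite_rv P (fun z' => (z' == z)%:R) fz) (bigD1 z)//= eqxx mul1r.
  rewrite big1 ?addr0 ?divff ?gt_eqF// => z' /negbTE ->.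
  by rewrite mul0r.
have -> : (fun w => f w - b) = fun w => 1 * f w + (- b) * 1.
  by apply/funext => w; rewrite mul1r mulr1.
by rewrite (condE_linear _ _ _ fi (integrable_cst P 1)) c1 mul1r mulr1.
Qed.

Lemma condE_sum (I : finType) (a : I -> R) (F : I -> T -> R) z :
  (forall i, P.-integrable setT (EFin \o F i)) ->
  condZ (fun w => \sum_i a i * F i w) z = \sum_i a i * condZ (F i) z.
Proof.
move=> Fi; rewrite /condE_Z.
under [RHS]eq_bigr => i _ do rewrite mulrA.
rewrite -mulr_suml; congr (_ / _).
under [RHS]eq_bigr => i _ do rewrite -(ExZ _ (integrable_stratum z (Fi i))).
rewrite -Ex_sum => [|i _].
  by congr Ex; apply/funext => w; rewrite mulr_suml; apply: eq_bigr => i _; rewrite mulrA.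
by apply: integrable_scale; exact: integrable_stratum.
Qed.

Definition tilde f w : R := f w - condZ f (Z0 w).

Lemma L2_tilde f : L2 P f -> L2 P (tilde f).
Proof. by move=> lf; apply: L2_sub => //; exact: (L2_finite_rv (fun z => condZ f z)). Qed.

Lemma tilde_sum (I : finType) (a : I -> R) (F : I -> T -> R) w :
  (forall i, L2 P (F i)) ->
  tilde (fun w => \sum_i a i * F i w) w = \sum_i a i * tilde (F i) w.
Proof.
move=> lF; rewrite /tilde condE_sum => [|i]; last exact: L2_integrable.
by rewrite -sumrB; apply: eq_bigr => i _; rewrite mulrBr.
Qed.

Lemma tilde_add f g w : L2 P f -> L2 P g ->
  tilde (fun w => f w + g w) w = tilde f w + tilde g w.
Proof.
move=> lf lg; rewrite /tilde.
rewrite (_ : (fun w => f w + g w) = fun w => 1 * f w + 1 * g w).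
  by rewrite condE_linear ?mul1r; [ring|exact: L2_integrable..].
by apply/funext => x; rewrite !mul1r.
Qed.

Lemma Ex_condE_mul f h : L2 P f ->
  Ex P (fun w => f w * h (Z0 w)) = Ex P (fun w => condZ f (Z0 w) * h (Z0 w)).
Proof.
move=> lf.
have fh z : P.-integrable setT (EFin \o (fun w => h z * f w)).
  by apply: integrable_scale; exact: L2_integrable.
transitivity (\sum_z pz z * condZ (fun w => h z * f w) z).
  by rewrite (sum_condE fh); congr Ex; apply/funext => w; rewrite mulrC.
rewrite (Ex_finite_rv P (fun z => condZ f z * h z) fz); apply: eq_bigr => z _.
by rewrite condE_scale; [ring|exact: L2_integrable].
Qed.

Lemma Ex_tilde_mul f g : L2 P f -> L2 P g ->
  Ex P (fun w => tilde f w * tilde g w) =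
  Ex P (fun w => f w * g w) - Ex P (fun w => condZ f (Z0 w) * condZ g (Z0 w)).
Proof.
move=> lf lg.
pose cf w := condZ f (Z0 w); pose cg w := condZ g (Z0 w).
have lcf : L2 P cf by exact: (L2_finite_rv (fun z => condZ f z)).
have lcg : L2 P cg by exact: (L2_finite_rv (fun z => condZ g z)).
have -> : (fun w => tilde f w * tilde g w) =
    fun w => (f w * g w - f w * cg w) - (g w * cf w - cf w * cg w).
  by apply/funext => w; rewrite /tilde -/(cf w) -/(cg w); ring.
have i1 := L2_mul_integrable lf lg; have i2 := L2_mul_integrable lf lcg.
have i3 := L2_mul_integrable lg lcf; have i4 := L2_mul_integrable lcf lcg.
rewrite ExB; [|exact: integrable_subr..]; rewrite (ExB i1 i2) (ExB i3 i4).
rewrite (Ex_condE_mul (fun z => condZ g z) lf) (Ex_condE_mul (fun z => condZ f z) lg).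
rewrite (_ : (fun w => condZ g (Z0 w) * _) = fun w => cf w * cg w) ?subrr ?subr0//.
by apply/funext => w; rewrite mulrC.
Qed.

End StratumCentring.

Lemma Ex_mul_sum {R : realType} {d : measure_display} {T : measurableType d}
    (P : probability T R) (I J : finType) (a : I -> R) (b : J -> R)
    (F : I -> T -> R) (G : J -> T -> R) :
  (forall i, L2 P (F i)) -> (forall j, L2 P (G j)) ->
  Ex P (fun w => (\sum_i a i * F i w) * (\sum_j b j * G j w)) =
  \sum_i \sum_j a i * b j * Ex P (fun w => F i w * G j w).
Proof.
move=> lF lG.
have lFG i j : P.-integrable setT (EFin \o (fun w => a i * b j * (F i w * G j w))).
  by apply: integrable_scale; exact: L2_mul_integrable.
have -> : (fun w => (\sum_i a i * F i w) * (\sum_j b j * G j w)) =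
    fun w => \sum_i \sum_j a i * b j * (F i w * G j w).
  apply/funext => w; rewrite mulr_suml; apply: eq_bigr => i _.
  by rewrite mulr_sumr; apply: eq_bigr => j _; ring.
rewrite Ex_sum => [|i _]; last by apply: integrable_sumr => j _; exact: lFG.
apply: eq_bigr => i _; rewrite Ex_sum => [|j _]; last exact: lFG.
by apply: eq_bigr => j _; rewrite ExZ//; exact: L2_mul_integrable.
Qed.

Lemma quad_formE {R : realType} (n : nat) (M : 'M[R]_n) (u : 'cV[R]_n) :
  (u^T *m M *m u) 0 0 = \sum_s \sum_t u s 0 * u t 0 * M s t.
Proof.
rewrite mxE exchange_big/=; apply: eq_bigr => t _; rewrite mxE mulr_suml.
by apply: eq_bigr => s _; rewrite mxE; ring.
Qed.

Lemma posdef_unitmx {R : realType} (n : nat) (M : 'M[R]_n) :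
  posdef M -> M \in unitmx.
Proof.
move=> pM; rewrite -row_free_unit -kermx_eq0; apply/eqP/row_matrixP => i.
rewrite row0; apply/eqP/negPn/negP => nz.
have := pM (row i (kermx M))^T; rewrite trmxK -row_mul mulmx_ker row0 mul0mx mxE ltxx.
by move=> h; have /h : (row i (kermx M))^T != 0 by rewrite trmx_eq0.
Qed.

Lemma sqr_sum_le {R : realType} (n : nat) (q x : 'I_n -> R) :
  (forall t, 0 < q t) -> \sum_t q t = 1 ->
  (\sum_t x t) ^+ 2 <= \sum_t x t ^+ 2 / q t.
Proof.
move=> q0 q1; set m := \sum_t x t.
have : 0 <= \sum_t q t * (x t / q t - m) ^+ 2.
  by apply: sumr_ge0 => t _; rewrite mulr_ge0 ?sqr_ge0// ltW.
have -> : \sum_t q t * (x t / q t - m) ^+ 2 =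
    \sum_t (x t ^+ 2 / q t - 2 * m * x t + m ^+ 2 * q t).
  by apply: eq_bigr => t _; field; rewrite gt_eqF.
rewrite big_split/= sumrB -!mulr_sumr q1 -/m.
by set S := \sum_t _; lra.
Qed.

Section Population.
Context {R : realType} {d : measure_display} {T : measurableType d}.
Variables (P : probability T R) (k p : nat) (zT : finType).
Variables (Y0 : 'I_k -> T -> R) (Z0 : T -> zT) (X0 : 'I_p -> T -> R).
Variables (pi : 'I_k -> R) (Omg : zT -> 'M[R]_k).
Hypotheses (lY : forall t, L2 P (Y0 t)) (lX : forall j, L2 P (X0 j)).
Hypothesis fz : finite_rv Z0.
Hypothesis pz_pos : forall z, 0 < prob P [set w | Z0 w = z].
Hypothesis pi_gt0 : forall t, 0 < pi t.
Hypothesis sum_pi : \sum_t pi t = 1.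
Hypothesis pdX : posdef (SigmaX P X0).
Local Notation condZ f z := (condE_Z P Z0 f z).
Local Notation tilde := (tilde P Z0).
Implicit Types (B : 'M[R]_(p, k)) (u : 'cV[R]_k).

Definition yc t w : R := Y0 t w - theta P Y0 t 0.
Definition xc j w : R := X0 j w - muX P X0 j 0.
Definition xfit B t w : R := \sum_j B j t * xc j w.
Definition res B t w : R := yc t w - xfit B t w.
Definition covXY : 'M[R]_(p, k) := \matrix_(j, t) cov P (X0 j) (Y0 t).
Definition res_cov B s t : R := Ex P (fun w => tilde (res B s) w * tilde (res B t) w).

Lemma L2_yc t : L2 P (yc t).
Proof. by apply: L2_sub => //; exact: L2_cst. Qed.
Lemma L2_xc j : L2 P (xc j).
Proof. by apply: L2_sub => //; exact: L2_cst. Qed.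
Lemma L2_xfit B t : L2 P (xfit B t).
Proof. by apply: L2_sum => j; apply: L2_scale; exact: L2_xc. Qed.
Lemma L2_res B t : L2 P (res B t).
Proof. by apply: L2_sub; [exact: L2_yc|exact: L2_xfit]. Qed.

Lemma Ex_yc t : Ex P (yc t) = 0.
Proof.
rewrite ExB ?Ex_cst ?mxE ?subrr//; first exact: L2_integrable.
exact: integrable_cst.
Qed.

Lemma Ex_xc j : Ex P (xc j) = 0.
Proof.
rewrite ExB ?Ex_cst ?mxE ?subrr//; first exact: L2_integrable.
exact: integrable_cst.
Qed.

Lemma Ex_xfit B t : Ex P (xfit B t) = 0.
Proof.
have i j := L2_integrable (L2_xc j).
rewrite Ex_sum => [|j _]; last exact: integrable_scale.
by rewrite big1// => j _; rewrite ExZ ?Ex_xc ?mulr0.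
Qed.

Lemma Ex_res B t : Ex P (res B t) = 0.
Proof.
rewrite ExB ?Ex_yc ?Ex_xfit ?subrr//; apply: L2_integrable.
  exact: L2_yc.
exact: L2_xfit.
Qed.

Lemma SigmaX_sym : (SigmaX P X0)^T = SigmaX P X0.
Proof.
apply/matrixP => i j; rewrite !mxE /cov; congr Ex; apply/funext => w.
exact: mulrC.
Qed.

Lemma SigmaX_scriptB : SigmaX P X0 *m scriptB P Y0 X0 = covXY.
Proof. by rewrite mulKVmx//; exact: posdef_unitmx. Qed.

Lemma scriptB_SigmaX : (scriptB P Y0 X0)^T *m SigmaX P X0 = covXY^T.
Proof. by rewrite -{1}SigmaX_sym -trmx_mul SigmaX_scriptB. Qed.

Lemma Ex_xc_yc j t : Ex P (fun w => xc j w * yc t w) = covXY j t.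
Proof. by rewrite mxE /cov /xc /yc !mxE. Qed.

Lemma Ex_xc_xc j l : Ex P (fun w => xc j w * xc l w) = SigmaX P X0 j l.
Proof. by rewrite mxE /cov /xc !mxE. Qed.

Lemma Ex_xc_xfit B j t :
  Ex P (fun w => xc j w * xfit B t w) = (SigmaX P X0 *m B) j t.
Proof.
rewrite mxE; under eq_fun do rewrite mulr_sumr.
rewrite Ex_sum => [|l _]; last first.
  by apply: L2_mul_integrable; [exact: L2_xc|apply: L2_scale; exact: L2_xc].
apply: eq_bigr => l _; rewrite -Ex_xc_xc mulrC -ExZ.
  by congr Ex; apply/funext => w; ring.
by apply: L2_mul_integrable; exact: L2_xc.
Qed.

Lemma Ex_xfit_mul B s f : L2 P f -> Ex P (fun w => xfit B s w * f w) =
  \sum_j B j s * Ex P (fun w => xc j w * f w).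
Proof.
move=> lf; under eq_fun do rewrite mulr_suml.
have i j : P.-integrable setT (EFin \o (fun w => xc j w * f w)).
  by apply: L2_mul_integrable => //; exact: L2_xc.
rewrite Ex_sum => [|j _].
  by apply: eq_bigr => j _; rewrite -ExZ//; congr Ex; apply/funext => w; ring.
apply: L2_mul_integrable => //; apply: L2_scale; exact: L2_xc.
Qed.

Lemma Ex_res_res B s t : Ex P (fun w => res B s w * res B t w) =
  cov P (Y0 s) (Y0 t) - (covXY^T *m B) s t - (B^T *m covXY) s t
  + (B^T *m SigmaX P X0 *m B) s t.
Proof.
have -> : (fun w => res B s w * res B t w) = fun w =>
    (yc s w * yc t w - xfit B t w * yc s w) -
    (xfit B s w * yc t w - xfit B s w * xfit B t w).
  by apply/funext => w; rewrite /res; ring.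
have i1 := L2_mul_integrable (L2_yc s) (L2_yc t).
have i2 := L2_mul_integrable (L2_xfit B t) (L2_yc s).
have i3 := L2_mul_integrable (L2_xfit B s) (L2_yc t).
have i4 := L2_mul_integrable (L2_xfit B s) (L2_xfit B t).
rewrite ExB; [|exact: integrable_subr..]; rewrite (ExB i1 i2) (ExB i3 i4).
rewrite (Ex_xfit_mul _ _ (L2_yc s)) (Ex_xfit_mul _ _ (L2_yc t)) (Ex_xfit_mul _ _ (L2_xfit B t)).
have -> : Ex P (fun w => yc s w * yc t w) = cov P (Y0 s) (Y0 t).
  by rewrite /cov /yc !mxE.
have -> : \sum_j B j t * Ex P (fun w => xc j w * yc s w) = (covXY^T *m B) s t.
  by rewrite mxE; apply: eq_bigr => j _; rewrite Ex_xc_yc mulrC [covXY^T _ _]mxE.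
have -> : \sum_j B j s * Ex P (fun w => xc j w * yc t w) = (B^T *m covXY) s t.
  by rewrite mxE; apply: eq_bigr => j _; rewrite Ex_xc_yc [B^T _ _]mxE.
have -> : \sum_j B j s * Ex P (fun w => xc j w * xfit B t w) =
    (B^T *m SigmaX P X0 *m B) s t.
  rewrite -mulmxA [RHS]mxE; apply: eq_bigr => j _.
  by rewrite Ex_xc_xfit [B^T _ _]mxE.
ring.
Qed.

Lemma var_res B t :
  var P (fun w => Y0 t w - \sum_j B j t * X0 j w) = Ex P (fun w => res B t w * res B t w).
Proof.
rewrite /var /cov.
have iX j : P.-integrable setT (EFin \o (fun w => B j t * X0 j w)).
  by apply: integrable_scale; exact: L2_integrable.
have -> : Ex P (fun w => Y0 t w - \sum_j B j t * X0 j w) =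
    theta P Y0 t 0 - \sum_j B j t * muX P X0 j 0.
  rewrite ExB; [|exact: L2_integrable|by apply: integrable_sumr => j _].
  rewrite Ex_sum// [theta _ _ _ _]mxE; congr (_ - _); apply: eq_bigr => j _.
  by rewrite ExZ ?[muX _ _ _ _]mxE//; exact: L2_integrable.
have e w : Y0 t w - \sum_j B j t * X0 j w - (theta P Y0 t 0 - \sum_j B j t * muX P X0 j 0)
    = res B t w.
  rewrite /res /yc /xfit /xc.
  under [X in _ = _ - X]eq_bigr => j _ do rewrite mulrBr.
  by rewrite sumrB; ring.
by congr Ex; apply/funext => w; rewrite !e.
Qed.

Lemma Ex_cond_cond B s t :
  Ex P (fun w => condZ (res B s) (Z0 w) * condZ (res B t) (Z0 w)) =
  Ex P (fun w => res B s w * res B t w) - res_cov B s t.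
Proof.
rewrite /res_cov (Ex_tilde_mul fz pz_pos (L2_res B s) (L2_res B t)); ring.
Qed.

Lemma VmatE B s t : Vmat P Y0 Z0 X0 pi Omg B s t =
  (s == t)%:R * (res_cov B t t / pi t) + cov P (Y0 s) (Y0 t) - res_cov B s t
  + Ex P (fun w => (Rmat P Y0 Z0 X0 pi B (Z0 w) *m Omg (Z0 w)
                    *m Rmat P Y0 Z0 X0 pi B (Z0 w)) s t).
Proof.
pose m r z := condZ (res B r) z.
have RE z (M : 'M[R]_k) : (Rmat P Y0 Z0 X0 pi B z *m M *m Rmat P Y0 Z0 X0 pi B z) s t =
    (pi s)^-1 * m s z * M s t * ((pi t)^-1 * m t z).
  rewrite /Rmat mul_mx_diag [LHS]mxE mul_diag_mx [X in X * _ = _]mxE.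
  by congr (_ * _ * _); rewrite [LHS]mxE.
have ps := lt0r_neq0 (pi_gt0 s); have pt := lt0r_neq0 (pi_gt0 t).
have -> : (fun w => (Rmat P Y0 Z0 X0 pi B (Z0 w) *m Omg (Z0 w)
                    *m Rmat P Y0 Z0 X0 pi B (Z0 w)) s t) = fun w =>
    (pi s)^-1 * m s (Z0 w) * Omg (Z0 w) s t * ((pi t)^-1 * m t (Z0 w)).
  by apply/funext => w; rewrite RE.
rewrite /Vmat [LHS]mxE [X in _ + X = _]mxE [X in _ - X = _]mxE.
have -> : (fun w => (Rmat P Y0 Z0 X0 pi B (Z0 w) *m (OmegaSR pi - Omg (Z0 w))
                    *m Rmat P Y0 Z0 X0 pi B (Z0 w)) s t) = fun w =>
    ((s == t)%:R / pi t - 1) * (m s (Z0 w) * m t (Z0 w)) -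
    (pi s)^-1 * m s (Z0 w) * Omg (Z0 w) s t * ((pi t)^-1 * m t (Z0 w)).
  apply/funext => w; rewrite RE /OmegaSR.
  have -> : (diag_mx (\row_t0 pi t0) - \col_t0 pi t0 *m (\col_t0 pi t0)^T - Omg (Z0 w)) s t
      = (s == t)%:R * pi t - pi s * pi t - Omg (Z0 w) s t.
    rewrite !mxE big_ord1 !mxE; congr (_ - _ - _).
    by case: eqP => [->|]; rewrite ?mul1r ?mul0r ?mulr1n ?mulr0n.
  by case: eqP => [->|_]; rewrite ?mulr0n ?mulr1n; field; rewrite ?ps ?pt.
have imm : P.-integrable setT (EFin \o (fun w => m s (Z0 w) * m t (Z0 w))).
  exact: (integrable_finite_rv P (fun z => m s z * m t z) fz).
rewrite ExB; [|exact: integrable_scale|]; last first.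
  exact: (integrable_finite_rv P (fun z => (pi s)^-1 * m s z * Omg z s t * ((pi t)^-1 * m t z)) fz).
rewrite (ExZ _ imm) Ex_cond_cond.
have -> : VSR P Y0 X0 pi B s t = (s == t)%:R / pi t * Ex P (fun w => res B s w * res B t w)
    + cov P (Y0 s) (Y0 t) - Ex P (fun w => res B s w * res B t w).
  rewrite /VSR scriptB_SigmaX -!mulmxA SigmaX_scriptB !mulmxA.
  set D := diag_mx _; have DE : D s t = (s == t)%:R / pi t *
      Ex P (fun w => res B s w * res B t w).
    rewrite mxE; case: eqP => [->|_]; last by rewrite mulr0n !mul0r.
    by rewrite mulr1n mxE var_res mul1r.
  rewrite [LHS]mxE [X in X + _ = _]mxE [X in X + _ + _ = _]mxE [X in _ + X = _]mxE DE.
  by rewrite Ex_res_res; ring.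
case: eqP => [->|_]; rewrite ?mulr0n ?mulr1n; last by ring.
by field.
Qed.

Definition imbalance_form B u : R := \sum_s \sum_t u s 0 * u t 0 *
  Ex P (fun w => (Rmat P Y0 Z0 X0 pi B (Z0 w) *m Omg (Z0 w)
                  *m Rmat P Y0 Z0 X0 pi B (Z0 w)) s t).

Lemma Ex_sqr_sum u (F : 'I_k -> T -> R) : (forall t, L2 P (F t)) ->
  Ex P (fun w => (\sum_t u t 0 * F t w) ^+ 2) =
  \sum_s \sum_t u s 0 * u t 0 * Ex P (fun w => F s w * F t w).
Proof.
by move=> lF; rewrite -Ex_mul_sum//; congr Ex; apply/funext => w; rewrite expr2.
Qed.

Lemma Vmat_quad B u : (u^T *m Vmat P Y0 Z0 X0 pi Omg B *m u) 0 0 =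
  \sum_t u t 0 ^+ 2 / pi t * res_cov B t t
  + Ex P (fun w => (\sum_t u t 0 * yc t w) ^+ 2)
  - Ex P (fun w => (\sum_t u t 0 * tilde (res B t) w) ^+ 2)
  + imbalance_form B u.
Proof.
rewrite quad_formE (Ex_sqr_sum u L2_yc).
rewrite Ex_sqr_sum => [|t]; last by apply: L2_tilde => //; exact: L2_res.
have -> : \sum_t u t 0 ^+ 2 / pi t * res_cov B t t =
    \sum_s \sum_t u s 0 * u t 0 * ((s == t)%:R * (res_cov B t t / pi t)).
  apply: eq_bigr => s _; rewrite (bigD1 s)//= eqxx big1 ?addr0.
    by rewrite mul1r expr2; ring.
  by move=> t; rewrite eq_sym => /negbTE ->; rewrite mul0r mulr0.
rewrite /imbalance_form -big_split -sumrB -big_split/=; apply: eq_bigr => s _.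
rewrite -big_split -sumrB -big_split/=; apply: eq_bigr => t _.
rewrite VmatE -/(res_cov B s t).
have -> : Ex P (fun w => yc s w * yc t w) = cov P (Y0 s) (Y0 t).
  by rewrite /cov /yc !mxE.
ring.
Qed.

Lemma imbalance_formE B u : imbalance_form B u =
  \sum_z prob P [set w | Z0 w = z] * \sum_s \sum_t
    (u s 0 / pi s * condZ (res B s) z) * (u t 0 / pi t * condZ (res B t) z) * Omg z s t.
Proof.
under [RHS]eq_bigr => z _ do rewrite mulr_sumr.
rewrite exchange_big/=; apply: eq_bigr => s _.
under [RHS]eq_bigr => z _ do rewrite mulr_sumr.
rewrite exchange_big/=; apply: eq_bigr => t _.
rewrite (Ex_finite_rv P (fun z => (Rmat P Y0 Z0 X0 pi B z *m Omg z
                  *m Rmat P Y0 Z0 X0 pi B z) s t) fz) mulr_sumr.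
apply: eq_bigr => z _; rewrite /Rmat mul_mx_diag [X in _ * (X * _) = _]mxE mul_diag_mx.
rewrite [X in _ * (X * _ * _) = _]mxE [X in _ * (X * _ * _ * _) = _]mxE.
rewrite [X in _ * (_ * X * _) = _]mxE.
rewrite -/(res B s) -/(res B t); ring.
Qed.

Section Optimality.
Hypothesis affine : forall z : zT, exists (c0 : R) (c : 'cV[R]_p),
  {ae P, forall w, (Z0 w == z)%:R = c0 + \sum_j c j 0 * X0 j w}.
Local Notation beta := (scriptB P Y0 X0).

Lemma Ex_xc_res j t : Ex P (fun w => xc j w * res beta t w) = 0.
Proof.
have i1 := L2_mul_integrable (L2_xc j) (L2_yc t).
have i2 := L2_mul_integrable (L2_xc j) (L2_xfit beta t).
under eq_fun do rewrite /res mulrBr.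
by rewrite (ExB i1 i2) Ex_xc_yc Ex_xc_xfit SigmaX_scriptB subrr.
Qed.

Lemma cond_res_scriptB t z : condZ (res beta t) z = 0.
Proof.
have [c0 [c hc]] := affine z.
pose b : R := c0 + \sum_j c j 0 * muX P X0 j 0.
have lr := L2_res beta t.
have -> : condZ (res beta t) z = Ex P (fun w => b * res beta t w +
    \sum_j c j 0 * (xc j w * res beta t w)) / prob P [set w | Z0 w = z].
  congr (_ / _); have [mr _] := lr; apply: eq_Ex_ae.
  - apply: measurable_funM => //.
    exact: (measurable_finite_rv (fun z' => (z' == z)%:R) fz).
  - apply: measurable_funD; first exact: measurable_scale.
    apply: measurable_sumr => j _; apply: measurable_scale.
    by apply: measurable_funM => //; have [] := L2_xc j.
  apply: filterS hc => w ->.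
  have -> : \sum_j c j 0 * X0 j w = \sum_j c j 0 * xc j w + \sum_j c j 0 * muX P X0 j 0.
    by rewrite -big_split/=; apply: eq_bigr => j _; rewrite /xc; ring.
  have -> : \sum_j c j 0 * (xc j w * res beta t w) =
      (\sum_j c j 0 * xc j w) * res beta t w.
    by rewrite mulr_suml; apply: eq_bigr => j _; rewrite mulrA.
  by rewrite /b; ring.
have ij j : P.-integrable setT (EFin \o (fun w => xc j w * res beta t w)).
  by apply: L2_mul_integrable; [exact: L2_xc|exact: lr].
rewrite ExD; last 2 first.
- by apply: integrable_scale; exact: L2_integrable.
- by apply: integrable_sumr => j _; exact: integrable_scale.
rewrite ExZ; last exact: L2_integrable.
rewrite Ex_res mulr0 add0r Ex_sum => [|j _]; last exact: integrable_scale.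
by rewrite big1 ?mul0r// => j _; rewrite ExZ ?Ex_xc_res ?mulr0.
Qed.

Lemma Rmat_scriptB z : Rmat P Y0 Z0 X0 pi beta z = 0.
Proof.
apply/matrixP => i j; rewrite [LHS]mxE [RHS]mxE [X in X *+ _]mxE.
by rewrite -/(res beta i) cond_res_scriptB mulr0 mul0rn.
Qed.

Lemma Vmat_scriptB : Vmat P Y0 Z0 X0 pi Omg beta = VSR P Y0 X0 pi beta.
Proof.
apply/matrixP => s t; rewrite /Vmat [LHS]mxE [X in _ + X]mxE [X in _ - X]mxE.
rewrite (_ : (fun w => _) = fun=> 0) ?Ex_cst ?subr0//.
by apply/funext => w; rewrite Rmat_scriptB mulmx0 mxE.
Qed.

Lemma imbalance_form_scriptB u : imbalance_form beta u = 0.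
Proof.
rewrite imbalance_formE big1// => z _; rewrite big1 ?mulr0// => s _.
by rewrite big1// => t _; rewrite !cond_res_scriptB !mulr0 !mul0r.
Qed.

Lemma Ex_sqr_sum_add u B : Ex P (fun w => (\sum_t u t 0 * tilde (res B t) w) ^+ 2) =
  Ex P (fun w => (\sum_t u t 0 * tilde (res beta t) w) ^+ 2) +
  Ex P (fun w => (\sum_t u t 0 * tilde (xfit (beta - B) t) w) ^+ 2).
Proof.
have h t w : tilde (res B t) w = tilde (res beta t) w + tilde (xfit (beta - B) t) w.
  rewrite -tilde_add//; [|exact: L2_res|exact: L2_xfit].
  apply: (congr1 (tilde ^~ w)); apply/funext => x.
  rewrite /res /xfit; have -> : \sum_j (beta - B) j t * xc j x =
     \sum_j beta j t * xc j x - \sum_j B j t * xc j x.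
    by rewrite -sumrB; apply: eq_bigr => j _; rewrite [(_ - B) _ _]mxE [(- B) _ _]mxE mulrBl.
  ring.
have lr t : L2 P (tilde (res beta t)) by apply: L2_tilde => //; exact: L2_res.
have lh t : L2 P (tilde (xfit (beta - B) t)).
  by apply: L2_tilde => //; exact: L2_xfit.
have orth s t : Ex P (fun w => tilde (res beta s) w * tilde (xfit (beta - B) t) w) = 0.
  rewrite (Ex_tilde_mul fz pz_pos (L2_res beta s) (L2_xfit _ t)).
  rewrite (_ : (fun w => condZ _ _ * _) = fun=> 0); last first.
    by apply/funext => w; rewrite cond_res_scriptB mul0r.
  rewrite Ex_cst subr0; under eq_fun do rewrite mulrC.
  rewrite Ex_xfit_mul; last exact: L2_res.
  by rewrite big1// => j _; rewrite Ex_xc_res mulr0.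
pose a w := \sum_t u t 0 * tilde (res beta t) w.
pose b w := \sum_t u t 0 * tilde (xfit (beta - B) t) w.
have la : L2 P a by apply: L2_sum => t; exact: L2_scale.
have lb : L2 P b by apply: L2_sum => t; exact: L2_scale.
have -> : (fun w => (\sum_t u t 0 * tilde (res B t) w) ^+ 2) =
    fun w => (a w ^+ 2 + b w ^+ 2) + 2 * (a w * b w).
  apply/funext => w; have -> : \sum_t u t 0 * tilde (res B t) w = a w + b w.
    by rewrite -big_split/=; apply: eq_bigr => t _; rewrite h mulrDr.
  ring.
have ab0 : Ex P (fun w => a w * b w) = 0.
  rewrite Ex_mul_sum// big1// => s _; rewrite big1// => t _.
  by rewrite orth mulr0.
have iab := L2_mul_integrable la lb.
have [_ ia] := la; have [_ ib] := lb.
rewrite ExD; [|exact: integrable_addr|exact: integrable_scale].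
by rewrite (ExD ia ib) (ExZ _ iab) ab0 mulr0 addr0.
Qed.

(* In [Vmat_quad] the residuals enter through [E q(tilde r_1, .., tilde r_k)],
   where [q a = sum_t u_t^2 a_t^2 / pi_t - (sum_t u_t a_t)^2] is nonnegative by
   Cauchy-Schwarz, and [tilde (res B t)] is [tilde (res beta t)] plus an
   orthogonal term. *)
Lemma Vmat_sub_psd B : (forall u, 0 <= imbalance_form B u) ->
  psd (Vmat P Y0 Z0 X0 pi Omg B - Vmat P Y0 Z0 X0 pi Omg beta).
Proof.
move=> D0 u; rewrite mulmxBr mulmxBl [X in _ <= X]mxE [X in _ <= _ + X]mxE.
rewrite !Vmat_quad imbalance_form_scriptB Ex_sqr_sum_add.
set h := fun t => tilde (xfit (beta - B) t).
have lh t : L2 P (h t) by apply: L2_tilde => //; exact: L2_xfit.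
have e t : res_cov B t t = res_cov beta t t + Ex P (fun w => h t w ^+ 2).
  have sel (F : 'I_k -> T -> R) : Ex P (fun w =>
      (\sum_s (delta_mx t 0 : 'cV[R]_k) s 0 * F s w) ^+ 2) = Ex P (fun w => F t w * F t w).
    congr Ex; apply/funext => w; rewrite (bigD1 t)//= mxE !eqxx mul1r.
    rewrite big1 ?addr0 ?expr2// => s /negbTE st.
    by rewrite mxE st mul0r.
  have := Ex_sqr_sum_add (delta_mx t 0) B; rewrite !sel /res_cov => ->.
  by congr (_ + _); congr Ex; apply/funext => w; rewrite expr2.
have -> : \sum_t u t 0 ^+ 2 / pi t * res_cov B t t =
    \sum_t u t 0 ^+ 2 / pi t * res_cov beta t t +
    Ex P (fun w => \sum_t (u t 0 * h t w) ^+ 2 / pi t).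
  rewrite Ex_sum => [|t _]; last first.
    have [_ i] := L2_scale (u t 0) (lh t).
    by under eq_fun do rewrite mulrC; exact: integrable_scale.
  rewrite -big_split/=; apply: eq_bigr => t _; rewrite e mulrDr; congr (_ + _).
  have [_ i] := lh t; rewrite -(ExZ _ i); congr Ex; apply/funext => w.
  by rewrite exprMn; ring.
have cs : Ex P (fun w => (\sum_t u t 0 * h t w) ^+ 2) <=
    Ex P (fun w => \sum_t (u t 0 * h t w) ^+ 2 / pi t).
  apply: Ex_le => [||w].
  - by have [] : L2 P (fun w => \sum_t u t 0 * h t w) by apply: L2_sum => t; exact: L2_scale.
  - apply: integrable_sumr => t _; have [_ i] := L2_scale (u t 0) (lh t).
    by under eq_fun do rewrite mulrC; exact: integrable_scale.
  - exact: sqr_sum_le.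
have := D0 u; move: cs; rewrite -/h.
set a := Ex P _; set b := Ex P _; lra.
Qed.

End Optimality.

End Population.

(** * Linearization of the estimator *)

Lemma tight_near_eq {R : realType} {d : measure_display} {T : measurableType d}
    (P : probability T R) (u v : nat -> T -> R) :
  (\forall n \near \oo, forall w, u n w = v n w) -> tight P v -> tight P u.
Proof.
move=> uv tv e e0; have [M hM] := tv e e0; exists M.
apply: filterS2 uv hM => n uvn [E [mE pE bE]].
by exists E; split=> // w Ew; rewrite uvn; exact: bE.
Qed.

Section ArmSums.
Context {R : realType} {d : measure_display} {T : measurableType d}.
Variables (P : probability T R) (k p : nat) (zT : finType).
Variables (Y : nat -> 'I_k -> T -> R) (Z : nat -> T -> zT)
          (X : nat -> 'I_p -> T -> R) (A : nat -> T -> 'I_k) (pi : 'I_k -> R)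
          (Omg : zT -> 'M[R]_k).
Hypotheses (hC1 : C1 P Y Z X) (hC2 : C2 P Y Z X A pi) (hC3 : C3 P Z A pi Omg).
Hypothesis pzpos : forall z, 0 < pz P Z z.
Hypothesis pi0 : forall t, 0 <= pi t.
Local Notation pz := (pz P Z).
Local Notation coords := ('I_k + 'I_p -> R).
Local Notation at0 F := (fun w => F (unit_coord Y X 0 ^~ w)).
Implicit Types F : coords -> R.

Definition regular F :=
  (forall (v : nat -> coords) v', (forall c, v n c @[n --> \oo] --> v' c) ->
     F (v n) @[n --> \oo] --> F v') /\
  P.-integrable setT (EFin \o (fun w => at0 F w ^+ 2)).

Lemma regular_L2 F : regular F -> L2 P (at0 F).
Proof.
by move=> [cF iF]; split=> //; exact: (measurable_coord_fun hC1).
Qed.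

Let fz : finite_rv (Z 0%N) := @finite_rv_Z _ _ _ _ _ _ _ _ _ _ hC1 0.

Lemma regular_integrable F : regular F -> P.-integrable setT (EFin \o at0 F).
Proof. by move=> rF; exact: (L2_integrable (regular_L2 rF)). Qed.

Lemma regular_coord c : regular (fun v => v c).
Proof.
split=> [v v' h|]; first exact: h.
have [_ [_ [_ [_ [_ [iY iX]]]]]] := hC1.
by case: c => t; [exact: (iY 0%N)|exact: (iX 0%N)].
Qed.

Lemma L2_Y0 t : L2 P (Y 0%N t).
Proof. exact: (regular_L2 (regular_coord (inl t))). Qed.

Lemma L2_X0 j : L2 P (X 0%N j).
Proof. exact: (regular_L2 (regular_coord (inr j))). Qed.

Lemma regular_cst (b : R) : regular (fun=> b).
Proof.
split=> [v v' _|]; first exact: cvg_cst.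
by have [] := L2_cst P (b : R).
Qed.

Lemma regular_add F F' : regular F -> regular F' ->
  regular (fun v => F v + F' v).
Proof.
move=> rF rF'; split; last by case: (L2_add (regular_L2 rF) (regular_L2 rF')).
move=> v v' h; have [cF _] := rF; have [cF' _] := rF'.
by apply: cvgD; [exact: cF|exact: cF'].
Qed.

Lemma regular_scale (b : R) F : regular F -> regular (fun v => b * F v).
Proof.
move=> rF; split; last by case: (L2_scale b (regular_L2 rF)).
by move=> v v' h; have [cF _] := rF; apply: cvgM; [exact: cvg_cst|exact: cF].
Qed.

Lemma regular_sub F F' : regular F -> regular F' ->
  regular (fun v => F v - F' v).
Proof.
move=> rF rF'; under eq_fun do rewrite -mulN1r.
by apply: regular_add => //; exact: regular_scale.
Qed.

Lemma regular_sum (I : finType) (F : I -> coords -> R) :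
  (forall i, regular (F i)) -> regular (fun v => \sum_i F i v).
Proof.
move=> rF; rewrite (_ : (fun v => _) = \sum_i F i).
  elim/big_rec: _ => [|i f _ lf]; first exact: regular_cst.
  exact: (regular_add (rF i) lf).
by apply/funext => w; rewrite fct_sumE.
Qed.

Lemma Dform_ge0 (W : 'M[R]_(k, #|zT|)) : 0 <= Dform P Z Omg W.
Proof.
have [d' [T' [Q [G0 [[mG0 hG0] _]]]]] := hC3.
have [hc _] := hG0 W.
have mW : measurable_fun setT (fun w => mx_inner W (G0 w)).
  apply: measurable_sumr => i _; apply: measurable_sumr => j _.
  exact: measurable_scale.
have : expR (- (Dform P Z Omg W / 2)) <= 1.
  rewrite -hc -/(Ex Q _) (le_trans (ler_norm _))//.
  by apply: Ex_bound; [exact: measurable_cos_comp|move=> w; exact: cos_max].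
by rewrite -[leRHS]expR0 ler_expR oppr_le0; lra.
Qed.

Lemma Dform_scale (v : R) (W : 'M[R]_(k, #|zT|)) :
  Dform P Z Omg (v *: W) = v ^+ 2 * Dform P Z Omg W.
Proof.
rewrite /Dform mulr_sumr; apply: eq_bigr => z _; rewrite mulrA; congr (_ / _).
have -> : col (enum_rank z) (v *: W) = v *: col (enum_rank z) W.
  by apply/colP => i; rewrite !mxE.
set x := col _ _; have -> : (v *: x)^T = v *: x^T.
  by apply/matrixP => i j; rewrite !mxE.
by rewrite -!scalemxAl -scalemxAr scalerA mxE expr2.
Qed.

Local Notation cond F z := (condE_Z P (Z 0%N) (at0 F) z).
Local Notation sums l g W := (fun n w =>
  (Num.sqrt n%:R)^-1 * \sum_(i < n) l (A i w) (Z i w) (unit_coord Y X i ^~ w)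
  + ((Num.sqrt n%:R)^-1 * \sum_(i < n) g (Z i w)
     + mx_inner W (Dmat pi (Af A n w) (Zf Z n w)))).

Lemma measurable_sums (l : 'I_k -> zT -> coords -> R) (g : zT -> R)
    (W : 'M[R]_(k, #|zT|)) n : (forall t z, regular (l t z)) ->
  measurable_fun setT (sums l g W n).
Proof.
move=> rl; apply: measurable_funD.
  by apply: (measurable_unit_sum hC1 hC2) => t z v v'; have [+ _] := rl t z; exact.
apply: measurable_funD.
  apply: measurable_scale; apply: measurable_sumr => i _.
  exact: (measurable_finite_rv g (@finite_rv_Z _ _ _ _ _ _ _ _ _ _ hC1 i)).
exact: (measurable_AZ hC1 hC2 (fun a zs => mx_inner W (Dmat pi a zs))).
Qed.

Lemma sums_tight (l : 'I_k -> zT -> coords -> R) (g : zT -> R)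
    (W : 'M[R]_(k, #|zT|)) :
  (forall t z, regular (l t z)) -> (forall t z, cond (l t z) z = 0) ->
  Ex P (fun w => g (Z 0%N w)) = 0 -> tight P (sums l g W).
Proof.
move=> rl l0 g0.
pose c := \sum_t \sum_z pi t * pz z * condE_Z P (Z 0%N) (fun w => at0 (l t z) w ^+ 2) z
  + Ex P (fun w => g (Z 0%N w) ^+ 2) + Dform P Z Omg W.
apply: (@tight_of_charfun _ _ _ P _ c).
- rewrite !addr_ge0 ?Dform_ge0//; last by apply: Ex_ge0 => w; exact: sqr_ge0.
  apply: sumr_ge0 => t _; apply: sumr_ge0 => z _; rewrite mulr_ge0//.
    by rewrite mulr_ge0// ltW.
  rewrite /condE_Z divr_ge0 ?prob_ge0//; apply: Ex_ge0 => w.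
  by rewrite mulr_ge0// sqr_ge0.
- by move=> n; exact: measurable_sums.
move=> v.
have cl t z (vv : nat -> coords) vv' : (forall c, vv n c @[n --> \oo] --> vv' c) ->
    v * l t z (vv n) @[n --> \oo] --> v * l t z vv'.
  by have [h _] := regular_scale v (rl t z); exact: h.
have xi2 t z : P.-integrable setT (EFin \o (fun w => (v * at0 (l t z) w) ^+ 2)).
  by have [_ h] := regular_scale v (rl t z); exact: h.
have xi0 t z : cond (fun x => v * l t z x) z = 0.
  by rewrite (condE_scale fz) ?l0 ?mulr0//; exact: regular_integrable.
have vg0 : Ex P (fun w => v * g (Z 0%N w)) = 0.
  by rewrite ExZ ?g0 ?mulr0//; exact: integrable_finite_rv.
have [/= + _] := @master_clt _ _ _ _ _ _ _ _ _ _ _ _ _ hC1 hC2 hC3 pzpos pi0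
  (fun t z x => v * l t z x) (fun z => v * g z) (v *: W) cl xi2 xi0 vg0.
rewrite (_ : \sum_t \sum_z pi t * pz z * _ + _ + _ = c * v ^+ 2).
  rewrite (_ : (fun n => Ex P _) = fun n => Ex P (fun w => cos (v * sums l g W n w)))//.
  apply/funext => n; congr Ex; apply/funext => w; congr cos.
  rewrite !mulrDr; congr (_ + (_ + _)).
  - by rewrite [RHS]mulrCA; congr (_ * _); rewrite mulr_sumr.
  - by rewrite [RHS]mulrCA; congr (_ * _); rewrite mulr_sumr.
  rewrite /mx_inner mulr_sumr; apply: eq_bigr => i _; rewrite mulr_sumr.
  by apply: eq_bigr => j _; rewrite mxE mulrA.
rewrite /c !mulrDl Dform_scale; congr (_ + _ + _); last by rewrite mulrC.
  rewrite mulr_suml; apply: eq_bigr => t _; rewrite mulr_suml.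
  apply: eq_bigr => z _; rewrite -[RHS]mulrA; congr (_ * _).
  rewrite [RHS]mulrC -(condE_scale fz); last by have [] := rl t z.
  by congr (condE_Z _ _ _ _); apply/funext => w; rewrite exprMn.
rewrite [RHS]mulrC -ExZ; last exact: (integrable_finite_rv P (fun z => g z ^+ 2)).
by congr Ex; apply/funext => w; rewrite exprMn.
Qed.

Lemma Ex_cond F : regular F ->
  Ex P (fun w => cond F (Z 0%N w)) = Ex P (at0 F).
Proof.
move=> rF; rewrite (Ex_Z0 hC1 (fun z => cond F z)).
rewrite -(sum_condE fz pzpos (fun=> regular_integrable rF)).
by apply: eq_bigr => z _; rewrite mulrC.
Qed.

Local Notation sqn n := (Num.sqrt (n%:R : R)).

Lemma regular_zero : regular (fun=> 0).
Proof. exact: regular_cst. Qed.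

Lemma cond_cst0 z : cond (fun=> 0) z = 0.
Proof.
by rewrite /condE_Z (_ : (fun w => _) = fun=> 0) ?Ex_cst ?mul0r//;
  apply/funext => w; rewrite mul0r.
Qed.

Definition imbalance n t z w : R :=
  sqn n * ((ntZ Z A n t z w)%:R / (nZ Z n z w)%:R - pi t).

Lemma mx_inner_Dmat (W : 'M[R]_(k, #|zT|)) n w :
  mx_inner W (Dmat pi (Af A n w) (Zf Z n w)) =
  \sum_t \sum_z W t (enum_rank z) * imbalance n t z w.
Proof.
apply: eq_bigr => t _; rewrite (reindex (@enum_rank zT)); last first.
  by exists enum_val => z _; rewrite ?enum_rankK ?enum_valK.
by apply: eq_bigr => z _; rewrite mxE enum_rankK /imbalance ntZfE nZfE.
Qed.

Lemma imbalance_tight t z : tight P (fun n w => imbalance n t z w).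
Proof.
pose W : 'M[R]_(k, #|zT|) := \matrix_(i, j) ((i == t) && (j == enum_rank z))%:R.
have := @sums_tight (fun _ _ _ => 0) (fun=> 0) W (fun _ _ => regular_zero)
  (fun _ => cond_cst0) (Ex_cst P 0).
move=> h; apply: tight_le h _ => n w; rewrite mx_inner_Dmat.
have z0 (j : nat) : \sum_(i < j) (0 : R) = 0 by rewrite big1.
rewrite !z0 !mulr0 !add0r (bigD1 t)//= (bigD1 z)//= [W _ _]mxE !eqxx mul1r.
rewrite big1 ?addr0; last first.
  move=> z' /negbTE zz; rewrite mxE eqxx/= (inj_eq enum_rank_inj) zz.
  by rewrite mul0r.
rewrite big1 ?addr0// => t' /negbTE tt; rewrite big1// => z' _.
by rewrite mxE tt mul0r.
Qed.

(* Also valid when [n(z) = 0], where [imbalance] involves [0 / 0 = 0]. *)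
Lemma ntZ_split n t z w : (0 < n)%N ->
  (sqn n)^-1 * (ntZ Z A n t z w)%:R =
  pi t * ((sqn n)^-1 * (nZ Z n z w)%:R) +
  (nZ Z n z w)%:R / n%:R * imbalance n t z w.
Proof.
move=> n0; have s0 : sqn n != 0 by rewrite gt_eqF// sqrtr_gt0 ltr0n.
have nE : n%:R = sqn n ^+ 2 by rewrite sqr_sqrtr.
rewrite /imbalance; move: s0 nE; set s := sqn n => s0 ->.
have [e|nz] := eqVneq (nZ Z n z w) 0%N.
  have := ntZ_le Z A n t z w; rewrite e leqn0 => /eqP ->.
  by rewrite !mul0r !mulr0 addr0.
by field; rewrite s0 pnatr_eq0 nz.
Qed.

Lemma arm_sum_strata (e : 'I_k -> R) (m : zT -> R) n w :
  \sum_(i < n) e (A i w) * m (Z i w) =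
  \sum_t \sum_z e t * m z * (ntZ Z A n t z w)%:R.
Proof.
transitivity (\sum_(i < n) \sum_t \sum_z
    e t * m z * ((Z i w == z) && (A i w == t))%:R).
  apply: eq_bigr => i _; rewrite (bigD1 (A i w))//= (bigD1 (Z i w))//= !eqxx mulr1.
  rewrite big1 ?addr0; last by move=> z; rewrite eq_sym => /negbTE ->; rewrite mulr0.
  rewrite big1 ?addr0// => t; rewrite eq_sym => /negbTE tA.
  by rewrite big1// => z _; rewrite tA andbF mulr0.
rewrite exchange_big/=; apply: eq_bigr => t _.
rewrite exchange_big/=; apply: eq_bigr => z _.
by rewrite -mulr_sumr ntZE natr_sum.
Qed.

Lemma sum_strata (m : zT -> R) n w :
  \sum_(i < n) m (Z i w) = \sum_z m z * (nZ Z n z w)%:R.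
Proof.
transitivity (\sum_(i < n) \sum_z m z * (Z i w == z)%:R).
  apply: eq_bigr => i _; rewrite (bigD1 (Z i w))//= eqxx mulr1 big1 ?addr0//.
  by move=> z; rewrite eq_sym => /negbTE ->; rewrite mulr0.
rewrite exchange_big/=; apply: eq_bigr => z _.
by rewrite -mulr_sumr nZE natr_sum.
Qed.

Lemma arm_mean_split (e : 'I_k -> R) (m : zT -> R) n w : (0 < n)%N ->
  (sqn n)^-1 * \sum_(i < n) e (A i w) * m (Z i w) =
  \sum_t e t * (pi t * ((sqn n)^-1 * \sum_(i < n) m (Z i w)) +
    \sum_z (nZ Z n z w)%:R / n%:R * m z * imbalance n t z w).
Proof.
move=> n0; rewrite arm_sum_strata sum_strata mulr_sumr; apply: eq_bigr => t _.
rewrite mulr_sumr !mulr_sumr -big_split mulr_sumr/=; apply: eq_bigr => z _.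
have := ntZ_split t z w n0.
set a := (sqn n)^-1; move=> h.
have -> : a * (e t * m z * (ntZ Z A n t z w)%:R) =
    e t * m z * (a * (ntZ Z A n t z w)%:R) by ring.
by rewrite h; ring.
Qed.

Lemma nZ_ratio_le1 n z w : `|(nZ Z n z w)%:R / n%:R : R| <= 1.
Proof.
rewrite ger0_norm ?divr_ge0//; have [->|n0] := posnP n.
  by rewrite invr0 mulr0.
by rewrite ler_pdivrMr ?ltr0n// mul1r ler_nat nZ_le.
Qed.

Lemma arm_sum_tight (e : 'I_k -> R) F : regular F -> Ex P (at0 F) = 0 ->
  tight P (fun n w =>
    (sqn n)^-1 * \sum_(i < n) e (A i w) * F (unit_coord Y X i ^~ w)).
Proof.
move=> rF F0.
pose m z := cond F z.
pose l t z v := e t * (F v - m z).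
have rl t z : regular (l t z).
  by apply: regular_scale; apply: regular_sub => //; exact: regular_cst.
have l0 t z : cond (l t z) z = 0.
  have rs : regular (fun v => F v - m z).
    by apply: regular_sub => //; exact: regular_cst.
  rewrite /l (condE_scale fz); last exact: (regular_integrable rs).
  by rewrite (condE_sub_cst fz pzpos) ?subrr ?mulr0//; exact: regular_integrable.
have m0 : Ex P (fun w => m (Z 0%N w)) = 0 by rewrite Ex_cond.
have t1 := @sums_tight l (fun=> 0) 0 rl l0 (Ex_cst P 0).
have t2 := Z_clt_tight hC1 m0.
have tc (c : R) : tight P (fun _ _ => c) by exact: (@tight_bounded _ _ _ P _ `|c|).
have t3 : tight P (fun n w => \sum_t e t *
    (pi t * ((sqn n)^-1 * \sum_(i < n) m (Z i w)) +
    \sum_z (nZ Z n z w)%:R / n%:R * m z * imbalance n t z w)).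
  apply: tight_sum => t _; apply: tight_mul; first exact: tc.
  apply: tight_add; first by apply: tight_mul; [exact: tc|exact: t2].
  apply: tight_sum => z _; apply: tight_mul; last exact: imbalance_tight.
  apply: tight_mul; last exact: tc.
  exact: (tight_bounded P (fun n w => nZ_ratio_le1 n z w)).
apply: tight_near_eq (tight_add t1 t3); exists 1%N => // n /= n0 w.
have zz : (sqn n)^-1 * (\sum_(i < n) 0) +
    mx_inner 0 (Dmat pi (Af A n w) (Zf Z n w)) = 0.
  rewrite big1// mulr0 add0r /mx_inner big1// => i _.
  by rewrite big1// => j _; rewrite mxE mul0r.
rewrite -arm_mean_split// zz addr0.
rewrite -mulrDr -big_split/=; congr (_ * _); apply: eq_bigr => i _.
by rewrite /l -mulrDr subrK.
Qed.

End ArmSums.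

Lemma normr_sin_le {R : realType} (x : R) : `|sin x| <= `|x|.
Proof.
wlog x0 : x / 0 <= x.
  move=> h; have [|/ltW x0] := leP 0 x; first exact: h.
  by rewrite -normrN -sinN -[leRHS]normrN; apply: h; rewrite oppr_ge0.
rewrite [leRHS]ger0_norm// ler_norml; have := sin_le_id x0 => h1.
apply/andP; split; last by lra.
have [x1|x1] := leP x 1; last by have := sin_geN1 x; lra.
have h2 := sin_ge_taylor x0.
have x2 : x ^+ 2 <= 1 by rewrite expr_le1.
have : x ^+ 3 <= x by rewrite exprS ler_piMr.
lra.
Qed.

Lemma normr_cos_sub {R : realType} (x y : R) : `|cos x - cos y| <= `|x - y|.
Proof.
pose a := (x + y) / 2; pose b := (x - y) / 2.
have -> : cos x - cos y = - 2 * (sin a * sin b).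
  have -> : x = a + b by rewrite /a /b; lra.
  have -> : y = a - b by rewrite /a /b; lra.
  by rewrite cosD cosB; ring.
rewrite !normrM normrN normr_nat.
have -> : `|x - y| = 2 * `|b|.
  by rewrite /b normrM normfV normr_nat; field.
rewrite ler_pM2l// -[leRHS]mul1r.
by apply: ler_pM => //; [exact: sin_max|exact: normr_sin_le].
Qed.

Section Slutsky.
Context {R : realType} {d : measure_display} {T : measurableType d}.
Variable P : probability T R.
Implicit Types u v : nat -> T -> R.

Lemma negl_eq_small u v (a : nat -> T -> R) (c : R) : 0 < c ->
  negligible_in_prob P a -> negligible_in_prob P v ->
  (forall n w, `|a n w| < c -> u n w = v n w) -> negligible_in_prob P u.
Proof.
move=> c0 na nv uv e e0; have e2 : 0 < e / 2 by rewrite divr_gt0.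
have m0 : 0 < Num.min (e / 2) (c / 2) by rewrite lt_min e2 divr_gt0.
apply: filterS2 (na _ m0) (nv _ e2) => n [E1 [m1 p1 b1]] [E2 [m2 p2 b2]].
have [me mc] : Num.min (e / 2) (c / 2) <= e / 2 /\ Num.min (e / 2) (c / 2) <= c / 2.
  by split; rewrite ge_min lexx ?orbT.
exists (E1 `|` E2); split; first exact: measurableU.
  rewrite (le_trans (probU_le _ m1 m2))// [leRHS]splitr lerD//.
  exact: le_trans me.
move=> w /not_orP[n1 n2]; rewrite uv; last first.
  by rewrite (le_lt_trans (b1 _ n1))// (le_lt_trans mc)//; lra.
by rewrite (le_trans (b2 _ n2))//; lra.
Qed.

Lemma negl_norm u : negligible_in_prob P u ->
  negligible_in_prob P (fun n w => `|u n w|).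
Proof. by move=> nu; apply: negl_le nu _ => n w; rewrite normr_id. Qed.

Lemma tight_cst (c : R) : tight P (fun _ _ => c).
Proof. exact: (@tight_bounded _ _ _ P _ `|c|). Qed.

Lemma negl_scale (c : R) u : negligible_in_prob P u ->
  negligible_in_prob P (fun n w => c * u n w).
Proof.
move=> nu; under eq_fun do under eq_fun do rewrite mulrC.
by apply: negl_mul_tight => //; exact: tight_cst.
Qed.

Lemma cvg_Ex_cos_of_negl u v (a c : R) :
  (forall n, measurable_fun setT (u n)) -> (forall n, measurable_fun setT (v n)) ->
  negligible_in_prob P (fun n w => u n w - v n w) ->
  ccvg (fun n => CE P (fun w => cexp (v n w))) (Complex c 0) ->
  Ex P (fun w => cos (u n w + a)) @[n --> \oo] --> cos a * c.
Proof.
move=> mu mv nuv [/= hc hs].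
have icos (f : T -> R) : measurable_fun setT f ->
    P.-integrable setT (EFin \o (fun w => cos (f w))).
  move=> mf; apply: (@bounded_integrable _ _ _ _ _ 1) => [|w]; last exact: cos_max.
  exact: measurable_cos_comp.
have isin (f : T -> R) : measurable_fun setT f ->
    P.-integrable setT (EFin \o (fun w => sin (f w))).
  move=> mf; apply: (@bounded_integrable _ _ _ _ _ 1) => [|w]; last exact: sin_max.
  exact: measurable_sin_comp.
have mD (f : T -> R) : measurable_fun setT f -> measurable_fun setT (fun w => f w + a).
  by move=> mf; apply: measurable_funD.
have cv : Ex P (fun w => cos (v n w + a)) @[n --> \oo] --> cos a * c.
  have e n : Ex P (fun w => cos (v n w + a)) =
      cos a * Ex P (fun w => cos (v n w)) - sin a * Ex P (fun w => sin (v n w)).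
    rewrite -!ExZ; [|exact: isin|exact: icos].
    rewrite -ExB; [|by apply: integrable_scale; exact: icos
                   |by apply: integrable_scale; exact: isin].
    by congr Ex; apply/funext => w; rewrite cosD; ring.
  rewrite (funext e) -[X in _ --> X]subr0 -[X in _ - X](mulr0 (sin a)).
  by apply: cvgB; apply: cvgM => //; exact: cvg_cst.
have mc n : measurable_fun setT (fun w => cos (u n w + a) - cos (v n w + a)).
  by apply: measurable_funB; apply: measurable_cos_comp; exact: mD.
have bc n w : `|cos (u n w + a) - cos (v n w + a)| <= 2.
  rewrite (le_trans (ler_normB _ _))// (_ : 2 = 1 + 1)//.
  by apply: lerD; exact: cos_max.
have nc : negligible_in_prob P (fun n w => cos (u n w + a) - cos (v n w + a)).
  apply: negl_le nuv _ => n w; apply: (le_trans (normr_cos_sub _ _)).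
  by rewrite opprD addrACA subrr addr0.
have h := negl_Ex_cvg0 mc bc nc.
have h0 : (Ex P (fun w => cos (u n w + a)) - Ex P (fun w => cos (v n w + a)))
    @[n --> \oo] --> (0 : R).
  apply/norm_cvg0P/(squeeze_cvgr _ (cvg_cst 0) h); near=> n.
  rewrite normr_ge0/= -ExB; [|by apply: icos; exact: mD|by apply: icos; exact: mD].
  by apply: Ex_norm; apply: (@bounded_integrable _ _ _ _ _ 2).
rewrite (_ : (fun n => Ex P (fun w => cos (u n w + a))) = fun n =>
   (Ex P (fun w => cos (u n w + a)) - Ex P (fun w => cos (v n w + a)))
   + Ex P (fun w => cos (v n w + a))); last by apply/funext => n; rewrite subrK.
rewrite -[X in _ --> X]add0r; exact: cvgD.
Unshelve. all: by end_near. Qed.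

End Slutsky.

Section Linearization.
Context {R : realType} {d : measure_display} {T : measurableType d}.
Variables (P : probability T R) (k p : nat) (zT : finType).
Variables (Y : nat -> 'I_k -> T -> R) (Z : nat -> T -> zT)
          (X : nat -> 'I_p -> T -> R) (A : nat -> T -> 'I_k) (pi : 'I_k -> R)
          (Omg : zT -> 'M[R]_k).
Hypotheses (hC1 : C1 P Y Z X) (hC2 : C2 P Y Z X A pi) (hC3 : C3 P Z A pi Omg).
Hypothesis pzpos : forall z, 0 < pz P Z z.
Hypothesis pi_gt0 : forall t, 0 < pi t.
Variables (B : 'M[R]_(p, k)) (t0 : 'I_k).
Local Notation pz := (pz P Z).
Local Notation coords := ('I_k + 'I_p -> R).
Local Notation at0 F := (fun w => F (unit_coord Y X 0 ^~ w)).
Local Notation cond F z := (condE_Z P (Z 0%N) (at0 F) z).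
Local Notation sqn n := (Num.sqrt (n%:R : R)).
Local Notation th t := (theta P (Y 0%N) t 0).
Local Notation mu j := (muX P (X 0%N) j 0).
Local Notation imb := (imbalance Z A pi).
Implicit Types (F : coords -> R) (u : 'cV[R]_k).

Let pi0 t : 0 <= pi t. Proof. exact: ltW. Qed.

Definition centred_x (j : 'I_p) (v : coords) : R := v (inr j) - mu j.
Definition resid (t : 'I_k) (v : coords) : R :=
  v (inl t) - th t - \sum_j B j t * centred_x j v.
Definition xlin u (v : coords) : R := \sum_s u s 0 * \sum_j B j s * centred_x j v.

Definition cond_resid t z := cond (resid t) z.
Definition cond_xlin u z := cond (xlin u) z.

(* [lin_unit] is centred given the stratum, [lin_Z] depends on the stratum only,
   and [lin_D] is the linear form applied to the imbalances of (C3). *)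
Definition lin_unit u t z (v : coords) : R :=
  u t 0 / pi t * (resid t v - cond_resid t z) + (xlin u v - cond_xlin u z).
Definition lin_Z u z : R := \sum_t u t 0 * cond_resid t z + cond_xlin u z.
Definition lin_D u : 'M[R]_(k, #|zT|) := \matrix_(t < k, c < #|zT|)
  (u t 0 / pi t * pz (enum_val c) * cond_resid t (enum_val c)).

Definition linearized u n w : R :=
  (sqn n)^-1 * \sum_(i < n) lin_unit u (A i w) (Z i w) (unit_coord Y X i ^~ w)
  + ((sqn n)^-1 * \sum_(i < n) lin_Z u (Z i w)
     + mx_inner (lin_D u) (Dmat pi (Af A n w) (Zf Z n w))).

Definition arm_sum F t n w : R :=
  (sqn n)^-1 * \sum_(i < n) (A i w == t)%:R * F (unit_coord Y X i ^~ w).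
Definition full_sum F n w : R :=
  (sqn n)^-1 * \sum_(i < n) F (unit_coord Y X i ^~ w).

Lemma arm_centering (f : nat -> R) (a : R) n t w : (0 < n)%N -> (0 < nt A n t w)%N ->
  sqn n * ((\sum_(i < n | A i w == t) f i) / (nt A n t w)%:R - a) =
  n%:R / (nt A n t w)%:R * ((sqn n)^-1 * \sum_(i < n) (A i w == t)%:R * (f i - a)).
Proof.
move=> n0 nt0; have s0 : sqn n != 0 by rewrite gt_eqF// sqrtr_gt0 ltr0n.
have nE : n%:R = sqn n ^+ 2 by rewrite sqr_sqrtr.
have -> : \sum_(i < n) (A i w == t)%:R * (f i - a) =
    \sum_(i < n | A i w == t) f i - a * (nt A n t w)%:R.
  rewrite ntE natr_sum mulr_sumr [X in _ = X - _]big_mkcond -sumrB/=.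
  by apply: eq_bigr => i _; case: (_ == _); rewrite ?mul0r ?mul1r ?mulr1 ?mulr0 ?subr0.
move: s0 nE; set s := sqn n => s0 ->.
by field; rewrite s0 pnatr_eq0 -lt0n nt0.
Qed.

Lemma full_centering (f : nat -> R) (a : R) n : (0 < n)%N ->
  sqn n * ((\sum_(i < n) f i) / n%:R - a) = (sqn n)^-1 * \sum_(i < n) (f i - a).
Proof.
move=> n0; have s0 : sqn n != 0 by rewrite gt_eqF// sqrtr_gt0 ltr0n.
have nE : n%:R = sqn n ^+ 2 by rewrite sqr_sqrtr.
rewrite sumrB sumr_const card_ord -[a *+ n]mulr_natr.
by move: s0 nE; set s := sqn n => s0 ->; field.
Qed.

Lemma arm_sum_resid t n w : arm_sum (fun v => v (inl t) - th t) t n w =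
  arm_sum (resid t) t n w + \sum_j B j t * arm_sum (centred_x j) t n w.
Proof.
rewrite /arm_sum; under [X in _ = _ + X]eq_bigr => j _ do rewrite mulrCA.
rewrite -mulr_sumr -mulrDr; congr (_ * _).
under [X in _ = _ + X]eq_bigr => j _ do rewrite mulr_sumr.
rewrite exchange_big -big_split/=; apply: eq_bigr => i _.
under [X in _ = _ + X]eq_bigr => j _ do rewrite mulrCA.
by rewrite -mulr_sumr -mulrDr /resid subrK.
Qed.

Lemma theta_hat_expand (b : 'M[R]_(p, k)) n t w : (0 < n)%N -> (0 < nt A n t w)%N ->
  let c := n%:R / (nt A n t w)%:R in
  sqn n * (theta_hat Y X A n b w t 0 - th t) =
  c * arm_sum (resid t) t n w
  + \sum_j (B j t - b j t) *
      (c * arm_sum (centred_x j) t n w - full_sum (centred_x j) n w)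
  + \sum_j B j t * full_sum (centred_x j) n w.
Proof.
move=> n0 nt0 c.
have hY : sqn n * (Ybar Y A n t w - th t) =
    c * arm_sum (fun v => v (inl t) - th t) t n w.
  exact: (arm_centering (fun i => Y i t w)).
have hX j : sqn n * (Xbar_arm X A n t j w - Xbar X n j w) =
    c * arm_sum (centred_x j) t n w - full_sum (centred_x j) n w.
  have e1 := arm_centering (fun i => X i j w) (mu j) n0 nt0.
  have e2 := full_centering (fun i => X i j w) (mu j) n0.
  rewrite /arm_sum /full_sum /centred_x /= -e1 -e2.
  by rewrite /Xbar_arm /Xbar; ring.
rewrite [theta_hat _ _ _ _ _ _ _ _]mxE.
have -> : sqn n * (Ybar Y A n t w -
    \sum_j b j t * (Xbar_arm X A n t j w - Xbar X n j w) - th t) =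
    sqn n * (Ybar Y A n t w - th t) -
    \sum_j b j t * (sqn n * (Xbar_arm X A n t j w - Xbar X n j w)).
  under [X in _ = _ - X]eq_bigr => j _ do rewrite mulrCA.
  by rewrite -mulr_sumr; ring.
under [X in _ - X = _]eq_bigr => j _ do rewrite hX.
rewrite hY arm_sum_resid mulrDr -!addrA; congr (_ + _).
rewrite mulr_sumr -sumrB -big_split/=; apply: eq_bigr => j _; ring.
Qed.

Lemma arm_sum_split u n w : (0 < n)%N ->
  \sum_t u t 0 / pi t * arm_sum (resid t) t n w
  + \sum_t u t 0 * \sum_j B j t * full_sum (centred_x j) n w =
  linearized u n w + \sum_t \sum_z u t 0 / pi t *
    (((nZ Z n z w)%:R / n%:R - pz z) * cond_resid t z * imb n t z w).
Proof.
move=> n0; set s := (sqn n)^-1.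
pose e t := u t 0 / pi t.
have E1 : \sum_t e t * arm_sum (resid t) t n w =
    s * \sum_(i < n) e (A i w) * resid (A i w) (unit_coord Y X i ^~ w).
  rewrite /arm_sum; under eq_bigr => t _ do rewrite mulrCA mulr_sumr.
  rewrite -mulr_sumr exchange_big/=; congr (_ * _); apply: eq_bigr => i _.
  rewrite (bigD1 (A i w))//= eqxx mul1r big1 ?addr0// => t.
  by rewrite eq_sym => /negbTE ->; rewrite mul0r mulr0.
have E2 : \sum_t u t 0 * (\sum_j B j t * full_sum (centred_x j) n w) =
    s * \sum_(i < n) xlin u (unit_coord Y X i ^~ w).
  rewrite exchange_big/= mulr_sumr; apply: eq_bigr => t _.
  rewrite -mulr_sumr mulrCA; congr (_ * _).
  rewrite exchange_big/= mulr_sumr; apply: eq_bigr => j _.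
  by rewrite -mulr_sumr mulrCA.
have E3 : s * \sum_(i < n) e (A i w) * cond_resid (A i w) (Z i w) =
    s * (\sum_(i < n) \sum_t u t 0 * cond_resid t (Z i w)) +
    \sum_t \sum_z e t * ((nZ Z n z w)%:R / n%:R * cond_resid t z * imb n t z w).
  transitivity (\sum_t e t * (s * \sum_(i < n) (A i w == t)%:R * cond_resid t (Z i w))).
    under [RHS]eq_bigr => t _ do rewrite mulrCA mulr_sumr.
    rewrite -mulr_sumr exchange_big/=; congr (_ * _); apply: eq_bigr => i _.
    rewrite [RHS](bigD1 (A i w))//= eqxx mul1r big1 ?addr0// => t.
    by rewrite eq_sym => /negbTE ->; rewrite mul0r mulr0.
  rewrite exchange_big/= mulr_sumr -big_split/=; apply: eq_bigr => t _.
  rewrite (arm_mean_split Z A pi (fun t' => (t' == t)%:R))//.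
  have -> (G : 'I_k -> R) : \sum_t' (t' == t)%:R * G t' = G t.
    rewrite (bigD1 t)//= eqxx mul1r big1 ?addr0// => t' /negbTE ->.
    by rewrite mul0r.
  rewrite mulrDr; congr (_ + _); last by rewrite mulr_sumr.
  by rewrite -mulr_sumr [LHS]mulrA /e divfK ?gt_eqF// mulrCA.
have E4 : mx_inner (lin_D u) (Dmat pi (Af A n w) (Zf Z n w)) =
    \sum_t \sum_z e t * (pz z * cond_resid t z * imb n t z w).
  rewrite mx_inner_Dmat; apply: eq_bigr => t _; apply: eq_bigr => z _.
  by rewrite mxE enum_rankK !mulrA.
have E5 : \sum_t \sum_z u t 0 / pi t *
    (((nZ Z n z w)%:R / n%:R - pz z) * cond_resid t z * imb n t z w) =
    \sum_t \sum_z e t * ((nZ Z n z w)%:R / n%:R * cond_resid t z * imb n t z w) -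
    \sum_t \sum_z e t * (pz z * cond_resid t z * imb n t z w).
  rewrite -sumrB; apply: eq_bigr => t _; rewrite -sumrB; apply: eq_bigr => z _.
  by rewrite /e; ring.
rewrite E1 E2 /linearized E4 E5 /lin_unit -/s.
have -> : \sum_(i < n) (u (A i w) 0 / pi (A i w) *
     (resid (A i w) (unit_coord Y X i ^~ w) - cond_resid (A i w) (Z i w)) +
    (xlin u (unit_coord Y X i ^~ w) - cond_xlin u (Z i w))) =
    \sum_(i < n) e (A i w) * resid (A i w) (unit_coord Y X i ^~ w)
    - \sum_(i < n) e (A i w) * cond_resid (A i w) (Z i w)
    + (\sum_(i < n) xlin u (unit_coord Y X i ^~ w) - \sum_(i < n) cond_xlin u (Z i w)).
  rewrite -!sumrB -big_split/=; apply: eq_bigr => i _.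
  by rewrite mulrBr.
rewrite /lin_Z big_split/= !mulrDr !mulrN E3; ring.
Qed.

Lemma regular_centred_x j : regular P Y X (centred_x j).
Proof.
by apply: (regular_sub hC1); [exact: (regular_coord hC1)|exact: (regular_cst P Y X)].
Qed.

Lemma regular_resid t : regular P Y X (resid t).
Proof.
apply: (regular_sub hC1).
  by apply: (regular_sub hC1); [exact: (regular_coord hC1)|exact: (regular_cst P Y X)].
by apply: (regular_sum hC1) => j; apply: (regular_scale hC1); exact: regular_centred_x.
Qed.

Lemma regular_xlin u : regular P Y X (xlin u).
Proof.
apply: (regular_sum hC1) => s; apply: (regular_scale hC1).
by apply: (regular_sum hC1) => j; apply: (regular_scale hC1); exact: regular_centred_x.
Qed.

Lemma Ex_centred_x j : Ex P (at0 (centred_x j)) = 0.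
Proof. exact: (Ex_xc (L2_X0 hC1)). Qed.

Lemma Ex_resid t : Ex P (at0 (resid t)) = 0.
Proof. exact: (Ex_res (L2_Y0 hC1) (L2_X0 hC1)). Qed.

Lemma Ex_xlin u : Ex P (at0 (xlin u)) = 0.
Proof.
have rx s : regular P Y X (fun v => \sum_j B j s * centred_x j v).
  by apply: (regular_sum hC1) => j; apply: (regular_scale hC1); exact: regular_centred_x.
rewrite /xlin Ex_sum => [|s _].
  rewrite big1// => s _; rewrite ExZ; last exact: (regular_integrable hC1 (rx s)).
  by rewrite (Ex_xfit (L2_X0 hC1)) mulr0.
exact: (regular_integrable hC1 (regular_scale hC1 _ (rx s))).
Qed.

Lemma full_sum_tight F : regular P Y X F -> Ex P (at0 F) = 0 ->
  tight P (full_sum F).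
Proof.
move=> rF F0; have := arm_sum_tight hC1 hC2 hC3 pzpos pi0 (fun=> 1) rF F0.
move/tight_le; apply => n w; rewrite /full_sum.
by under [in X in _ <= X]eq_bigr => i _ do rewrite mul1r.
Qed.

Variable bhat : nat -> T -> 'M[R]_(p, k).
Hypothesis mbhat : forall n j t, measurable_fun setT (fun w => bhat n w j t).
Hypothesis bhat_cvg : forall j t, cvg_in_prob P (fun n w => bhat n w j t) (B j t).

Let S n w := sqn n *: (theta_hat Y X A n (bhat n w) w - theta P (Y 0%N)).

Lemma linearization_negl u :
  negligible_in_prob P (fun n w => mx_inner u (S n w) - linearized u n w).
Proof.
pose c n t w : R := n%:R / (nt A n t w)%:R.
have nc t : negligible_in_prob P (fun n w => c n t w - (pi t)^-1).
  have := negl_inv (lt0r_neq0 (pi_gt0 t)) (nt_lln hC1 hC2 t).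
  by under eq_fun do under eq_fun do rewrite invf_div.
have tc t : tight P (fun n w => c n t w).
  have := tight_add (negl_tight (nc t)) (tight_cst P (pi t)^-1).
  by under eq_fun do under eq_fun do rewrite subrK.
pose a n w := \sum_t (pi t)^-1 * `|(nt A n t w)%:R / n%:R - pi t|.
pose rem n w := \sum_t u t 0 * ((c n t w - (pi t)^-1) * arm_sum (resid t) t n w
    + \sum_j (B j t - bhat n w j t) *
       (c n t w * arm_sum (centred_x j) t n w - full_sum (centred_x j) n w))
  + \sum_t \sum_z u t 0 / pi t *
    (((nZ Z n z w)%:R / n%:R - pz z) * cond_resid t z * imb n t z w).
apply: (@negl_eq_small _ _ _ P _ rem a 1) => //.
- apply: negl_sum => t _; apply: negl_scale; apply: negl_norm; exact: (nt_lln hC1 hC2).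
- apply: negl_add.
    apply: negl_sum => t _; apply: negl_scale; apply: negl_add.
      apply: negl_mul_tight; first exact: nc.
      exact: (arm_sum_tight hC1 hC2 hC3 pzpos pi0 (fun t' => (t' == t)%:R)
        (regular_resid t) (Ex_resid t)).
    apply: negl_sum => j _; apply: negl_mul_tight.
      apply: negl_le (negl_of_cvg_in_prob (fun n => mbhat n j t) (bhat_cvg j t)) _ => n w.
      by rewrite distrC.
    apply: tight_add.
      apply: tight_mul; first exact: tc.
      exact: (arm_sum_tight hC1 hC2 hC3 pzpos pi0 (fun t' => (t' == t)%:R)
        (regular_centred_x j) (Ex_centred_x j)).
    apply: (tight_le (full_sum_tight (regular_centred_x j) (Ex_centred_x j))) => n w.
    by rewrite normrN.
  apply: negl_sum => t _; apply: negl_sum => z _; apply: negl_scale.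
  apply: negl_mul_tight; last exact: (imbalance_tight hC1 hC2 hC3 pzpos pi0).
  apply: negl_mul_tight; last exact: tight_cst.
  exact: (nZ_lln hC1).
move=> n w aw.
have at_ t : (pi t)^-1 * `|(nt A n t w)%:R / n%:R - pi t| < 1.
  apply: le_lt_trans aw; apply: le_trans (ler_norm _).
  rewrite /a (bigD1 t)//= lerDl; apply: sumr_ge0 => s _.
  by rewrite mulr_ge0// invr_ge0.
have npos t : 0 < (nt A n t w)%:R / n%:R :> R.
  have := at_ t; rewrite mulrC ltr_pdivrMr// mul1r.
  by rewrite ltr_distl => /andP[]; rewrite subrr.
have n0 : (0 < n)%N.
  by rewrite lt0n; apply/negP => /eqP e; have := npos t0; rewrite e invr0 mulr0 ltxx.
have nt0 t : (0 < nt A n t w)%N.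
  by rewrite lt0n; apply/negP => /eqP e; have := npos t; rewrite e mul0r ltxx.
rewrite mx_inner_sum.
have hS t : S n w t 0 = sqn n * (theta_hat Y X A n (bhat n w) w t 0 - th t).
  by rewrite /S [LHS]mxE; congr (_ * _); rewrite [LHS]mxE; congr (_ + _); rewrite [LHS]mxE.
under eq_bigr => t _ do rewrite hS (theta_hat_expand _ n0 (nt0 t)) /=.
rewrite /rem.
have := arm_sum_split u w n0.
set L := linearized u n w => h.
rewrite [X in _ = _ + X](_ : _ = \sum_t u t 0 / pi t * arm_sum (resid t) t n w
  + \sum_t u t 0 * (\sum_j B j t * full_sum (centred_x j) n w) - L); last first.
  by rewrite h addrC addKr.
rewrite addrA; congr (_ - _); rewrite addrA -!big_split/=; apply: eq_bigr => t _.
by rewrite -/(c n t w); ring.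
Qed.

Lemma measurable_theta_hat n i : measurable_fun setT (fun w => S n w i 0).
Proof.
have [mY [mX _]] := hC1.
have fA := @finite_rv_A _ _ _ _ _ _ _ _ _ _ _ _ hC2.
have mind j t : measurable_fun setT (fun w => (A j w == t)%:R : R).
  exact: (measurable_finite_rv (fun a => (a == t)%:R) (fA j)).
have marm (f : nat -> T -> R) t : (forall j, measurable_fun setT (f j)) ->
    measurable_fun setT (fun w => (\sum_(j < n | A j w == t) f j w) / (nt A n t w)%:R).
  move=> mf; apply: measurable_funM.
    under eq_fun do rewrite big_mkcond/=.
    apply: measurable_sumr => j _.
    rewrite (_ : (fun w => _) = fun w => (A j w == t)%:R * f j w).
      exact: measurable_funM.
    by apply/funext => w; case: (_ == _); rewrite (mul1r, mul0r).
  have := measurable_AZ hC1 hC2 (fun (a : {ffun 'I_n -> 'I_k}) (_ : {ffun 'I_n -> zT}) =>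
    ((\sum_j (a j == t))%N%:R)^-1 : R).
  apply: eq_measurable_fun => w _; rewrite ntE; congr (_%:R^-1).
  by apply: eq_bigr => j _; rewrite ffunE.
under eq_fun do rewrite !mxE.
apply: measurable_scale; apply: measurable_funB => //.
apply: measurable_funB; first exact: (marm (fun j => Y j i)).
apply: measurable_sumr => j _; apply: measurable_funM; first exact: mbhat.
apply: measurable_funB; first exact: (marm (fun l => X l j)).
by apply: measurable_funM => //; apply: measurable_sumr => l _.
Qed.

Definition tau u : R :=
  \sum_t \sum_z pi t * pz z * condE_Z P (Z 0%N) (fun w => at0 (lin_unit u t z) w ^+ 2) z
  + Ex P (fun w => lin_Z u (Z 0%N w) ^+ 2) + Dform P Z Omg (lin_D u).

Lemma regular_lin_unit u t z : regular P Y X (lin_unit u t z).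
Proof.
apply: (regular_add hC1).
  apply: (regular_scale hC1); apply: (regular_sub hC1); first exact: regular_resid.
  exact: (regular_cst P Y X).
by apply: (regular_sub hC1); [exact: regular_xlin|exact: (regular_cst P Y X)].
Qed.

Lemma charfun_cvg u (a : R) :
  Ex P (fun w => cos (mx_inner u (S n w) + a)) @[n --> \oo] -->
  cos a * expR (- (tau u / 2)).
Proof.
have fz := @finite_rv_Z _ _ _ _ _ _ _ _ _ _ hC1 0.
have c0 F z : regular P Y X F -> cond (fun v => F v - cond F z) z = 0.
  move=> rF; rewrite (condE_sub_cst fz pzpos) ?subrr//.
  exact: (regular_integrable hC1 rF).
have ic F (b : R) : regular P Y X F ->
    P.-integrable setT (EFin \o at0 (fun v => F v - b)).
  by move=> rF; exact: (regular_integrable hC1 (regular_sub hC1 rF (regular_cst P Y X b))).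
have xi0 t z : cond (lin_unit u t z) z = 0.
  transitivity (condE_Z P (Z 0%N) (fun w =>
      u t 0 / pi t * at0 (fun v => resid t v - cond_resid t z) w +
      1 * at0 (fun v => xlin u v - cond_xlin u z) w) z).
    by congr (condE_Z _ _ _ _); apply/funext => w; rewrite mul1r.
  rewrite (condE_linear fz); [|exact: (ic _ _ (regular_resid t))
                              |exact: (ic _ _ (regular_xlin u))].
  by rewrite !c0 ?mulr0 ?addr0//; [exact: regular_xlin|exact: regular_resid].
have g0 : Ex P (fun w => lin_Z u (Z 0%N w)) = 0.
  have iz (h : zT -> R) : P.-integrable setT (EFin \o (fun w => h (Z 0%N w))).
    exact: integrable_finite_rv.
  rewrite /lin_Z ExD; [|exact: (iz (fun z => \sum_t u t 0 * cond_resid t z))|exact: iz].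
  rewrite (Ex_cond hC1 pzpos (regular_xlin u)) Ex_xlin addr0.
  rewrite Ex_sum => [|t _]; last exact: (iz (fun z => u t 0 * cond_resid t z)).
  rewrite big1// => t _; rewrite ExZ; last exact: iz.
  by rewrite (Ex_cond hC1 pzpos (regular_resid t)) Ex_resid mulr0.
apply: (@cvg_Ex_cos_of_negl _ _ _ _ _ (linearized u)).
- move=> n; under eq_fun do rewrite mx_inner_sum; apply: measurable_sumr => i _.
  by apply: measurable_scale; exact: measurable_theta_hat.
- by move=> n; apply: (measurable_sums hC1 hC2) => t z; exact: regular_lin_unit.
- exact: linearization_negl.
apply: (@master_clt _ _ _ _ _ _ _ _ _ _ _ _ _ hC1 hC2 hC3 pzpos pi0
  (lin_unit u) (lin_Z u) (lin_D u)) => //.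
- by move=> t z v v'; have [+ _] := regular_lin_unit u t z; exact.
- by move=> t z; have [] := regular_lin_unit u t z.
Qed.

End Linearization.

Section LimitVariance.
Context {R : realType} {d : measure_display} {T : measurableType d}.
Variables (P : probability T R) (k p : nat) (zT : finType).
Variables (Y : nat -> 'I_k -> T -> R) (Z : nat -> T -> zT)
          (X : nat -> 'I_p -> T -> R) (A : nat -> T -> 'I_k) (pi : 'I_k -> R)
          (Omg : zT -> 'M[R]_k).
Hypotheses (hC1 : C1 P Y Z X) (hC2 : C2 P Y Z X A pi) (hC3 : C3 P Z A pi Omg).
Hypothesis pzpos : forall z, 0 < pz P Z z.
Hypothesis pi_gt0 : forall t, 0 < pi t.
Hypothesis sum_pi : \sum_t pi t = 1.
Hypothesis pdX : posdef (SigmaX P (X 0%N)).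
Variable B : 'M[R]_(p, k).
Local Notation Y0 := (Y 0%N).
Local Notation X0 := (X 0%N).
Local Notation Z0 := (Z 0%N).
Local Notation tilde := (tilde P Z0).
Local Notation r := (res P Y0 X0 B).
Local Notation x := (xfit P X0 B).

Let fz : finite_rv Z0 := @finite_rv_Z _ _ _ _ _ _ _ _ _ _ hC1 0.

Lemma Dform_lin_D u :
  Dform P Z Omg (lin_D P Y Z X pi B u) = imbalance_form P Y0 Z0 X0 pi Omg B u.
Proof.
rewrite (imbalance_formE _ _ _ _ _ fz); apply: eq_bigr => z _.
rewrite quad_formE mulr_suml mulr_sumr; apply: eq_bigr => s _.
rewrite mulr_suml mulr_sumr; apply: eq_bigr => t _.
rewrite [col _ _ s 0]mxE [col _ _ t 0]mxE [lin_D _ _ _ _ _ _ _ s _]mxE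
  [lin_D _ _ _ _ _ _ _ t _]mxE !enum_rankK.
have := pzpos z; rewrite /pz => /lt0r_neq0; rewrite /cond_resid.
rewrite -[condE_Z _ _ (fun w => resid _ _ _ _ s _) _]/(condE_Z P Z0 (r s) z).
rewrite -[condE_Z _ _ (fun w => resid _ _ _ _ t _) _]/(condE_Z P Z0 (r t) z).
move=> pz0; have ps := lt0r_neq0 (pi_gt0 s); have pt := lt0r_neq0 (pi_gt0 t).
by field; rewrite pz0 ps pt.
Qed.

Lemma imbalance_form_ge0 u : 0 <= imbalance_form P Y0 Z0 X0 pi Omg B u.
Proof. by rewrite -Dform_lin_D; exact: (Dform_ge0 hC3). Qed.

Lemma tau_quad u : tau P Y Z X pi Omg B u =
  (u^T *m Vmat P Y0 Z0 X0 pi Omg B *m u) 0 0.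
Proof.
rewrite (Vmat_quad _ (L2_Y0 hC1) (L2_X0 hC1) fz pzpos pi_gt0 pdX) /tau Dform_lin_D.
congr (_ + _).
pose xu w := \sum_s u s 0 * x s w; pose yu w := \sum_s u s 0 * yc P Y0 s w.
have lr t : L2 P (r t) by exact: (L2_res (L2_Y0 hC1) (L2_X0 hC1)).
have lx t : L2 P (x t) by exact: (L2_xfit (L2_X0 hC1)).
have ly t : L2 P (yc P Y0 t) by exact: (L2_yc (L2_Y0 hC1)).
have lxu : L2 P xu by apply: L2_sum => t; exact: L2_scale.
have lyu : L2 P yu by apply: L2_sum => t; exact: L2_scale.
have ltr t : L2 P (tilde (r t)) by exact: L2_tilde.
have ltx : L2 P (tilde xu) by exact: L2_tilde.
pose ru w := \sum_t u t 0 * tilde (r t) w.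
have lru : L2 P ru by apply: L2_sum => t; exact: L2_scale.
have lur : L2 P (fun w => \sum_t u t 0 * r t w).
  by apply: L2_sum => t; exact: L2_scale.
have yuE : yu = fun w => (\sum_t u t 0 * r t w) + xu w.
  apply/funext => w'; rewrite -big_split/=; apply: eq_bigr => t _.
  by rewrite -mulrDr /res subrK.
have yrx w : tilde yu w = ru w + tilde xu w by rewrite yuE tilde_add// tilde_sum.
have gE w : lin_Z P Y Z X B u (Z0 w) = condE_Z P Z0 yu (Z0 w).
  rewrite (_ : yu = fun w => 1 * (\sum_t u t 0 * r t w) + 1 * xu w); last first.
    by rewrite yuE; apply/funext => v; rewrite !mul1r.
  rewrite (condE_linear _ _ _ _ (L2_integrable lur) (L2_integrable lxu))// !mul1r.
  by rewrite condE_sum// => t; exact: L2_integrable.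
have t1 : \sum_t \sum_z pi t * pz P Z z * condE_Z P Z0 (fun w =>
    lin_unit P Y Z X pi B u t z (unit_coord Y X 0 ^~ w) ^+ 2) z =
    \sum_t u t 0 ^+ 2 / pi t * res_cov P Y0 Z0 X0 B t t
    + (2 * Ex P (fun w => ru w * tilde xu w) + Ex P (fun w => tilde xu w ^+ 2)).
  have -> : Ex P (fun w => ru w * tilde xu w) =
      \sum_t u t 0 * Ex P (fun w => tilde (r t) w * tilde xu w).
    have i t := L2_mul_integrable (ltr t) ltx.
    under [RHS]eq_bigr => t _ do rewrite -(ExZ _ (i t)).
    rewrite -Ex_sum => [|t _]; last exact: integrable_scale.
    by congr Ex; apply/funext => w; rewrite mulr_suml; apply: eq_bigr => t _; rewrite mulrA.
  rewrite [X in _ = _ + (_ + X)](_ : _ = \sum_t pi t * Ex P (fun w => tilde xu w ^+ 2));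
    last by rewrite -mulr_suml sum_pi mul1r.
  rewrite mulr_sumr -!big_split/=.
  apply: eq_bigr => t _; under eq_bigr => z _ do rewrite -mulrA.
  rewrite -mulr_sumr (sum_condE fz pzpos (f := fun z w =>
    lin_unit P Y Z X pi B u t z (unit_coord Y X 0 ^~ w) ^+ 2)); last first.
    by move=> z; have [] := regular_lin_unit pi hC1 B u t z.
  pose e := u t 0 / pi t.
  have -> : (fun w => lin_unit P Y Z X pi B u t (Z0 w) (unit_coord Y X 0 ^~ w) ^+ 2) =
      fun w => e ^+ 2 * (tilde (r t) w * tilde (r t) w) +
        (2 * e * (tilde (r t) w * tilde xu w) + tilde xu w ^+ 2).
    apply/funext => w.
    rewrite (_ : lin_unit _ _ _ _ _ _ _ _ _ _ = e * tilde (r t) w + tilde xu w)//; ring.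
  have i1 := L2_mul_integrable (ltr t) (ltr t).
  have i2 := L2_mul_integrable (ltr t) ltx.
  have [_ i3] := ltx.
  rewrite ExD; [|exact: integrable_scale|]; last first.
    by apply: integrable_addr => //; exact: integrable_scale.
  rewrite (ExZ _ i1) ExD//; last exact: integrable_scale.
  rewrite (ExZ _ i2) -/(res_cov P Y0 Z0 X0 B t t) /e.
  by field; rewrite gt_eqF.
rewrite t1 (_ : (fun w => lin_Z _ _ _ _ _ _ _ ^+ 2) =
  fun w => condE_Z P Z0 yu (Z0 w) * condE_Z P Z0 yu (Z0 w)); last first.
  by apply/funext => w; rewrite gE expr2.
have := Ex_tilde_mul fz pzpos lyu lyu.
have -> : (fun w => tilde yu w * tilde yu w) =
    fun w => ru w ^+ 2 + (2 * (ru w * tilde xu w) + tilde xu w ^+ 2).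
  by apply/funext => w; rewrite yrx; ring.
have [_ i1] := lru; have i2 := L2_mul_integrable lru ltx; have [_ i3] := ltx.
rewrite (ExD i1); last by apply: integrable_addr => //; exact: integrable_scale.
rewrite ExD//; last exact: integrable_scale.
rewrite (ExZ _ i2) (_ : (fun w => yu w * yu w) = fun w => yu w ^+ 2); last first.
  by apply/funext => w; rewrite expr2.
rewrite -/ru -/yu; set a := Ex P _; set b := Ex P _; lra.
Qed.

Lemma tau_ge0 u : 0 <= tau P Y Z X pi Omg B u.
Proof.
rewrite /tau !addr_ge0 ?(Dform_ge0 hC3)//; last by apply: Ex_ge0 => w; exact: sqr_ge0.
apply: sumr_ge0 => t _; apply: sumr_ge0 => z _.
rewrite mulr_ge0//; first by rewrite mulr_ge0// ltW.
rewrite /condE_Z divr_ge0 ?prob_ge0//; apply: Ex_ge0 => w.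
by rewrite mulr_ge0// sqr_ge0.
Qed.

End LimitVariance.
Theorem theorem3 (R : realType) (d : measure_display) (T : measurableType d)
  (P : probability T R) (k p : nat) (zT : finType)
  (Y : nat -> 'I_k -> T -> R) (Z : nat -> T -> zT) (X : nat -> 'I_p -> T -> R)
  (A : nat -> T -> 'I_k) (pi : 'I_k -> R) (Omg : zT -> 'M[R]_k)
  (bhat : nat -> T -> 'M[R]_(p, k)) (B : 'M[R]_(p, k)) :
  (forall t, 0 < pi t < 1) -> \sum_t pi t = 1 ->
  C1 P Y Z X ->
  posdef (SigmaX P (X 0%N)) ->
  C2 P Y Z X A pi ->
  C3 P Z A pi Omg ->
  (* I(Z = z) is an affine function of X *)
  (forall z : zT, exists (c0 : R) (c : 'cV[R]_p), forall i,
     {ae P, forall w, (Z i w == z)%:R = c0 + \sum_j c j 0 * X i j w}) ->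
  (* bhat_t -> b_t in probability *)
  (forall n j t, measurable_fun setT (fun w => bhat n w j t)) ->
  (forall j t, cvg_in_prob P (fun n w => bhat n w j t) (B j t)) ->
  let V := Vmat P (Y 0%N) (Z 0%N) (X 0%N) pi Omg in
  (* (i) *)
  cvg_dist_normal P
    (fun n w => Num.sqrt n%:R *: (theta_hat Y X A n (bhat n w) w - theta P (Y 0%N)))
    (fun u => (u^T *m V B *m u) 0 0) /\
  (forall z, Rmat P (Y 0%N) (Z 0%N) (X 0%N) pi (scriptB P (Y 0%N) (X 0%N)) z = 0) /\
  V (scriptB P (Y 0%N) (X 0%N)) = VSR P (Y 0%N) (X 0%N) pi (scriptB P (Y 0%N) (X 0%N)) /\
  (* (ii) *)
  (forall B' : 'M[R]_(p, k), psd (V B' - V (scriptB P (Y 0%N) (X 0%N)))).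
Proof.
move=> pi01 sum_pi hC1 pdX hC2 hC3 affine mbhat bhat_cvg V.
have pi_gt0 t : 0 < pi t by have /andP[] := pi01 t.
have t0 : 'I_k.
  have [t _|no_arm] := pickP (fun _ : 'I_k => true); first exact: t.
  exfalso; move: sum_pi; rewrite big_pred0 // => /eqP.
  by rewrite eq_sym oner_eq0.
have pzpos z : 0 < pz P Z z := pz_gt0 hC1 hC2 z (pi_gt0 t0).
have lY := L2_Y0 hC1; have lX := L2_X0 hC1.
have fz := @finite_rv_Z _ _ _ _ _ _ _ _ _ _ hC1 0.
have affine0 z : exists (c0 : R) (c : 'cV[R]_p),
    {ae P, forall w, (Z 0%N w == z)%:R = c0 + \sum_j c j 0 * X 0%N j w}.
  by have [c0 [c h]] := affine z; exists c0, c.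
split; last split; last split.
- apply: cvg_dist_of_charfun.
  + move=> u; rewrite -(tau_quad Omg hC1 pzpos pi_gt0 sum_pi pdX).
    exact: (tau_ge0 _ _ hC3 pzpos pi_gt0).
  + exact: (measurable_theta_hat hC1 hC2 mbhat).
  + move=> u a; rewrite -(tau_quad Omg hC1 pzpos pi_gt0 sum_pi pdX).
    exact: (charfun_cvg hC1 hC2 hC3 pzpos pi_gt0 t0 mbhat bhat_cvg).
- exact: (Rmat_scriptB pi lY lX fz pdX affine0).
- exact: (Vmat_scriptB pi Omg lY lX fz pdX affine0).
- move=> B'; apply: (Vmat_sub_psd lY lX fz pzpos pi_gt0 sum_pi pdX affine0).
  exact: (imbalance_form_ge0 hC1 hC3 pzpos pi_gt0).
Qed.
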